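(* Let $(n_j)_{j\ge 1}$ be a strictly increasing sequence of positive integers and let $(z_j)_{j\ge 1}$ be a sequence of complex numbers such that $B_{n_j}(n_j z_j)=0$ for every $j$ and $z_j\to z^*\in\mathbb{C}$ as $j\to\infty$. If $\operatorname{Im}(z^* )>0$, then $e^{2\pi \operatorname{Im}(z^* )}=2\pi e\,|z^*|$. If $\operatorname{Im}(z^* )<0$, then $e^{-2\pi \operatorname{Im}(z^* )}=2\pi e\,|z^*|$.
   Context: For $n\ge 0$, $B_n(z)$ denotes the $n$-th Bernoulli polynomial, defined by the generating function $\sum_{k=0}^\infty B_k(z)\frac{t^k}{k!}=\frac{t e^{zt}}{e^t-1}$, regarded as a polynomial in the complex variable $z$. In the claim, $e$ is the base of the natural logarithm. *)

(* Defs.v *)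
From Stdlib Require Import Reals Factorial.
From Coquelicot Require Import Coquelicot.

Open Scope R_scope.
Open Scope C_scope.

Definition Cexp (z : C) : C :=
  (exp (Re z) * cos (Im z), exp (Re z) * sin (Im z))%R.

(* The generating function identity
     sum_k B_k(z) t^k / k! = t e^(z t) / (e^t - 1)
   as an identity of convergent series for t near 0.  The point t = 0, where the
   right-hand side has a removable singularity, is excluded.  By uniqueness of
   power series coefficients this determines every value B k z. *)
Definition is_bernoulli_polynomials (B : nat -> C -> C) : Prop :=
  forall z : C, exists r : R, (0 < r)%R /\
    forall t : C, (0 < Cmod t < r)%R ->
      @is_series C_AbsRing C_NormedModule
        (fun k : nat => B k z * (t ^ k / RtoC (INR (fact k))))
        (t * Cexp (z * t) / (Cexp t - 1)).

(* Main.v *)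
Require Import Defs.
From Stdlib Require Import Reals ZArith Lra Lia Factorial.
From Coquelicot Require Import Coquelicot.
Local Open Scope R_scope.

(** Up to n!, the number B_n(nz) is the coefficient of t^n in t e^(nzt) / (e^t - 1), the
    contour integral of (e^(zt) / t)^n / (e^t - 1).  Two kinds of quantities compete in it:
    the saddle point t = 1/z of e^(zt) / t, where its modulus is e |z|, and the poles
    2 pi i m, m <> 0.  Only the poles with |zt| <= 1 matter, and the strongest of them is the
    one nearest to 0 with Re (zt) > 0, of modulus e^(2 pi |Im z|) / (2 pi).  If the two moduli differ at the
    limit point, one contribution dominates and B_n(nz) cannot vanish for large n.

    No contour integral is needed.  Euler's partial fractions of the cotangent
    ([cotan_partial_fractions]) give the Taylor coefficients of t / (e^t - 1) as sums over
    the poles ([bernoulli_formula]), and turn B_n(nz) / (nz)^n into 1 - 1/(2z) minus the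
    sum over m >= 1 of S_n(m w) + S_n(- m w), where w = 2 pi i z and S_n(w) is the section
    of the series of exp (n w), normalised by its term of index n
    ([scaled_bernoulli_pole_pairs]).

    The asymptotics of S_n are Szego's: S_n(w) tends to 1 / (w - 1), plus, when
    |w| <= 1, the normalised exponential n! exp (n w) / (n w)^n.  Two summations by
    parts prove this for |w| >= 1 and |w| <= 1 separately, with bounds that remain valid on
    the circle |w| = 1 away from w = 1 ([slow_csum_limit], [exp_section_limit_out],
    [exp_section_limit_in]).  The normalised exponential is governed by the rate
    |e^w / w| compared with e, which for w = 2 pi i z or its opposite is exactly the
    comparison of pole and saddle.

    If the first pole has rate above e and lies in the unit disk, its exponential outgrows
    all other terms ([no_zeros_when_pole_dominates]).  Otherwise, unless the rate is exactly
    e, no exponential matters and B_n(nz) / (nz)^n converges locally uniformly.  That the limit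
    is nonzero is seen without computing it: B_n(x + 1) - B_n(x) = n x^(n-1) makes the
    values at z and z + 1/n differ by a quantity bounded below when the first one vanishes
    ([no_zeros_when_saddle_dominates]). *)

(** * Finite sums *)

(** Both sums run over the indices strictly below [N], which keeps telescoping
    and splitting free of predecessors. *)
Fixpoint rsum (f : nat -> R) (N : nat) : R :=
  match N with O => 0 | S N => rsum f N + f N end.

Fixpoint csum (f : nat -> C) (N : nat) : C :=
  match N with O => RtoC 0 | S N => (csum f N + f N)%C end.

Lemma rsum_ext f g N : (forall i, (i < N)%nat -> f i = g i) -> rsum f N = rsum g N.
Proof.
  induction N as [|N IH]; intros H; simpl; [reflexivity|].
  rewrite IH, H; auto with arith.
Qed.

Lemma rsum_le f g N : (forall i, (i < N)%nat -> f i <= g i) -> rsum f N <= rsum g N.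
Proof.
  induction N as [|N IH]; intros H; simpl; [lra|].
  specialize (IH (fun i Hi => H i (Nat.lt_lt_succ_r _ _ Hi))).
  specialize (H N (Nat.lt_succ_diag_r N)). lra.
Qed.

Lemma rsum_plus f g N : rsum (fun i => f i + g i) N = rsum f N + rsum g N.
Proof. induction N as [|N IH]; simpl; [|rewrite IH]; ring. Qed.

Lemma rsum_minus f g N : rsum (fun i => f i - g i) N = rsum f N - rsum g N.
Proof. induction N as [|N IH]; simpl; [|rewrite IH]; ring. Qed.

Lemma rsum_scal c f N : rsum (fun i => c * f i) N = c * rsum f N.
Proof. induction N as [|N IH]; simpl; [|rewrite IH]; ring. Qed.

Lemma rsum_zero N : rsum (fun _ => 0) N = 0.
Proof. induction N as [|N IH]; simpl; [|rewrite IH]; ring. Qed.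

Lemma rsum_pos f N : (forall i, (i < N)%nat -> 0 <= f i) -> 0 <= rsum f N.
Proof. intros H. rewrite <- (rsum_zero N). apply rsum_le; auto. Qed.

Lemma Rabs_rsum_le f g N :
  (forall i, (i < N)%nat -> Rabs (f i) <= g i) -> Rabs (rsum f N) <= rsum g N.
Proof.
  induction N as [|N IH]; intros H; simpl.
  - rewrite Rabs_R0. lra.
  - eapply Rle_trans; [apply Rabs_triang|].
    apply Rplus_le_compat; [apply IH|]; auto with arith.
Qed.

Lemma rsum_split f M N : rsum f (M + N) = rsum f M + rsum (fun i => f (M + i)%nat) N.
Proof.
  induction N as [|N IH].
  - rewrite Nat.add_0_r. simpl. ring.
  - rewrite Nat.add_succ_r. simpl. rewrite IH. ring.
Qed.

Lemma rsum_head f N : rsum f (S N) = f O + rsum (fun i => f (S i)) N.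
Proof. change (S N) with (1 + N)%nat. rewrite rsum_split. simpl. ring. Qed.

Lemma rsum_mono f M N : (M <= N)%nat -> (forall i, 0 <= f i) -> rsum f M <= rsum f N.
Proof.
  intros H Hf. replace N with (M + (N - M))%nat by lia. rewrite rsum_split.
  assert (0 <= rsum (fun i => f (M + i)%nat) (N - M)) by (apply rsum_pos; auto). lra.
Qed.

Lemma rsum_rev f N : rsum (fun i => f (N - S i)%nat) N = rsum f N.
Proof.
  induction N as [|N IH]; [reflexivity|].
  rewrite rsum_head. simpl (rsum f (S N)). rewrite <- IH.
  replace (S N - 1)%nat with N by lia. rewrite Rplus_comm. f_equal.
Qed.

Lemma rsum_double f N : rsum f (2 * N) = rsum (fun i => f (2 * i)%nat + f (2 * i + 1)%nat) N.
Proof.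
  induction N as [|N IH]; [reflexivity|].
  replace (2 * S N)%nat with (S (S (2 * N))) by lia. cbn [rsum].
  rewrite IH. replace (2 * N + 1)%nat with (S (2 * N)) by lia. ring.
Qed.

Lemma rsum_geom q N : (1 - q) * rsum (fun k => q ^ k) N = 1 - q ^ N.
Proof.
  induction N as [|N IH]; simpl; [ring|].
  rewrite Rmult_plus_distr_l, IH. ring.
Qed.

Lemma sum_n_rsum (a : nat -> R) N : sum_n a N = rsum a (S N).
Proof.
  induction N as [|N IH].
  - rewrite sum_O. simpl. ring.
  - rewrite sum_Sn, IH. reflexivity.
Qed.

Lemma csum_ext f g N : (forall i, (i < N)%nat -> f i = g i) -> csum f N = csum g N.
Proof.
  induction N as [|N IH]; intros H; simpl; [reflexivity|].
  rewrite IH, H; auto with arith.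
Qed.

Lemma csum_plus f g N : csum (fun i => f i + g i)%C N = (csum f N + csum g N)%C.
Proof. induction N as [|N IH]; simpl; [|rewrite IH]; ring. Qed.

Lemma csum_scal c f N : csum (fun i => c * f i)%C N = (c * csum f N)%C.
Proof. induction N as [|N IH]; simpl; [|rewrite IH]; ring. Qed.

Lemma csum_zero N : csum (fun _ => RtoC 0) N = RtoC 0.
Proof. induction N as [|N IH]; simpl; [|rewrite IH]; ring. Qed.

Lemma csum_split f M N :
  csum f (M + N) = (csum f M + csum (fun i => f (M + i)%nat) N)%C.
Proof.
  induction N as [|N IH].
  - rewrite Nat.add_0_r. simpl. ring.
  - rewrite Nat.add_succ_r. simpl. rewrite IH. ring.
Qed.

Lemma csum_head f N : csum f (S N) = (f O + csum (fun i => f (S i)) N)%C.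
Proof. change (S N) with (1 + N)%nat. rewrite csum_split. simpl. ring. Qed.

Lemma csum_rev f N : csum (fun i => f (N - S i)%nat) N = csum f N.
Proof.
  induction N as [|N IH]; [reflexivity|].
  rewrite csum_head. simpl (csum f (S N)). rewrite <- IH.
  replace (S N - 1)%nat with N by lia. rewrite Cplus_comm. f_equal.
Qed.

Lemma csum_exchange (f : nat -> nat -> C) M N :
  csum (fun i => csum (fun j => f i j) N) M = csum (fun j => csum (fun i => f i j) M) N.
Proof.
  induction M as [|M IH]; simpl.
  - symmetry. apply csum_zero.
  - rewrite IH, <- csum_plus. apply csum_ext. reflexivity.
Qed.

Lemma Cmod_csum f N : Cmod (csum f N) <= rsum (fun i => Cmod (f i)) N.
Proof.
  induction N as [|N IH]; simpl.
  - rewrite Cmod_0. lra.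
  - eapply Rle_trans; [apply Cmod_triangle|lra].
Qed.

Lemma Re_csum f N : Re (csum f N) = rsum (fun i => Re (f i)) N.
Proof. induction N as [|N IH]; [reflexivity|]. simpl rsum. rewrite <- IH. reflexivity. Qed.

Lemma Im_csum f N : Im (csum f N) = rsum (fun i => Im (f i)) N.
Proof. induction N as [|N IH]; [reflexivity|]. simpl rsum. rewrite <- IH. reflexivity. Qed.

Lemma csum_RtoC f N : csum (fun i => RtoC (f i)) N = RtoC (rsum f N).
Proof. induction N as [|N IH]; simpl; [|rewrite IH, RtoC_plus]; reflexivity. Qed.

Lemma sum_n_csum (a : nat -> C) N : sum_n a N = csum a (S N).
Proof.
  induction N as [|N IH].
  - rewrite sum_O. simpl. ring.
  - rewrite sum_Sn, IH. reflexivity.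
Qed.

(** * Complex power series along a real line *)

Lemma Ceq_parts (x y : C) : Re x = Re y -> Im x = Im y -> x = y.
Proof. destruct x, y; simpl; intros; subst; reflexivity. Qed.

Lemma Cmod_le_parts (x : C) : Cmod x <= Rabs (Re x) + Rabs (Im x).
Proof.
  replace x with (RtoC (Re x) + Ci * RtoC (Im x))%C at 1
    by (apply Ceq_parts; simpl; ring).
  eapply Rle_trans; [apply Cmod_triangle|].
  rewrite Cmod_mult, Cmod_Ci, !Cmod_R. lra.
Qed.

Lemma Rabs_Re_le (x : C) : Rabs (Re x) <= Cmod x.
Proof. apply re_le_Cmod. Qed.

Lemma Rabs_Im_le (x : C) : Rabs (Im x) <= Cmod x.
Proof. eapply Rle_trans; [apply Rmax_r|apply Rmax_Cmod]. Qed.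

Lemma is_lim_seq_0_abs_le (u v : nat -> R) :
  (forall n, Rabs (u n) <= v n) -> is_lim_seq v 0 -> is_lim_seq u 0.
Proof.
  intros H Hv. apply is_lim_seq_abs_0.
  apply is_lim_seq_le_le with (fun _ => 0) v; auto.
  - intros n; split; [apply Rabs_pos|apply H].
  - apply is_lim_seq_const.
Qed.

(** The uniform structure of C is the product one, whereas [Cmod] is Euclidean; the
    two are equivalent up to a factor sqrt 2. *)
Lemma filterlim_Cmod (u : nat -> C) (l : C) :
  filterlim u eventually (locally l) <-> is_lim_seq (fun n => Cmod (u n - l)) 0.
Proof.
  split; intros H.
  - apply is_lim_seq_spec. intros eps.
    assert (He : 0 < eps / sqrt 2)
      by (apply Rdiv_lt_0_compat; [apply cond_pos|apply sqrt_lt_R0; lra]).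
    destruct (H (ball l (mkposreal _ He)) (locally_ball l (mkposreal _ He))) as [N HN].
    exists N. intros n Hn. specialize (HN n Hn).
    apply C_NormedModule_mixin_compat2 in HN. simpl in HN.
    rewrite Rminus_0_r, Rabs_pos_eq by apply Cmod_ge_0.
    replace (pos eps) with (sqrt 2 * (eps / sqrt 2)).
    + exact HN.
    + field. apply Rgt_not_eq, sqrt_lt_R0. lra.
  - intros P [eps HP]. apply is_lim_seq_spec in H. destruct (H eps) as [N HN].
    exists N. intros n Hn. apply HP. apply C_NormedModule_mixin_compat1.
    specialize (HN n Hn). rewrite Rminus_0_r, Rabs_pos_eq in HN by apply Cmod_ge_0.
    exact HN.
Qed.

Lemma is_Cseries_Cmod (a : nat -> C) (l : C) :
  @is_series C_AbsRing C_NormedModule a l <->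
  is_lim_seq (fun N => Cmod (csum a N - l)) 0.
Proof.
  unfold is_series. rewrite filterlim_Cmod.
  split; intros H.
  - apply is_lim_seq_incr_1. eapply is_lim_seq_ext; [|exact H].
    intros n. simpl. rewrite sum_n_csum. reflexivity.
  - apply is_lim_seq_incr_1 in H. eapply is_lim_seq_ext; [|exact H].
    intros n. simpl. rewrite sum_n_csum. reflexivity.
Qed.

Lemma is_Rseries_rsum (a : nat -> R) (l : R) :
  is_series a l <-> is_lim_seq (rsum a) l.
Proof.
  change (is_series a l) with (is_lim_seq (sum_n a) l). split; intros H.
  - apply is_lim_seq_incr_1. eapply is_lim_seq_ext; [|exact H].
    intros n. apply sum_n_rsum.
  - apply is_lim_seq_incr_1 in H. eapply is_lim_seq_ext; [|exact H].
    intros n. symmetry. apply sum_n_rsum.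
Qed.

Lemma is_lim_seq_minus_0 (u : nat -> R) (l : R) :
  is_lim_seq u l <-> is_lim_seq (fun n => u n - l) 0.
Proof.
  split; intros H.
  - replace 0 with (l - l) by ring.
    apply is_lim_seq_minus'; [exact H|apply is_lim_seq_const].
  - replace l with (0 + l) by ring.
    eapply is_lim_seq_ext; [|apply is_lim_seq_plus'; [exact H|apply is_lim_seq_const]].
    intros n. simpl. ring.
Qed.

Lemma is_Cseries_parts (a : nat -> C) (l : C) :
  @is_series C_AbsRing C_NormedModule a l <->
  is_series (fun n => Re (a n)) (Re l) /\ is_series (fun n => Im (a n)) (Im l).
Proof.
  rewrite is_Cseries_Cmod, !is_Rseries_rsum, (is_lim_seq_minus_0 _ (Re l)),
    (is_lim_seq_minus_0 _ (Im l)).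
  split.
  - intros H. split; (eapply is_lim_seq_0_abs_le; [|exact H]); intros n; simpl.
    + rewrite <- Re_csum. apply (Rabs_Re_le (csum a n - l)).
    + rewrite <- Im_csum. apply (Rabs_Im_le (csum a n - l)).
  - intros [H1 H2]. apply is_lim_seq_0_abs_le with
      (fun n => Rabs (rsum (fun k => Re (a k)) n - Re l) +
                Rabs (rsum (fun k => Im (a k)) n - Im l)).
    + intros n. rewrite Rabs_pos_eq by apply Cmod_ge_0.
      rewrite <- Re_csum, <- Im_csum. apply (Cmod_le_parts (csum a n - l)).
    + replace 0 with (0 + 0) by ring.
      apply is_lim_seq_plus'; apply -> is_lim_seq_abs_0; assumption.
Qed.

(** Nothing is known about the sum at 0 itself, so the identity theorem is applied
    to x times the series, whose sum vanishes at 0 automatically. *)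
Lemma pseries_zero_coeffs (a : nat -> R) (r : R) :
  0 < r -> (forall x, 0 < Rabs x < r -> is_series (fun k => a k * x ^ k) 0) ->
  forall k, a k = 0.
Proof.
  intros Hr H k.
  assert (Hx : forall x, 0 < Rabs x < r -> PSeries a x = 0).
  { intros x Hx. apply is_series_unique, H, Hx. }
  assert (Hrad : Rbar_lt 0 (CV_radius a)).
  { apply Rbar_lt_le_trans with (r / 2); [simpl; lra|].
    apply Rbar_not_lt_le. intros Hlt.
    assert (Ha : Rabs (r / 2) = r / 2) by (apply Rabs_pos_eq; lra).
    apply (CV_disk_outside a (r / 2)).
    - rewrite Ha. exact Hlt.
    - apply (ex_series_lim_0 (fun n => a n * (r / 2) ^ n)). exists 0. apply H.
      rewrite Ha. lra. }
  change (PS_incr_1 a (S k) = (fun _ => 0) (S k)).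
  apply PSeries_ext_recip.
  - rewrite CV_radius_incr_1. exact Hrad.
  - rewrite CV_radius_const_0. exact I.
  - exists (mkposreal r Hr). intros x Hb.
    rewrite PSeries_incr_1, PSeries_const_0.
    destruct (Req_dec x 0) as [->|Hne]; [ring|].
    rewrite Hx; [ring|]. split; [apply Rabs_pos_lt; exact Hne|].
    revert Hb. unfold ball; simpl; unfold AbsRing_ball, abs, minus, plus, opp; simpl.
    rewrite Ropp_0, Rplus_0_r. auto.
Qed.

(** Vanishing on a punctured real interval is enough: every use below restricts the
    generating function to one line through 0. *)
Lemma Cpseries_zero_coeffs (a : nat -> C) (r : R) :
  0 < r ->
  (forall x : R, 0 < Rabs x < r ->
     @is_series C_AbsRing C_NormedModule (fun k => a k * RtoC (x ^ k))%C (RtoC 0)) ->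
  forall k, a k = RtoC 0.
Proof.
  intros Hr H k.
  apply Ceq_parts; simpl.
  - apply (pseries_zero_coeffs (fun k => Re (a k)) r Hr). intros x Hx.
    specialize (H x Hx). apply is_Cseries_parts in H. destruct H as [H _].
    eapply is_series_ext; [|exact H]. intros n. unfold Re, Im; simpl; ring.
  - apply (pseries_zero_coeffs (fun k => Im (a k)) r Hr). intros x Hx.
    specialize (H x Hx). apply is_Cseries_parts in H. destruct H as [_ H].
    eapply is_series_ext; [|exact H]. intros n. unfold Re, Im; simpl; ring.
Qed.

Lemma is_Cseries_minus (a b : nat -> C) (la lb : C) :
  @is_series C_AbsRing C_NormedModule a la ->
  @is_series C_AbsRing C_NormedModule b lb ->
  @is_series C_AbsRing C_NormedModule (fun n => a n - b n)%C (la - lb)%C.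
Proof. intros Ha Hb. apply (is_series_minus a b la lb Ha Hb). Qed.

Lemma is_Cseries_ext (a b : nat -> C) (la lb : C) :
  (forall n, a n = b n) -> la = lb ->
  @is_series C_AbsRing C_NormedModule a la ->
  @is_series C_AbsRing C_NormedModule b lb.
Proof. intros H <- Ha. eapply is_series_ext; [exact H|exact Ha]. Qed.

Lemma ex_series_Rabs_le (a b : nat -> R) :
  (forall n, Rabs (a n) <= b n) -> ex_series b -> ex_series (fun n => Rabs (a n)).
Proof.
  intros H. apply (ex_series_le (fun n => Rabs (a n)) b). intros n.
  unfold norm; simpl; unfold abs; simpl. rewrite Rabs_Rabsolu. apply H.
Qed.

Lemma rsum_sum_f_R0 (f : nat -> R) N : sum_f_R0 f N = rsum f (S N).
Proof. rewrite <- sum_n_rsum. symmetry. apply sum_n_Reals. Qed.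

(** Splitting into real and imaginary parts reduces the complex Cauchy product to
    four real ones. *)
Lemma is_Cseries_mult (a b : nat -> C) (la lb : C) :
  @is_series C_AbsRing C_NormedModule a la ->
  @is_series C_AbsRing C_NormedModule b lb ->
  ex_series (fun n => Cmod (a n)) -> ex_series (fun n => Cmod (b n)) ->
  @is_series C_AbsRing C_NormedModule
    (fun n => csum (fun k => a k * b (n - k)%nat)%C (S n)) (la * lb)%C.
Proof.
  intros Ha Hb Ea Eb.
  apply is_Cseries_parts in Ha. apply is_Cseries_parts in Hb.
  destruct Ha as [Ha1 Ha2], Hb as [Hb1 Hb2].
  assert (Ea1 := ex_series_Rabs_le _ _ (fun n => Rabs_Re_le (a n)) Ea).
  assert (Ea2 := ex_series_Rabs_le _ _ (fun n => Rabs_Im_le (a n)) Ea).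
  assert (Eb1 := ex_series_Rabs_le _ _ (fun n => Rabs_Re_le (b n)) Eb).
  assert (Eb2 := ex_series_Rabs_le _ _ (fun n => Rabs_Im_le (b n)) Eb).
  apply is_Cseries_parts. split.
  - eapply is_series_ext;
      [|exact (is_series_minus _ _ _ _ (is_series_mult _ _ _ _ Ha1 Hb1 Ea1 Eb1)
                 (is_series_mult _ _ _ _ Ha2 Hb2 Ea2 Eb2))].
    intros n. rewrite Re_csum, !rsum_sum_f_R0. symmetry. apply rsum_minus.
  - eapply is_series_ext;
      [|exact (is_series_plus _ _ _ _ (is_series_mult _ _ _ _ Ha1 Hb2 Ea1 Eb2)
                 (is_series_mult _ _ _ _ Ha2 Hb1 Ea2 Eb1))].
    intros n. rewrite Im_csum, !rsum_sum_f_R0. symmetry. apply rsum_plus.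
Qed.

(** * The complex exponential *)

Lemma exp_mono x y : x <= y -> exp x <= exp y.
Proof. intros [H| ->]; [left; apply exp_increasing; exact H|right; reflexivity]. Qed.

Lemma Cexp_add (a b : C) : Cexp (a + b) = (Cexp a * Cexp b)%C.
Proof.
  apply Ceq_parts; unfold Re, Im; simpl; unfold Re, Im; simpl;
    rewrite exp_plus; [rewrite cos_plus|rewrite sin_plus]; ring.
Qed.

Lemma Cmod_Cexp (z : C) : Cmod (Cexp z) = exp (Re z).
Proof.
  unfold Cmod, Cexp; simpl.
  replace (_ + _) with (exp (Re z) * exp (Re z) * (Rsqr (sin (Im z)) + Rsqr (cos (Im z))))
    by (unfold Rsqr; ring).
  rewrite sin2_cos2, Rmult_1_r. apply sqrt_square. left. apply exp_pos.
Qed.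

Lemma INR_fact_C (k : nat) : RtoC (INR (fact k)) <> RtoC 0.
Proof. intros H. apply RtoC_inj in H. exact (INR_fact_neq_0 k H). Qed.

Definition exp_term (z : C) (k : nat) : C := (z ^ k / RtoC (INR (fact k)))%C.

Lemma Cmod_exp_term z k : Cmod (exp_term z k) = Cmod z ^ k / INR (fact k).
Proof.
  unfold exp_term. rewrite Cmod_div by apply INR_fact_C.
  rewrite Cmod_pow, Cmod_R, Rabs_pos_eq by apply pos_INR. reflexivity.
Qed.

(** [re_ray c z] is the real function s |-> Re (c exp (s z)); this form is closed under
    differentiation, which multiplies c by z. *)
Definition re_ray (c z : C) (s : R) : R :=
  exp (s * Re z) * (Re c * cos (s * Im z) - Im c * sin (s * Im z)).

Lemma is_derive_re_ray (c z : C) (s : R) :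
  is_derive (re_ray c z) s (re_ray (c * z) z s).
Proof. unfold re_ray. auto_derive; [auto|]. simpl. unfold Re, Im. ring. Qed.

Lemma Derive_n_re_ray (c z : C) (k : nat) (s : R) :
  Derive_n (re_ray c z) k s = re_ray (c * z ^ k) z s.
Proof.
  revert s. induction k as [|k IH]; intros s; simpl.
  - f_equal. ring.
  - rewrite (Derive_ext _ _ s IH).
    replace (c * (z * z ^ k))%C with ((c * z ^ k) * z)%C by ring.
    apply is_derive_unique, is_derive_re_ray.
Qed.

Lemma ex_derive_n_re_ray (c z : C) (k : nat) (s : R) : ex_derive_n (re_ray c z) k s.
Proof.
  destruct k as [|k]; simpl; [exact I|].
  eapply ex_derive_ext; [intros t; symmetry; apply Derive_n_re_ray|].
  eexists. apply is_derive_re_ray.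
Qed.

Lemma re_ray_Cexp (c z : C) (s : R) : re_ray c z s = Re (c * Cexp (RtoC s * z)).
Proof.
  unfold re_ray, Cexp. simpl. unfold Re, Im. simpl.
  rewrite !Rmult_0_l, Rminus_0_r, Rplus_0_r. ring.
Qed.

Lemma Rabs_re_ray (c z : C) (s : R) :
  0 <= s <= 1 -> Rabs (re_ray c z s) <= Cmod c * exp (Cmod z).
Proof.
  intros Hs. rewrite re_ray_Cexp. eapply Rle_trans; [apply Rabs_Re_le|].
  rewrite Cmod_mult, Cmod_Cexp. apply Rmult_le_compat_l; [apply Cmod_ge_0|].
  apply exp_mono. replace (Re (RtoC s * z)) with (s * Re z) by (unfold Re; simpl; ring).
  assert (H := Rabs_Re_le z). assert (H' := Rle_abs (Re z)).
  assert (H'' := Cmod_ge_0 z). nra.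
Qed.

(** The Lagrange form of the remainder is a statement about real functions; a free
    complex factor c lets it see every component of exp z. *)
Lemma re_ray_taylor (c z : C) (N : nat) :
  Rabs (Re (c * (Cexp z - csum (exp_term z) (S N)))) <=
  Cmod c * exp (Cmod z) * (Cmod z ^ S N / INR (fact (S N))).
Proof.
  destruct (Taylor_Lagrange (re_ray c z) N 0 1 Rlt_0_1) as [s [Hs E]].
  { intros. apply ex_derive_n_re_ray. }
  rewrite rsum_sum_f_R0, Derive_n_re_ray in E.
  replace (Re (c * (Cexp z - csum (exp_term z) (S N))))
    with ((1 - 0) ^ S N / INR (fact (S N)) * re_ray (c * z ^ S N) z s).
  - rewrite Rminus_0_r, pow1, Rabs_mult, Rabs_pos_eq
      by (apply Rlt_le, Rdiv_lt_0_compat; [lra|apply INR_fact_lt_0]).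
    assert (H := Rabs_re_ray (c * z ^ S N) z s).
    rewrite Cmod_mult, Cmod_pow in H.
    eapply Rle_trans.
    + apply Rmult_le_compat_l; [|apply H; lra].
      apply Rlt_le, Rdiv_lt_0_compat; [lra|apply INR_fact_lt_0].
    + right. field. apply INR_fact_neq_0.
  - replace (c * (Cexp z - csum (exp_term z) (S N)))%C
      with (c * Cexp (RtoC 1 * z) - csum (fun k => c * exp_term z k) (S N))%C
      by (rewrite csum_scal, Cmult_1_l; ring).
    replace (Re (c * Cexp (RtoC 1 * z) - csum (fun k => c * exp_term z k)%C (S N)))
      with (re_ray c z 1 - rsum (fun k => Re (c * exp_term z k)%C) (S N)).
    + rewrite E. rewrite (rsum_ext (fun k => Re (c * exp_term z k)%C)
        (fun m => (1 - 0) ^ m / INR (fact m) * Derive_n (re_ray c z) m 0)).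
      * ring.
      * intros k _. rewrite Derive_n_re_ray, Rminus_0_r, pow1.
        unfold exp_term, re_ray. rewrite !Rmult_0_l, exp_0, cos_0, sin_0.
        replace (c * (z ^ k / INR (fact k)))%C
          with ((c * z ^ k) * RtoC (/ INR (fact k)))%C.
        -- unfold Re, Im; simpl. field. apply INR_fact_neq_0.
        -- rewrite RtoC_inv by apply INR_fact_neq_0. field. apply INR_fact_C.
    + rewrite <- Re_csum, re_ray_Cexp. reflexivity.
Qed.

Lemma Cexp_taylor (z : C) (N : nat) :
  Cmod (Cexp z - csum (exp_term z) (S N)) <=
  2 * exp (Cmod z) * (Cmod z ^ S N / INR (fact (S N))).
Proof.
  eapply Rle_trans; [apply Cmod_le_parts|].
  (* c = 1 and c = - i extract the real and the imaginary part. *)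
  assert (H1 := re_ray_taylor 1 z N). assert (H2 := re_ray_taylor (- Ci) z N).
  rewrite Cmod_1 in H1. rewrite Cmod_opp, Cmod_Ci in H2.
  rewrite Cmult_1_l in H1.
  set (d := (Cexp z - csum (exp_term z) (S N))%C) in *.
  replace (Re (- Ci * d)) with (Im d) in H2 by (unfold Re, Im; simpl; ring).
  lra.
Qed.

Lemma is_lim_pow_fact (x : R) : is_lim_seq (fun n => x ^ n / INR (fact n)) 0.
Proof.
  eapply is_lim_seq_ext; [|apply (ex_series_lim_0 (fun n => / INR (fact n) * x ^ n))].
  - intros n. simpl. unfold Rdiv. ring.
  - exists (exp x). eapply is_series_ext; [|apply (is_exp_Reals x)].
    intros n. unfold scal; simpl; unfold mult; simpl.
    rewrite pow_n_pow. ring.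
Qed.

Lemma is_lim_Cexp_partial (z : C) :
  is_lim_seq (fun N => Cmod (csum (exp_term z) N - Cexp z)) 0.
Proof.
  apply is_lim_seq_incr_1.
  apply is_lim_seq_0_abs_le with
    (fun N => 2 * exp (Cmod z) * (Cmod z ^ S N / INR (fact (S N)))).
  - intros N. rewrite Rabs_pos_eq by apply Cmod_ge_0.
    rewrite <- Cmod_opp.
    replace (- (csum (exp_term z) (S N) - Cexp z))%C
      with (Cexp z - csum (exp_term z) (S N))%C by ring.
    apply Cexp_taylor.
  - rewrite <- (Rmult_0_r (2 * exp (Cmod z))).
    apply (is_lim_seq_scal_l _ _ 0).
    apply (is_lim_seq_incr_1 (fun n => Cmod z ^ n / INR (fact n))), is_lim_pow_fact.
Qed.

Lemma is_series_Cexp (z : C) :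
  @is_series C_AbsRing C_NormedModule (exp_term z) (Cexp z).
Proof. apply is_Cseries_Cmod, is_lim_Cexp_partial. Qed.

Lemma ex_series_Cmod_exp_term (z : C) : ex_series (fun k => Cmod (exp_term z k)).
Proof.
  exists (exp (Cmod z)). eapply is_series_ext; [|apply (is_exp_Reals (Cmod z))].
  intros n. rewrite Cmod_exp_term. unfold scal; simpl; unfold mult; simpl.
  rewrite pow_n_pow. unfold Rdiv. ring.
Qed.

(** * Partial fractions of the cotangent *)

Lemma pi_gt_3 : 3 < PI.
Proof. assert (T := PI2_3_2). lra. Qed.

Lemma sin_neq_0_small x : 0 < Rabs x <= 1 / 2 -> sin x <> 0.
Proof.
  intros Hx E. assert (T := pi_gt_3).
  destruct (Rle_lt_dec 0 x) as [P|P].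
  - rewrite Rabs_pos_eq in Hx by exact P.
    assert (0 < sin x) by (apply sin_gt_0; lra). lra.
  - rewrite Rabs_left in Hx by exact P.
    assert (0 < sin (- x)) by (apply sin_gt_0; lra). rewrite sin_neg in H. lra.
Qed.

Definition cotan (x : R) : R := cos x / sin x.

Lemma cotan_half y :
  sin y <> 0 ->
  sin (y / 2) <> 0 /\ sin ((y + PI) / 2) <> 0 /\
  cotan y = (cotan (y / 2) + cotan ((y + PI) / 2)) / 2.
Proof.
  intros H. unfold cotan.
  replace ((y + PI) / 2) with (PI / 2 + y / 2) by field.
  rewrite <- cos_sin. replace (cos (PI / 2 + y / 2)) with (- sin (y / 2))
    by (rewrite sin_cos; ring).
  replace y with (2 * (y / 2)) in H by field.
  replace y with (2 * (y / 2)) at 3 4 by field.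
  rewrite cos_2a, sin_2a. rewrite sin_2a in H.
  assert (sin (y / 2) <> 0) by (intros E; apply H; rewrite E; ring).
  assert (cos (y / 2) <> 0) by (intros E; apply H; rewrite E; ring).
  repeat split; auto. field. auto.
Qed.

(** Euler's route to partial fractions: halving the argument N times spreads the
    poles of the cotangent over 2^N translates, each of which is then close to a
    simple fraction. *)
Lemma cotan_iterated N : forall y, sin y <> 0 ->
  cotan y = / 2 ^ N * rsum (fun j => cotan ((y + PI * INR j) / 2 ^ N)) (2 ^ N).
Proof.
  induction N as [|N IH]; intros y H.
  - simpl. rewrite Rinv_1, Rmult_0_r, Rplus_0_r. unfold Rdiv. rewrite Rinv_1, Rmult_1_r. ring.
  - destruct (cotan_half y H) as [H1 [H2 E]]. rewrite E, (IH _ H1), (IH _ H2).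
    rewrite (Nat.pow_succ_r' 2 N), rsum_double.
    assert (P : 2 ^ N <> 0) by (apply pow_nonzero; lra).
    replace (/ 2 ^ S N) with (/ 2 * / 2 ^ N) by (simpl; field; exact P).
    rewrite (rsum_ext (fun i => cotan ((y + PI * INR (2 * i)) / 2 ^ S N) +
                                cotan ((y + PI * INR (2 * i + 1)) / 2 ^ S N))
      (fun i => cotan ((y / 2 + PI * INR i) / 2 ^ N) +
                cotan (((y + PI) / 2 + PI * INR i) / 2 ^ N))).
    + rewrite rsum_plus. field. exact P.
    + intros i _. rewrite plus_INR, mult_INR. simpl INR. simpl pow.
      f_equal; f_equal; field; exact P.
Qed.

(** The window of indices in [cotan_iterated] recentred around 0, using that the
    cotangent has period pi. *)
Lemma cotan_symmetric N x : sin x <> 0 ->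
  let h := / 2 ^ S N in
  cotan x = h * cotan (x * h) + h * cotan (x * h + PI / 2) +
    rsum (fun i => h * (cotan (x * h + PI * INR (S i) * h) +
                        cotan (x * h - PI * INR (S i) * h))) (2 ^ N - 1).
Proof.
  intros H h. rewrite (cotan_iterated (S N) x H).
  assert (P2 : 2 ^ N <> 0) by (apply pow_nonzero; lra).
  assert (Q : (2 ^ N <> 0)%nat) by (apply Nat.pow_nonzero; lia).
  assert (Hh : 2 ^ N * h = / 2) by (unfold h; simpl; field; exact P2).
  assert (HI : INR (2 ^ N) = 2 ^ N) by (rewrite pow_INR; reflexivity).
  set (P := (2 ^ N - 1)%nat). rewrite Nat.pow_succ_r'.
  replace (2 * 2 ^ N)%nat with ((1 + P) + (1 + P))%nat by lia.
  rewrite !rsum_split. cbn [rsum]. rewrite rsum_scal, rsum_plus.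
  rewrite <- (rsum_rev (fun i => cotan ((x + PI * INR (1 + P + (1 + i))) / 2 ^ S N))).
  rewrite (rsum_ext (fun i => cotan ((x + PI * INR (1 + P + (1 + (P - S i)))) / 2 ^ S N))
    (fun i => cotan (x * h - PI * INR (S i) * h))).
  2:{ intros i Hi.
      replace ((x + PI * INR (1 + P + (1 + (P - S i)))) / 2 ^ S N)
        with ((x * h - PI * INR (S i) * h) + PI).
      - unfold cotan. rewrite neg_cos, neg_sin.
        destruct (Req_dec (sin (x * h - PI * INR (S i) * h)) 0) as [E|E].
        + rewrite E, Ropp_0. unfold Rdiv. rewrite Rinv_0. ring.
        + field. exact E.
      - replace (1 + P + (1 + (P - S i)))%nat with (2 * 2 ^ N - S i)%nat by lia.
        rewrite minus_INR, mult_INR, HI by lia. unfold Rdiv. fold h. simpl (INR 2).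
        replace (PI) with (PI * (2 * (2 ^ N * h))) at 2 by (rewrite Hh; field). ring. }
  rewrite (rsum_ext (fun i => cotan ((x + PI * INR (1 + i)) / 2 ^ S N))
    (fun i => cotan (x * h + PI * INR (S i) * h))).
  2:{ intros i _. f_equal. unfold Rdiv. fold h. rewrite (Nat.add_1_l i). ring. }
  replace ((x + PI * INR 0) / 2 ^ S N) with (x * h)
    by (unfold Rdiv; fold h; simpl INR; ring).
  replace ((x + PI * INR (1 + P + 0)) / 2 ^ S N) with (x * h + PI / 2).
  2:{ replace (1 + P + 0)%nat with (2 ^ N)%nat by lia. rewrite HI.
      unfold Rdiv. fold h. rewrite <- Hh. ring. }
  fold h. ring.
Qed.

Lemma sin_ge_third b : 0 <= b -> b <= PI / 2 -> b / 3 <= sin b.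
Proof.
  intros H0 H1. assert (HP := PI_4).
  destruct (pre_sin_bound b 0 H0) as [H _]; [lra|].
  eapply Rle_trans; [|exact H].
  unfold sin_approx, sin_term; simpl.
  assert (b * b <= 4) by nra.
  assert (b * b * b <= 4 * b) by nra. lra.
Qed.

Lemma Rabs_sin_le a : Rabs (sin a) <= Rabs a.
Proof.
  destruct (Rle_lt_dec 0 a) as [H|H].
  - rewrite (Rabs_pos_eq a) by exact H. apply Rabs_le. split.
    + destruct (Rle_lt_dec a 1).
      * assert (0 <= sin a) by (apply sin_ge_0; [exact H|assert (T := PI2_3_2); lra]). lra.
      * assert (T := SIN_bound a). lra.
    + destruct (Req_dec a 0) as [->|]; [rewrite sin_0; lra|].
      left. apply sin_lt_x. lra.
  - rewrite (Rabs_left a) by exact H. rewrite <- Rabs_Ropp, <- sin_neg.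
    apply Rabs_le. split.
    + destruct (Rle_lt_dec (- a) 1).
      * assert (0 <= sin (- a)) by (apply sin_ge_0; [lra|assert (T := PI2_3_2); lra]). lra.
      * assert (T := SIN_bound (- a)). lra.
    + left. apply sin_lt_x. lra.
Qed.

(** Opposite terms combine to sin (2a) / (sin (a+b) sin (a-b)), which decays
    quadratically in the index j although each of the two terms does not. *)
Lemma cotan_pair a b h j :
  0 < h -> 1 <= j -> Rabs a <= h / 2 -> PI * j * h <= PI / 2 -> b = PI * j * h ->
  Rabs (h * (cotan (a + b) + cotan (a - b))) <= 3 * (Rabs a / h) / (j * j).
Proof.
  intros Hh Hj Ha Hb1 Hb. assert (T := PI2_3_2).
  assert (Hjh : 0 < j * h) by nra.
  assert (Sb : j * h <= sin b).
  { eapply Rle_trans; [|apply sin_ge_third; subst b; nra]. subst b. nra. }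
  assert (Sa : sin a * sin a <= h * h / 4).
  { assert (E := Rabs_sin_le a).
    replace (sin a * sin a) with (Rabs (sin a) * Rabs (sin a))
      by (rewrite <- Rabs_mult; apply Rabs_pos_eq, Rle_0_sqr).
    assert (U := Rabs_pos (sin a)). nra. }
  assert (D : 3 / 4 * (j * j * h * h) <= sin b * sin b - sin a * sin a).
  { assert (j * h * (j * h) <= sin b * sin b) by (apply Rmult_le_compat; lra).
    assert (h * h <= j * h * (j * h)) by (apply Rmult_le_compat; nra). nra. }
  assert (D0 : 0 < 3 / 4 * (j * j * h * h))
    by (replace (j * j * h * h) with ((j * h) * (j * h)) by ring;
        assert (0 < (j * h) * (j * h)) by (apply Rmult_lt_0_compat; exact Hjh); lra).
  assert (Pr : sin (a + b) * sin (a - b) = sin a * sin a - sin b * sin b).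
  { rewrite sin_plus, sin_minus.
    assert (U := sin2_cos2 a). assert (V := sin2_cos2 b). unfold Rsqr in U, V.
    replace ((sin a * cos b + cos a * sin b) * (sin a * cos b - cos a * sin b))
      with (sin a * sin a * (cos b * cos b) - cos a * cos a * (sin b * sin b)) by ring.
    replace (cos b * cos b) with (1 - sin b * sin b) by lra.
    replace (cos a * cos a) with (1 - sin a * sin a) by lra. ring. }
  assert (N1 : sin (a + b) <> 0) by (intros E; rewrite E in Pr; lra).
  assert (N2 : sin (a - b) <> 0) by (intros E; rewrite E in Pr; lra).
  replace (cotan (a + b) + cotan (a - b)) with
    (- (sin (2 * a) / (sin b * sin b - sin a * sin a))).
  - rewrite Rabs_mult, Rabs_Ropp. unfold Rdiv at 1. rewrite Rabs_mult, Rabs_inv.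
    rewrite (Rabs_pos_eq h) by lra.
    rewrite (Rabs_pos_eq (sin b * sin b - sin a * sin a)) by lra.
    assert (E := Rabs_sin_le (2 * a)). rewrite (Rabs_mult 2), (Rabs_pos_eq 2) in E by lra.
    apply Rle_trans with (h * ((2 * Rabs a) * / (3 / 4 * (j * j * h * h)))).
    + apply Rmult_le_compat_l; [lra|]. apply Rmult_le_compat; auto using Rabs_pos.
      * left. apply Rinv_0_lt_compat. lra.
      * apply Rinv_le_contravar; assumption.
    + replace (h * (2 * Rabs a * / (3 / 4 * (j * j * h * h))))
        with (8 / 3 * (Rabs a / h / (j * j))) by (field; lra).
      assert (0 <= Rabs a / h / (j * j)).
      { unfold Rdiv. repeat apply Rmult_le_pos; auto using Rabs_pos;
          left; apply Rinv_0_lt_compat; nra. }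
      unfold Rdiv in *. lra.
  - unfold cotan.
    replace (cos (a + b) / sin (a + b) + cos (a - b) / sin (a - b))
      with ((sin (a + b) * cos (a - b) + cos (a + b) * sin (a - b)) /
            (sin (a + b) * sin (a - b))) by (field; auto).
    rewrite <- sin_plus, Pr. replace (a + b + (a - b)) with (2 * a) by ring.
    field. split; lra.
Qed.

(** Comparison with the telescoping sum of 1/p - 1/(p+1). *)
Lemma tail_inv_square K M : (1 <= K)%nat ->
  rsum (fun i => / (INR (S (K + i)) * INR (S (K + i)))) M <= / INR K - / INR (K + M).
Proof.
  intros HK. induction M as [|M IH]; cbn [rsum].
  - rewrite Nat.add_0_r. lra.
  - replace (K + S M)%nat with (S (K + M)) by lia.
    assert (P : 1 <= INR (K + M)) by (apply (le_INR 1); lia).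
    rewrite (S_INR (K + M)). set (p := INR (K + M)) in *.
    assert (/ ((p + 1) * (p + 1)) <= / p - / (p + 1)).
    { replace (/ p - / (p + 1)) with (/ (p * (p + 1))) by (field; lra).
      apply Rinv_le_contravar; nra. }
    lra.
Qed.

Lemma tail_inv_square_le K M : (1 <= K)%nat ->
  rsum (fun i => / (INR (S (K + i)) * INR (S (K + i)))) M <= / INR K.
Proof.
  intros HK. assert (H := tail_inv_square K M HK).
  assert (0 < / INR (K + M)) by (apply Rinv_0_lt_compat, lt_0_INR; lia). lra.
Qed.

Lemma is_lim_inv_pow2 : is_lim_seq (fun N => / 2 ^ S N) 0.
Proof.
  eapply is_lim_seq_ext; [|apply (proj1 (is_lim_seq_incr_1 (fun n => (/ 2) ^ n) 0)), is_lim_seq_geom].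
  - intros n. simpl. rewrite pow_inv. field. apply pow_nonzero. lra.
  - rewrite Rabs_pos_eq; lra.
Qed.

Lemma is_lim_h_cotan y (h : nat -> R) : y <> 0 -> (forall n, h n <> 0) -> is_lim_seq h 0 ->
  is_lim_seq (fun n => h n * cotan (y * h n)) (/ y).
Proof.
  intros Hy Hh Lh.
  assert (Lu : is_lim_seq (fun n => y * h n) 0)
    by (rewrite <- (Rmult_0_r y); apply (is_lim_seq_scal_l h y 0 Lh)).
  assert (Hs : is_lim_seq (fun n => sin (y * h n) / (y * h n)) 1).
  { apply (is_lim_comp_seq (fun x => sin x / x) _ 0 1).
    - apply is_lim_sinc_0.
    - exists O. intros n _ E. injection E as E. apply Rmult_integral in E.
      destruct E; [auto|exact (Hh n H)].
    - exact Lu. }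
  assert (Hc : is_lim_seq (fun n => cos (y * h n)) 1).
  { rewrite <- cos_0. apply is_lim_seq_continuous; [|exact Lu].
    apply continuity_cos. }
  replace (Finite (/ y)) with (Finite (/ y * (1 / 1))) by (f_equal; field; exact Hy).
  eapply is_lim_seq_ext_loc; [|apply (is_lim_seq_scal_l
    (fun n => cos (y * h n) / (sin (y * h n) / (y * h n))) (/ y) (1 / 1)),
    (is_lim_seq_div' _ _ 1 1 Hc Hs); lra].
  exists O. intros n _. unfold cotan.
  destruct (Req_dec (sin (y * h n)) 0) as [E|E].
  - rewrite E. unfold Rdiv. rewrite Rmult_0_l, Rinv_0. ring.
  - field. repeat split; auto.
Qed.

(** Fix how many terms of [cotan_symmetric] are kept and let the mesh go to 0:
    the kept terms converge to simple fractions, and the rest is uniformly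
    dominated by the tail of the sum of inverse squares. *)
Lemma cotan_partial_fractions x K : 0 < Rabs x <= 1 / 2 -> (1 <= K)%nat ->
  Rabs (cotan x - (/ x + rsum (fun i => / (x + PI * INR (S i)) + / (x - PI * INR (S i))) K))
  <= 3 * Rabs x / INR K.
Proof.
  intros Hx HK. assert (T := PI2_3_2).
  assert (Hx0 : x <> 0) by (intros ->; rewrite Rabs_R0 in Hx; lra).
  assert (Hs : sin x <> 0) by (apply sin_neq_0_small, Hx).
  set (h := fun N => / 2 ^ S N).
  assert (Hh : forall N, 0 < h N) by (intros N; apply Rinv_0_lt_compat, pow_lt; lra).
  set (t := fun N i => h N * (cotan (x * h N + PI * INR (S i) * h N) +
                              cotan (x * h N - PI * INR (S i) * h N))).
  set (E := fun N => h N * cotan (x * h N) + h N * cotan (x * h N + PI / 2) + rsum (t N) K).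
  assert (Hi : forall i, 1 <= INR (S i)) by (intros i; apply (le_INR 1); lia).
  assert (Lh : is_lim_seq h 0) by apply is_lim_inv_pow2.
  assert (LE : is_lim_seq E (/ x + 0 +
     rsum (fun i => / (x + PI * INR (S i)) + / (x - PI * INR (S i))) K)).
  { apply is_lim_seq_plus'; [apply is_lim_seq_plus'|].
    - apply is_lim_h_cotan; auto. intros n. apply Rgt_not_eq, Hh.
    - assert (Lu : is_lim_seq (fun n => x * h n) 0)
        by (rewrite <- (Rmult_0_r x); apply (is_lim_seq_scal_l h x 0 Lh)).
      replace (Finite 0) with (Finite (0 * (cos (0 + PI / 2) / sin (0 + PI / 2)))) by (f_equal; ring).
      apply is_lim_seq_mult'; [exact Lh|]. unfold cotan.
      apply is_lim_seq_div'.
      + apply (is_lim_seq_continuous cos); [apply continuity_cos|].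
        apply is_lim_seq_plus'; [exact Lu|apply is_lim_seq_const].
      + apply (is_lim_seq_continuous sin); [apply continuity_sin|].
        apply is_lim_seq_plus'; [exact Lu|apply is_lim_seq_const].
      + rewrite Rplus_0_l, sin_PI2. lra.
    - clear HK. induction K as [|K IH]; simpl; [apply is_lim_seq_const|].
      apply is_lim_seq_plus'; [exact IH|]. unfold t.
      specialize (Hi K). set (j := INR (S K)) in *.
      eapply is_lim_seq_ext; [|apply is_lim_seq_plus';
        [apply (is_lim_h_cotan (x + PI * j) h)|apply (is_lim_h_cotan (x - PI * j) h)]].
      + intros n. simpl. rewrite <- Rmult_plus_distr_l. do 2 f_equal; f_equal; ring.
      + assert (- (1/2) <= x <= 1/2) by (apply Rabs_le_between; apply Hx). nra.
      + intros n. apply Rgt_not_eq, Hh.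
      + exact Lh.
      + assert (- (1/2) <= x <= 1/2) by (apply Rabs_le_between; apply Hx). nra.
      + intros n. apply Rgt_not_eq, Hh.
      + exact Lh. }
  rewrite Rplus_0_r in LE.
  apply (is_lim_seq_le_loc (fun N => Rabs (cotan x - E N)) (fun _ => 3 * Rabs x / INR K)
    (Rabs (cotan x - (/ x + rsum (fun i => / (x + PI * INR (S i)) + / (x - PI * INR (S i))) K)))
    (3 * Rabs x / INR K)).
  - exists (S K). intros N HN.
    assert (HKN : (K <= 2 ^ N - 1)%nat).
    { assert (N < 2 ^ N)%nat by (apply Nat.pow_gt_lin_r; lia). lia. }
    rewrite (cotan_symmetric N x Hs). cbv zeta. fold (h N).
    change (fun i => h N * (cotan (x * h N + PI * INR (S i) * h N) +
                            cotan (x * h N - PI * INR (S i) * h N))) with (t N).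
    replace (2 ^ N - 1)%nat with (K + (2 ^ N - 1 - K))%nat by lia.
    rewrite rsum_split. set (M := (2 ^ N - 1 - K)%nat).
    unfold E.
    replace (_ - _) with (rsum (fun i => t N (K + i)%nat) M) by ring.
    apply Rle_trans with
      (rsum (fun i => 3 * Rabs x * / (INR (S (K + i)) * INR (S (K + i)))) M).
    + apply Rabs_rsum_le. intros i Hiq. unfold t.
      eapply Rle_trans; [apply (cotan_pair _ _ (h N) (INR (S (K + i))))|].
      * apply Hh.
      * apply Hi.
      * rewrite Rabs_mult, (Rabs_pos_eq (h N)) by (left; apply Hh).
        assert (U := Hh N). nra.
      * assert (V : INR (S (K + i)) * h N <= 1 / 2).
        { assert (W : INR (S (K + i)) <= 2 ^ N).
          { replace (2 ^ N) with (INR (2 ^ N)) by (rewrite pow_INR; reflexivity).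
            apply le_INR. lia. }
          replace (1 / 2) with (2 ^ N * h N)
            by (unfold h; simpl; field; apply pow_nonzero; lra).
          apply Rmult_le_compat_r; [left; apply Hh|exact W]. }
        assert (0 < PI) by lra. nra.
      * reflexivity.
      * rewrite Rabs_mult, (Rabs_pos_eq (h N)) by (left; apply Hh).
        right. specialize (Hi (K + i)%nat). specialize (Hh N). field. lra.
    + rewrite rsum_scal. unfold Rdiv.
      apply Rmult_le_compat_l; [lra|]. apply tail_inv_square_le, HK.
  - apply is_lim_seq_abs with (l := Finite (cotan x - (/ x + rsum (fun i => / (x + PI * INR (S i)) + / (x - PI * INR (S i))) K))).
    apply is_lim_seq_minus'; [apply is_lim_seq_const|exact LE].
  - apply is_lim_seq_const.
Qed.

(** * The Taylor coefficients of t / (e^t - 1) *)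

(** The zeros of the sine are the nonzero multiples of pi; for k >= 2,
    [pole_sum k] is zeta(k) / pi^k. *)
Definition pole_power (k i : nat) : R := (/ (PI * INR (S i))) ^ k.

Definition pole_sum (k : nat) : R := Series (pole_power k).

Lemma pole_power_pos k i : 0 < pole_power k i.
Proof.
  apply pow_lt, Rinv_0_lt_compat, Rmult_lt_0_compat; [apply PI_RGT_0|].
  apply lt_0_INR. lia.
Qed.

Lemma pole_inv_le K i : (1 <= K)%nat -> / (PI * INR (S (K + i))) <= / (PI * INR K).
Proof.
  intros HK. assert (T := pi_gt_3).
  assert (1 <= INR K) by (apply (le_INR 1); lia).
  assert (INR K <= INR (S (K + i))) by (apply le_INR; lia).
  apply Rinv_le_contravar; nra.
Qed.

Lemma pole_power_tail k K i : (1 <= K)%nat ->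
  pole_power (S (S k)) (K + i) <=
  (/ (PI * INR K)) ^ k * / (INR (S (K + i)) * INR (S (K + i))).
Proof.
  intros HK. unfold pole_power. assert (T := pi_gt_3).
  assert (J : 1 <= INR (S (K + i))) by (apply (le_INR 1); lia).
  set (j := INR (S (K + i))) in *.
  replace ((/ (PI * j)) ^ S (S k)) with ((/ (PI * j)) ^ k * (/ (PI * j) * / (PI * j)))
    by (simpl; ring).
  assert (P : 0 < / (PI * j)) by (apply Rinv_0_lt_compat; nra).
  apply Rmult_le_compat.
  - apply pow_le. lra.
  - nra.
  - apply pow_incr. split; [lra|]. apply pole_inv_le, HK.
  - rewrite <- Rinv_mult. assert (j <= PI * j) by nra.
    apply Rinv_le_contravar; [nra|]. apply Rmult_le_compat; lra.
Qed.

Lemma pole_power_tail_sum k K M : (1 <= K)%nat ->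
  rsum (fun i => pole_power (S (S k)) (K + i)) M <= (/ (PI * INR K)) ^ k * / INR K.
Proof.
  intros HK. assert (T := pi_gt_3).
  assert (1 <= INR K) by (apply (le_INR 1); lia).
  eapply Rle_trans.
  - apply rsum_le. intros i _. apply pole_power_tail, HK.
  - rewrite rsum_scal. apply Rmult_le_compat_l; [|apply tail_inv_square_le, HK].
    apply pow_le. left. apply Rinv_0_lt_compat. nra.
Qed.

Lemma rsum_pole_power_le k N : rsum (pole_power (S (S k))) N <= 2.
Proof.
  assert (T := pi_gt_3).
  eapply Rle_trans; [apply (rsum_mono _ N (S N)); [lia|intros; left; apply pole_power_pos]|].
  rewrite rsum_head.
  assert (H := pole_power_tail_sum k 1 N ltac:(lia)). simpl (INR 1) in H.
  rewrite Rinv_1, !Rmult_1_r in H.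
  assert (P : 0 < / PI <= 1).
  { split; [apply Rinv_0_lt_compat; lra|]. rewrite <- Rinv_1.
    apply Rinv_le_contravar; lra. }
  assert (Q : forall m, (/ PI) ^ m <= 1).
  { intros m. rewrite <- (pow1 m). apply pow_incr. lra. }
  assert (pole_power (S (S k)) 0 <= 1).
  { unfold pole_power. simpl (INR 1). rewrite Rmult_1_r. apply Q. }
  specialize (Q k). simpl in H. lra.
Qed.

Lemma is_lim_pole_sum k : is_lim_seq (rsum (pole_power (S (S k)))) (pole_sum (S (S k))).
Proof.
  apply is_Rseries_rsum. apply Series_correct.
  destruct (ex_finite_lim_seq_incr (rsum (pole_power (S (S k)))) 2) as [l Hl].
  - intros n. simpl. assert (H := pole_power_pos (S (S k)) n). lra.
  - apply rsum_pole_power_le.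
  - exists l. apply is_Rseries_rsum, Hl.
Qed.

Lemma pole_sum_bounds k K : (1 <= K)%nat ->
  0 <= pole_sum (S (S k)) - rsum (pole_power (S (S k))) K <= (/ (PI * INR K)) ^ k * / INR K.
Proof.
  intros HK.
  assert (L : is_lim_seq (fun M => rsum (fun i => pole_power (S (S k)) (K + i)) M)
                (pole_sum (S (S k)) - rsum (pole_power (S (S k))) K)).
  { eapply is_lim_seq_ext;
      [|apply is_lim_seq_minus';
        [apply (proj1 (is_lim_seq_incr_n _ K _) (is_lim_pole_sum k))|
         apply is_lim_seq_const]].
    intros M. simpl. rewrite (Nat.add_comm M K), rsum_split. ring. }
  split.
  - apply (is_lim_seq_le (fun _ => 0) _ 0 _) in L; [exact L| |apply is_lim_seq_const].
    intros M. apply rsum_pos. intros i _. left. apply pole_power_pos.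
  - apply (is_lim_seq_le _ (fun _ => (/ (PI * INR K)) ^ k * / INR K) _
      ((/ (PI * INR K)) ^ k * / INR K)) in L; [exact L| |apply is_lim_seq_const].
    intros M. apply pole_power_tail_sum, HK.
Qed.

Lemma pole_sum_le_2 k : 0 <= pole_sum (S (S k)) <= 2.
Proof.
  split.
  - apply (is_lim_seq_le (fun _ => 0) (rsum (pole_power (S (S k)))) 0 (pole_sum (S (S k))));
      [|apply is_lim_seq_const|apply is_lim_pole_sum].
    intros M. apply rsum_pos. intros i _. left. apply pole_power_pos.
  - apply (is_lim_seq_le (rsum (pole_power (S (S k)))) (fun _ => 2) (pole_sum (S (S k))) 2);
      [apply rsum_pole_power_le|apply is_lim_pole_sum|apply is_lim_seq_const].
Qed.

(** Taylor coefficients of x cot x: its poles are the nonzero multiples of pi, and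
    opposite poles cancel in odd degree. *)
Definition cot_coef (k : nat) : R :=
  match k with
  | O => 1
  | S O => 0
  | S (S k) => - ((1 + (-1) ^ k) * pole_sum (S (S k)))
  end.

Lemma sign_bounds k : 0 <= 1 + (-1) ^ k <= 2.
Proof.
  assert (H := pow_1_abs k). assert (-1 <= (-1) ^ k <= 1).
  { apply Rabs_le_between. lra. }
  lra.
Qed.

Lemma Rabs_cot_coef k : Rabs (cot_coef k) <= 4.
Proof.
  destruct k as [|[|k]]; simpl cot_coef.
  - rewrite Rabs_R1. lra.
  - rewrite Rabs_R0. lra.
  - assert (A := sign_bounds k). assert (B := pole_sum_le_2 k).
    rewrite Rabs_Ropp, Rabs_pos_eq by nra. nra.
Qed.

(** The contribution of a pair of opposite poles, expanded to finite order. *)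
Lemma pole_pair_geom q N : Rabs q <= 1 / 2 ->
  Rabs (2 - (/ (1 - q) + / (1 + q)) +
    rsum (fun k => (1 + (-1) ^ k) * q ^ S (S k)) N) <= 4 * Rabs q ^ S (S N).
Proof.
  intros Hq. assert (B := proj1 (Rabs_le_between q (1 / 2)) Hq).
  assert (E : 2 - (/ (1 - q) + / (1 + q)) + rsum (fun k => (1 + (-1) ^ k) * q ^ S (S k)) N
    = - (q ^ S (S N) * / (1 - q)) - (- 1) ^ N * (q ^ S (S N) * / (1 + q))).
  { induction N as [|N IH].
    - simpl. field. lra.
    - cbn [rsum]. rewrite <- Rplus_assoc, IH. simpl. field. lra. }
  rewrite E. unfold Rminus.
  eapply Rle_trans; [apply Rabs_triang|].
  rewrite !Rabs_Ropp, !Rabs_mult, pow_1_abs, Rmult_1_l, !Rabs_inv, <- RPow_abs.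
  rewrite (Rabs_pos_eq (1 + - q)), (Rabs_pos_eq (1 + q)) by lra.
  assert (P : 0 <= Rabs q ^ S (S N)) by (apply pow_le, Rabs_pos).
  assert (U : / (1 + - q) <= 2).
  { replace 2 with (/ (1 / 2)) by field. apply Rinv_le_contravar; lra. }
  assert (V : / (1 + q) <= 2).
  { replace 2 with (/ (1 / 2)) by field. apply Rinv_le_contravar; lra. }
  unfold Rminus. nra.
Qed.

Lemma rsum_exchange (f : nat -> nat -> R) M N :
  rsum (fun i => rsum (fun j => f i j) N) M = rsum (fun j => rsum (fun i => f i j) M) N.
Proof.
  induction M as [|M IH]; simpl.
  - symmetry. apply rsum_zero.
  - rewrite IH, <- rsum_plus. reflexivity.
Qed.

Lemma rsum_half_pow N : rsum (fun k => (1 / 2) ^ k) N <= 2.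
Proof.
  assert (H := rsum_geom (1 / 2) N).
  assert (0 < (1 / 2) ^ N) by (apply pow_lt; lra). lra.
Qed.

(** Three errors add up: the truncation at K of the partial fractions, the
    truncation at K of the coefficients, and the order-N remainders of the K pole
    pairs.  Only the last survives when K tends to infinity with N fixed, so no
    double series has to be rearranged. *)
Lemma cot_coef_partial x K N : 0 < Rabs x <= 1 / 2 -> (1 <= K)%nat ->
  Rabs (x * cotan x - rsum (fun k => cot_coef k * x ^ k) (S (S N))) <=
  7 / INR K + 8 * Rabs x ^ S (S N).
Proof.
  intros Hx HK. assert (T := pi_gt_3).
  assert (Hx0 : x <> 0) by (intros ->; rewrite Rabs_R0 in Hx; lra).
  assert (Bx := proj1 (Rabs_le_between x (1 / 2)) (proj2 Hx)).
  assert (HK1 : 1 <= INR K) by (apply (le_INR 1); lia).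
  assert (HKi : 0 < / INR K) by (apply Rinv_0_lt_compat; lra).
  assert (Hi : forall i, 1 <= INR (S i)) by (intros i; apply (le_INR 1); lia).
  set (q := fun i => x * / (PI * INR (S i))).
  assert (Hq : forall i, Rabs (q i) <= Rabs x * / INR (S i)).
  { intros i. unfold q. rewrite Rabs_mult, Rabs_inv. specialize (Hi i).
    rewrite (Rabs_pos_eq (PI * INR (S i))) by nra.
    apply Rmult_le_compat_l; [apply Rabs_pos|]. apply Rinv_le_contravar; nra. }
  assert (Hi1 : forall i, 0 < / INR (S i) <= 1).
  { intros i. specialize (Hi i). split; [apply Rinv_0_lt_compat; lra|].
    rewrite <- Rinv_1. apply Rinv_le_contravar; lra. }
  assert (Hq2 : forall i, Rabs (q i) <= 1 / 2).
  { intros i. eapply Rle_trans; [apply Hq|]. specialize (Hi1 i).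
    assert (0 <= Rabs x) by apply Rabs_pos. nra. }
  rewrite !rsum_head. simpl (cot_coef 0). simpl (cot_coef 1).
  rewrite (rsum_ext (fun i => cot_coef (S (S i)) * x ^ S (S i))
    (fun k => (-1) * ((1 + (-1) ^ k) * x ^ S (S k) *
                (pole_sum (S (S k)) - rsum (pole_power (S (S k))) K)) +
              (-1) * rsum (fun i => (1 + (-1) ^ k) * q i ^ S (S k)) K)).
  2:{ intros k _. cbn [cot_coef]. 
      rewrite (rsum_ext (fun i => (1 + (-1) ^ k) * q i ^ S (S k))
        (fun i => ((1 + (-1) ^ k) * x ^ S (S k)) * pole_power (S (S k)) i)).
      - rewrite rsum_scal. ring.
      - intros i _. unfold q, pole_power. rewrite Rpow_mult_distr. ring. }
  rewrite rsum_plus, !rsum_scal, rsum_exchange.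
  set (e2 := rsum (fun k => (1 + (-1) ^ k) * x ^ S (S k) *
                (pole_sum (S (S k)) - rsum (pole_power (S (S k))) K)) N).
  assert (H2 : Rabs e2 <= 4 * / INR K).
  { apply Rle_trans with (rsum (fun k => / INR K * 2 * (1 / 2) ^ k) N).
    - apply Rabs_rsum_le. intros k _. rewrite !Rabs_mult.
      assert (A := sign_bounds k). rewrite (Rabs_pos_eq (1 + (-1) ^ k)) by lra.
      assert (B := pole_sum_bounds k K HK). rewrite (Rabs_pos_eq (_ - _)) by lra.
      rewrite <- RPow_abs.
      assert (Rabs x ^ S (S k) <= (1 / 2) ^ k).
      { apply Rle_trans with ((1 / 2) ^ S (S k)).
        - apply pow_incr. split; [apply Rabs_pos|lra].
        - simpl. assert (0 < (1 / 2) ^ k) by (apply pow_lt; lra). lra. }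
      assert (W : (/ (PI * INR K)) ^ k <= 1).
      { rewrite <- (pow1 k). apply pow_incr. split.
        - left. apply Rinv_0_lt_compat. nra.
        - rewrite <- Rinv_1. apply Rinv_le_contravar; nra. }
      assert (0 <= Rabs x ^ S (S k)) by (apply pow_le, Rabs_pos).
      apply Rle_trans with (2 * (1 / 2) ^ k * / INR K); [|right; ring].
      apply Rmult_le_compat; [nra|lra|nra|nra].
    - rewrite rsum_scal. replace (4 * / INR K) with (/ INR K * 2 * 2) by ring.
      apply Rmult_le_compat_l; [lra|apply rsum_half_pow]. }
  set (e1 := cotan x - (/ x + rsum (fun i => / (x + PI * INR (S i)) + / (x - PI * INR (S i))) K)).
  assert (H1 : Rabs e1 <= 3 * Rabs x / INR K) by (apply cotan_partial_fractions; assumption).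
  set (e3 := rsum (fun i => 2 - (/ (1 - q i) + / (1 + q i)) +
               rsum (fun k => (1 + (-1) ^ k) * q i ^ S (S k)) N) K).
  assert (H3 : Rabs e3 <= 8 * Rabs x ^ S (S N)).
  { apply Rle_trans with (rsum (fun i => 4 * Rabs x ^ S (S N) * / (INR (S i) * INR (S i))) K).
    - apply Rabs_rsum_le. intros i _. eapply Rle_trans; [apply pole_pair_geom, Hq2|].
      rewrite Rmult_assoc. apply Rmult_le_compat_l; [lra|].
      apply Rle_trans with ((Rabs x * / INR (S i)) ^ S (S N)).
      + apply pow_incr. split; [apply Rabs_pos|apply Hq].
      + rewrite Rpow_mult_distr. apply Rmult_le_compat_l; [apply pow_le, Rabs_pos|].
        rewrite Rinv_mult. specialize (Hi1 i). set (y := / INR (S i)) in *. cbn [pow].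
        assert (0 <= y ^ N <= 1).
        { split; [apply pow_le; lra|]. rewrite <- (pow1 N). apply pow_incr. lra. }
        assert (0 <= y * y) by nra. nra.
    - rewrite rsum_scal.
      assert (S2 : rsum (fun i => / (INR (S i) * INR (S i))) K <= 2).
      { destruct K as [|K]; [lia|]. rewrite rsum_head.
        assert (U := tail_inv_square_le 1 K ltac:(lia)).
        simpl (INR 1) in *. rewrite Rinv_1 in U. rewrite Rmult_1_r, Rinv_1.
        simpl (1 + _)%nat in U. lra. }
      assert (0 <= Rabs x ^ S (S N)) by (apply pow_le, Rabs_pos).
      replace (8 * Rabs x ^ S (S N)) with (4 * Rabs x ^ S (S N) * 2) by ring.
      apply Rmult_le_compat_l; [lra|exact S2]. }
  replace (_ - _) with (x * e1 + e2 + e3).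
  - eapply Rle_trans; [apply Rabs_triang|].
    assert (Rabs (x * e1 + e2) <= 7 / INR K); [|lra].
    eapply Rle_trans; [apply Rabs_triang|]. rewrite Rabs_mult.
    assert (Rabs x * Rabs e1 <= 3 * / INR K).
    { apply Rle_trans with (1 * (3 * Rabs x / INR K)).
      - apply Rmult_le_compat; auto using Rabs_pos. lra.
      - unfold Rdiv. nra. }
    unfold Rdiv. lra.
  - unfold e3. rewrite rsum_plus.
    rewrite (rsum_ext (fun i => 2 - (/ (1 - q i) + / (1 + q i)))
      (fun i => x * (/ (x + PI * INR (S i)) + / (x - PI * INR (S i))))).
    + rewrite rsum_scal. unfold e1. simpl (x ^ 0). field. exact Hx0.
    + intros i _. specialize (Hi i). unfold q. field. repeat split; nra.
Qed.

(** Lets a truncation parameter tend to infinity inside an inequality. *)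
Lemma le_of_inv_INR a b c :
  (forall K, (1 <= K)%nat -> a <= b / INR K + c) -> a <= c.
Proof.
  intros H. apply Rnot_lt_le. intros Hlt.
  destruct (INR_unbounded (Rmax 1 (b / (a - c)))) as [K HK].
  assert (H1 := Rmax_l 1 (b / (a - c))). assert (H2 := Rmax_r 1 (b / (a - c))).
  assert (HK1 : (1 <= K)%nat) by (apply INR_le; simpl; lra).
  specialize (H K HK1).
  assert (b / INR K < a - c); [|lra].
  apply Rmult_lt_reg_r with (INR K); [lra|].
  replace (b / INR K * INR K) with (b / (a - c) * (a - c)) by (field; lra).
  rewrite (Rmult_comm (a - c)). apply Rmult_lt_compat_r; lra.
Qed.

Lemma is_lim_pow_0 q c : 0 <= q < 1 -> is_lim_seq (fun N => c * q ^ N) 0.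
Proof.
  intros Hq. rewrite <- (Rmult_0_r c). apply (is_lim_seq_scal_l _ c 0).
  apply is_lim_seq_geom. rewrite Rabs_pos_eq; lra.
Qed.

Lemma is_series_cot_coef x : 0 < Rabs x <= 1 / 2 ->
  is_series (fun k => cot_coef k * x ^ k) (x * cotan x).
Proof.
  intros Hx. apply is_Rseries_rsum.
  apply (is_lim_seq_incr_n _ 2). apply is_lim_seq_minus_0.
  apply is_lim_seq_0_abs_le with (fun N => (8 * Rabs x ^ 2) * Rabs x ^ N).
  - intros N. rewrite Nat.add_comm. simpl Nat.add. rewrite Rabs_minus_sym.
    apply le_of_inv_INR with 7. intros K HK.
    replace (8 * Rabs x ^ 2 * Rabs x ^ N) with (8 * Rabs x ^ S (S N)) by (simpl; ring).
    apply cot_coef_partial; assumption.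
  - apply is_lim_pow_0. assert (0 <= Rabs x) by apply Rabs_pos. lra.
Qed.

Definition C2i : C := (0, 2).

Lemma C2i_neq_0 : C2i <> RtoC 0.
Proof. intros H. injection H. lra. Qed.

Lemma Cmod_C2i : Cmod C2i = 2.
Proof.
  replace C2i with (RtoC 2 * Ci)%C by (apply Ceq_parts; simpl; ring).
  rewrite Cmod_mult, Cmod_Ci, Cmod_R, Rabs_pos_eq; lra.
Qed.

(** Taylor coefficients of t / (e^t - 1), read off from those of the cotangent:
    for t = 2ix the quotient is x cot x - ix. *)
Definition bern_coef (k : nat) : C :=
  match k with
  | O => RtoC 1
  | S O => RtoC (- / 2)
  | S (S _) => (RtoC (cot_coef k) * (/ C2i) ^ k)%C
  end.

Lemma C2i_pow k : ((/ C2i) ^ k * C2i ^ k = 1)%C.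
Proof.
  rewrite <- Cpow_mult_l, Cinv_l by apply C2i_neq_0. apply Cpow_1_l.
Qed.

Lemma bern_coef_term x k :
  (bern_coef k * (C2i * RtoC x) ^ k =
   RtoC (cot_coef k * x ^ k) - RtoC (if Nat.eqb k 1 then x else 0%R) * Ci)%C.
Proof.
  destruct k as [|[|k]].
  - simpl. rewrite Rmult_1_l. ring.
  - simpl. apply Ceq_parts; simpl; field.
  - unfold bern_coef. rewrite Cpow_mult_l.
    replace (_ * _)%C with (RtoC (cot_coef (S (S k))) * ((/ C2i) ^ S (S k) * C2i ^ S (S k)) *
      RtoC x ^ S (S k))%C by ring.
    rewrite C2i_pow, RtoC_mult, RtoC_pow. simpl Nat.eqb. cbv iota. ring.
Qed.

Lemma cotan_exp x : sin x <> 0 ->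
  ((RtoC (x * cotan x) - RtoC x * Ci) * (Cexp (C2i * RtoC x) - 1) = C2i * RtoC x)%C.
Proof.
  intros H.
  assert (E : Cexp (C2i * RtoC x) = (cos (2 * x), sin (2 * x))).
  { unfold Cexp, C2i. simpl. replace (0 * x - 2 * 0) with 0 by ring.
    replace (0 * 0 + 2 * x) with (2 * x) by ring. rewrite exp_0.
    rewrite !Rmult_1_l. reflexivity. }
  rewrite E, cos_2a_sin, sin_2a. unfold cotan, C2i.
  assert (U := sin2_cos2 x). unfold Rsqr in U.
  apply Ceq_parts; simpl.
  - field. exact H.
  - replace (0 * 0 + 2 * x) with (2 * x * (sin x * sin x + cos x * cos x))
      by (rewrite U; ring).
    field. exact H.
Qed.

(** * Bernoulli polynomials *)

Lemma Cmod_bern_coef_term x k : Rabs x <= 1 / 2 ->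
  Cmod (bern_coef k * (C2i * RtoC x) ^ k) <= 5 * (1 / 2) ^ k.
Proof.
  intros Hx. rewrite bern_coef_term. unfold Cminus.
  eapply Rle_trans; [apply Cmod_triangle|].
  rewrite Cmod_opp, Cmod_mult, Cmod_Ci, !Cmod_R, Rabs_mult, <- RPow_abs, Rmult_1_r.
  assert (H := Rabs_cot_coef k).
  assert (P : Rabs x ^ k <= (1 / 2) ^ k) by (apply pow_incr; split; [apply Rabs_pos|lra]).
  assert (P0 : 0 <= Rabs x ^ k) by (apply pow_le, Rabs_pos).
  assert (Q : 0 < (1 / 2) ^ k) by (apply pow_lt; lra).
  assert (R1 : Rabs (if Nat.eqb k 1 then x else 0) <= (1 / 2) ^ k).
  { destruct (Nat.eqb_spec k 1) as [->|_]; [simpl; lra|]. rewrite Rabs_R0. lra. }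
  assert (0 <= Rabs (cot_coef k)) by apply Rabs_pos. nra.
Qed.

Lemma is_series_bern_coef x : 0 < Rabs x <= 1 / 2 ->
  @is_series C_AbsRing C_NormedModule (fun k => bern_coef k * (C2i * RtoC x) ^ k)%C
    (RtoC (x * cotan x) - RtoC x * Ci)%C.
Proof.
  intros Hx. apply is_Cseries_parts. split.
  - replace (Re (RtoC (x * cotan x) - RtoC x * Ci)) with (x * cotan x) by (simpl; ring).
    eapply is_series_ext; [|apply (is_series_cot_coef x Hx)].
    intros n. rewrite bern_coef_term. unfold Re; simpl; ring.
  - replace (Im (RtoC (x * cotan x) - RtoC x * Ci)) with (- x) by (simpl; ring).
    apply is_Rseries_rsum. apply is_lim_seq_incr_n with 2%nat.
    eapply is_lim_seq_ext; [|apply is_lim_seq_const].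
    intros n. rewrite (rsum_ext _ (fun k => - (if Nat.eqb k 1 then x else 0))).
    + rewrite Nat.add_comm. cbn [Nat.add]. rewrite !rsum_head. simpl.
      rewrite (rsum_ext _ (fun _ => 0)) by (intros; ring). rewrite rsum_zero. ring.
    + intros k _. rewrite bern_coef_term. simpl. ring.
Qed.

Lemma ex_series_Cmod_bern x : Rabs x <= 1 / 2 ->
  ex_series (fun k => Cmod (bern_coef k * (C2i * RtoC x) ^ k)).
Proof.
  intros Hx.
  apply (ex_series_ext (fun k => Rabs (Cmod (bern_coef k * (C2i * RtoC x) ^ k)))).
  { intros n. apply Rabs_pos_eq, Cmod_ge_0. }
  apply ex_series_Rabs_le with (fun k => 5 * (1 / 2) ^ k).
  - intros n. rewrite Rabs_pos_eq by apply Cmod_ge_0. apply Cmod_bern_coef_term, Hx.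
  - apply (ex_series_scal 5 (fun k => (1 / 2) ^ k)), ex_series_geom.
    rewrite Rabs_pos_eq; lra.
Qed.

Lemma Cmult_eq_0_l (a b : C) : b <> RtoC 0 -> (a * b = 0)%C -> a = RtoC 0.
Proof.
  intros Hb E. replace a with (a * b / b)%C by (field; exact Hb).
  rewrite E. field. exact Hb.
Qed.

Lemma bern_generating_cotan X x : 0 < Rabs x <= 1 / 2 ->
  let t := (C2i * RtoC x)%C in
  (Cexp t - 1 <> 0 /\
   t * Cexp (X * t) / (Cexp t - 1) = (RtoC (x * cotan x) - RtoC x * Ci) * Cexp (X * t))%C.
Proof.
  intros Hx t. assert (H := cotan_exp x (sin_neq_0_small x Hx)). fold t in H.
  assert (Hx0 : RtoC x <> RtoC 0).
  { intros E. apply RtoC_inj in E. rewrite E, Rabs_R0 in Hx. lra. }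
  assert (N : (Cexp t - 1 <> 0)%C).
  { intros E. rewrite E, Cmult_0_r in H. symmetry in H. unfold t in H.
    exact (Cmult_neq_0 _ _ C2i_neq_0 Hx0 H). }
  split; [exact N|]. rewrite <- H at 1. field. exact N.
Qed.

Lemma Cmod_C2i_mult x : Cmod (C2i * RtoC x) = 2 * Rabs x.
Proof. rewrite Cmod_mult, Cmod_C2i, Cmod_R. reflexivity. Qed.

(** The generating function is compared on the imaginary axis near 0, where the
    Taylor coefficients of t / (e^t - 1) are known from the cotangent. *)
Lemma bernoulli_formula B : is_bernoulli_polynomials B -> forall X n,
  (B n X / RtoC (INR (fact n)) =
   csum (fun k => bern_coef k * exp_term X (n - k)) (S n))%C.
Proof.
  intros HB X n. destruct (HB X) as [r [Hr H]].
  assert (Hr' : 0 < Rmin (r / 2) (1 / 2)) by (apply Rmin_glb_lt; lra).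
  assert (L1 := Rmin_l (r / 2) (1 / 2)). assert (L2 := Rmin_r (r / 2) (1 / 2)).
  assert (Z : ((B n X / RtoC (INR (fact n)) -
     csum (fun k => bern_coef k * exp_term X (n - k)) (S n)) * C2i ^ n = 0)%C).
  2:{ apply Cmult_eq_0_l in Z; [|apply Cpow_nz, C2i_neq_0].
      rewrite <- (Cplus_0_r (csum _ _)), <- Z. ring. }
  revert n.
  apply (Cpseries_zero_coeffs (fun n => (B n X / RtoC (INR (fact n)) -
     csum (fun k => bern_coef k * exp_term X (n - k)) (S n)) * C2i ^ n)%C _ Hr').
  intros x Hx. assert (Hx2 : 0 < Rabs x <= 1 / 2) by lra.
  set (t := (C2i * RtoC x)%C).
  assert (Ht : 0 < Cmod t < r) by (unfold t; rewrite Cmod_C2i_mult; lra).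
  specialize (H t Ht).
  destruct (bern_generating_cotan X x Hx2) as [_ G]. fold t in G. rewrite G in H.
  eapply is_Cseries_ext; [| |apply (is_Cseries_minus _ _ _ _ H
    (is_Cseries_mult _ _ _ _ (is_series_bern_coef x Hx2) (is_series_Cexp (X * t))
       (ex_series_Cmod_bern x (proj2 Hx2)) (ex_series_Cmod_exp_term (X * t))))].
  2:{ ring. }
  intros n. cbv beta.
  rewrite (csum_ext (fun k => bern_coef k * (C2i * RtoC x) ^ k * exp_term (X * t) (n - k))
    (fun k => t ^ n * (bern_coef k * exp_term X (n - k))))%C.
  - rewrite csum_scal. rewrite RtoC_pow.
    replace (t ^ n)%C with (C2i ^ n * RtoC x ^ n)%C
      by (unfold t; rewrite Cpow_mult_l; reflexivity).
    field. apply INR_fact_C.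
  - intros k Hk. fold t. replace (t ^ n)%C with (t ^ k * t ^ (n - k))%C
      by (rewrite <- Cpow_add_r; f_equal; lia).
    unfold exp_term. rewrite Cpow_mult_l. field. apply INR_fact_C.
Qed.

(** In the difference of the two generating functions the factor e^t - 1 cancels,
    leaving t e^(Xt). *)
Lemma bernoulli_difference B : is_bernoulli_polynomials B -> forall X m,
  (B (S m) (X + 1) - B (S m) X = RtoC (INR (S m)) * X ^ m)%C.
Proof.
  intros HB X m. destruct (HB X) as [r1 [Hr1 H1]].
  destruct (HB (X + 1)%C) as [r2 [Hr2 H2]].
  set (r := Rmin (r1 / 2) (Rmin (r2 / 2) (1 / 2))).
  assert (Hr : 0 < r) by (repeat apply Rmin_glb_lt; lra).
  assert (L1 : r <= r1 / 2) by apply Rmin_l.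
  assert (L : r <= Rmin (r2 / 2) (1 / 2)) by apply Rmin_r.
  assert (L2 := Rmin_l (r2 / 2) (1 / 2)). assert (L3 := Rmin_r (r2 / 2) (1 / 2)).
  set (g := fun n => match n with O => RtoC 0 | S m => exp_term X m end).
  assert (Z : forall n, (((B n (X + 1) - B n X) / RtoC (INR (fact n)) - g n) * C2i ^ n = 0)%C).
  2:{ specialize (Z (S m)). apply Cmult_eq_0_l in Z; [|apply Cpow_nz, C2i_neq_0].
      unfold g, exp_term in Z.
      assert (F := INR_fact_C m). assert (F' := INR_fact_C (S m)).
      rewrite fact_simpl, mult_INR, RtoC_mult in Z, F'.
      set (f := RtoC (INR (fact m))) in *.
      assert (G : RtoC (INR (S m)) <> RtoC 0) by (intros E; apply F'; rewrite E; ring).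
      set (s := RtoC (INR (S m))) in *.
      set (d := (B (S m) (X + 1) - B (S m) X)%C) in *.
      replace d with ((d / (s * f) - X ^ m / f) * (s * f) + s * X ^ m)%C
        by (field; auto).
      rewrite Z. ring. }
  apply (Cpseries_zero_coeffs _ r Hr).
  intros x Hx. assert (Hx2 : 0 < Rabs x <= 1 / 2) by lra.
  set (t := (C2i * RtoC x)%C).
  assert (Ht : Cmod t = 2 * Rabs x) by apply Cmod_C2i_mult.
  specialize (H1 t ltac:(lra)). specialize (H2 t ltac:(lra)).
  destruct (bern_generating_cotan X x Hx2) as [N _]. fold t in N.
  assert (H3 : @is_series C_AbsRing C_NormedModule (fun n => g n * t ^ n)%C (t * Cexp (X * t))%C).
  { apply is_Cseries_Cmod. apply is_lim_seq_incr_1.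
    eapply is_lim_seq_ext; [|rewrite <- (Rmult_0_r (Cmod t));
      apply (is_lim_seq_scal_l _ _ 0 (is_lim_Cexp_partial (X * t)))].
    intros n. cbv beta. rewrite csum_head, <- Cmod_mult. f_equal.
    rewrite (csum_ext (fun k => g (S k) * t ^ S k)%C (fun k => t * exp_term (X * t) k)%C).
    - rewrite csum_scal. unfold g. ring.
    - intros i _. unfold g, exp_term. rewrite Cpow_mult_l, Cpow_S. field. apply INR_fact_C. }
  eapply is_Cseries_ext; [| |exact (is_Cseries_minus _ _ _ _ (is_Cseries_minus _ _ _ _ H2 H1) H3)].
  - intros n. cbv beta. rewrite RtoC_pow.
    replace (t ^ n)%C with (C2i ^ n * RtoC x ^ n)%C
      by (unfold t; rewrite Cpow_mult_l; reflexivity).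
    field. apply INR_fact_C.
  - replace ((X + 1) * t)%C with (X * t + t)%C by ring. rewrite Cexp_add.
    field. exact N.
Qed.

(** * Slowly decreasing power sums *)

(** The terms of the series of exp n, divided by its largest term and read from there
    in either direction, form such a sequence: a discrete half Gaussian of width
    sqrt n.  Its first differences have total mass at most 1, but by the last two conditions
    they vary so little that its second differences have mass O(n^(-1/2)). *)
Record slow (n : R) (u : nat -> R) : Prop := {
  slow_0 : u O = 1;
  slow_pos : forall i, 0 <= u i;
  slow_decr : forall i, u (S i) <= u i;
  slow_first : u O - u 1%nat <= / n;
  slow_mass : forall i, INR (S i) * u (S i) <= n * (u i - u (S i));
  slow_second : forall i,
    n * Rabs ((u (S i) - u (S (S i))) - (u i - u (S i))) <=
    u i + INR (S (S i)) * (u i - u (S i)) +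
    u (S i) + INR (S (S i)) * (u (S i) - u (S (S i)))
}.

(** A bound for the total mass of a [slow] sequence. *)
Definition slow_bound (n : R) : R := 2 * sqrt n + 2.

Lemma slow_le_1 n u i : slow n u -> u i <= 1.
Proof.
  intros Hu. induction i as [|i IH]; [rewrite (slow_0 _ _ Hu); lra|].
  assert (H := slow_decr _ _ Hu i). lra.
Qed.

Lemma rsum_drop n u (Hu : slow n u) M : rsum (fun i => u i - u (S i)) M = 1 - u M.
Proof.
  induction M as [|M IH]; simpl; [rewrite (slow_0 _ _ Hu)|rewrite IH]; ring.
Qed.

(** The first moment is at most n, so the indices beyond sqrt n carry a mass of at
    most sqrt n. *)
Lemma slow_sum n u (Hn : 1 <= n) (Hu : slow n u) M : rsum u M <= slow_bound n.
Proof.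
  set (s := sqrt n).
  assert (Hs : 1 <= s) by (unfold s; rewrite <- sqrt_1; apply sqrt_le_1; lra).
  assert (Hss : s * s = n) by (apply sqrt_sqrt; lra).
  destruct (archimed s) as [A1 A2]. set (J := Z.to_nat (up s)).
  assert (HJ : INR J = IZR (up s)).
  { unfold J. rewrite INR_IZR_INZ, Z2Nat.id; [reflexivity|].
    apply le_IZR. lra. }
  assert (Hi : forall K, rsum (fun i => if Nat.ltb i J then 1 else 0) K <= INR J).
  { assert (G : forall K, rsum (fun i => if Nat.ltb i J then 1 else 0) K = INR (Nat.min K J)).
    { induction K as [|K IH]; [reflexivity|]. cbn [rsum]. rewrite IH.
      destruct (Nat.ltb_spec K J).
      - replace (Nat.min (S K) J) with (S (Nat.min K J)) by lia. rewrite S_INR. reflexivity.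
      - replace (Nat.min (S K) J) with (Nat.min K J) by lia. ring. }
    intros K. rewrite G. apply le_INR. lia. }
  assert (Hm : forall K, rsum (fun i => INR i * u i) K <= n).
  { intros K. eapply Rle_trans.
    - apply (rsum_mono _ K (S K)); [lia|]. intros i.
      apply Rmult_le_pos; [apply pos_INR|apply (slow_pos _ _ Hu)].
    - rewrite rsum_head. simpl (INR 0). rewrite Rmult_0_l, Rplus_0_l.
      eapply Rle_trans; [apply rsum_le; intros i _; apply (slow_mass _ _ Hu)|].
      rewrite rsum_scal, (rsum_drop n u Hu). assert (H := slow_pos _ _ Hu K). nra. }
  apply Rle_trans with
    (rsum (fun i => (if Nat.ltb i J then 1 else 0) + / s * (INR i * u i)) M).
  - apply rsum_le. intros i _.
    assert (P := slow_pos _ _ Hu i).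
    assert (L := slow_le_1 n u i Hu).
    assert (Q : 0 < / s) by (apply Rinv_0_lt_compat; lra).
    destruct (Nat.ltb_spec i J) as [E|E].
    + assert (0 <= INR i * u i) by (apply Rmult_le_pos; [apply pos_INR|exact P]). nra.
    + apply le_INR in E. rewrite Rplus_0_l.
      apply Rle_trans with (/ s * (s * u i)); [right; field; lra|].
      apply Rmult_le_compat_l; [lra|]. apply Rmult_le_compat_r; lra.
  - rewrite rsum_plus, rsum_scal. specialize (Hi M). specialize (Hm M).
    assert (/ s * rsum (fun i => INR i * u i) M <= s).
    { apply Rle_trans with (/ s * n).
      - apply Rmult_le_compat_l; [left; apply Rinv_0_lt_compat|]; lra.
      - right. rewrite <- Hss. field. lra. }
    unfold slow_bound. fold s. lra.
Qed.

Lemma slow_csum_bound n u (Hn : 1 <= n) (Hu : slow n u) (v : C) M : Cmod v <= 1 ->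
  Cmod (csum (fun i => RtoC (u i) * v ^ i)%C M) <= slow_bound n.
Proof.
  intros Hv. eapply Rle_trans; [apply Cmod_csum|].
  eapply Rle_trans; [|apply (slow_sum n u Hn Hu M)]. apply rsum_le. intros i _.
  rewrite Cmod_mult, Cmod_R, Cmod_pow, Rabs_pos_eq by apply (slow_pos _ _ Hu).
  assert (Cmod v ^ i <= 1).
  { rewrite <- (pow1 i). apply pow_incr. split; [apply Cmod_ge_0|exact Hv]. }
  assert (H' := slow_pos _ _ Hu i). nra.
Qed.

(** Summation by parts. *)
Lemma slow_weighted_drop n u (Hu : slow n u) M :
  rsum (fun i => INR (S (S i)) * (u i - u (S i))) M <= 1 + rsum u M.
Proof.
  assert (E : rsum (fun i => INR (S (S i)) * (u i - u (S i))) M =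
              1 + rsum u M - INR (S M) * u M).
  { induction M as [|M IH].
    - simpl. rewrite (slow_0 _ _ Hu). ring.
    - cbn [rsum]. rewrite IH, !S_INR. ring. }
  rewrite E. assert (0 <= INR (S M) * u M)
    by (apply Rmult_le_pos; [apply pos_INR|apply (slow_pos _ _ Hu)]). lra.
Qed.

Lemma slow_variation n u (Hn : 1 <= n) (Hu : slow n u) M :
  n * rsum (fun i => Rabs ((u (S i) - u (S (S i))) - (u i - u (S i)))) M <=
  4 * slow_bound n + 2.
Proof.
  rewrite <- rsum_scal.
  eapply Rle_trans; [apply rsum_le; intros i _; apply (slow_second _ _ Hu)|].
  rewrite !rsum_plus.
  assert (A := slow_sum n u Hn Hu M). assert (A' := slow_sum n u Hn Hu (S M)).
  assert (W := slow_weighted_drop n u Hu M).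
  assert (W' := slow_weighted_drop n u Hu (S M)).
  rewrite !rsum_head, !(slow_0 _ _ Hu) in W'. rewrite rsum_head, (slow_0 _ _ Hu) in A'.
  assert (D0 := slow_decr _ _ Hu 0). rewrite (slow_0 _ _ Hu) in D0.
  assert (rsum (fun i => INR (S (S i)) * (u (S i) - u (S (S i)))) M <=
          rsum (fun i => INR (S (S (S i))) * (u (S i) - u (S (S i)))) M).
  { apply rsum_le. intros i _. apply Rmult_le_compat_r.
    - assert (D := slow_decr _ _ Hu (S i)). lra.
    - apply le_INR. lia. }
  assert (0 <= INR 2 * (1 - u 1%nat)) by (simpl; nra).
  lra.
Qed.

(** Multiplying by 1 - v turns the coefficients into their first differences, and
    once more into their second differences, whose total mass is only of order
    n^(-1/2).  The bound stays valid on the whole unit circle except v = 1. *)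
Lemma slow_csum_limit n u (Hn : 1 <= n) (Hu : slow n u) (v : C) M :
  Cmod v <= 1 -> v <> RtoC 1 ->
  Cmod (csum (fun i => RtoC (u i) * v ^ i)%C (S M) - / (1 - v)) <=
  (38 / sqrt n + 2 * u M) / Cmod (1 - v) ^ 2.
Proof.
  intros Hv Hv1. assert (Hv2 : (1 - v <> 0)%C).
  { intros E. apply Hv1. replace v with (1 - (1 - v))%C by ring. rewrite E. ring. }
  assert (Hm : 0 < Cmod (1 - v)) by (apply Cmod_gt_0; exact Hv2).
  assert (Hp : forall i, Cmod (v ^ i) <= 1).
  { intros i. rewrite Cmod_pow, <- (pow1 i). apply pow_incr.
    split; [apply Cmod_ge_0|exact Hv]. }
  set (d := fun i => u i - u (S i)).
  assert (E1 : forall K, ((1 - v) * csum (fun i => RtoC (u i) * v ^ i) (S K) - 1 =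
    - (v * csum (fun i => RtoC (d i) * v ^ i) K) - RtoC (u K) * v ^ S K)%C).
  { induction K as [|K IH].
    - simpl. rewrite (slow_0 _ _ Hu). ring.
    - replace ((1 - v) * csum (fun i => RtoC (u i) * v ^ i) (S (S K)) - 1)%C with
        (((1 - v) * csum (fun i => RtoC (u i) * v ^ i) (S K) - 1) +
          (1 - v) * (RtoC (u (S K)) * v ^ S K))%C by (cbn [csum]; ring).
      rewrite IH. cbn [csum]. unfold d. rewrite RtoC_minus. cbn [Cpow]. ring. }
  assert (E2 : forall K, ((1 - v) * csum (fun i => RtoC (d i) * v ^ i) (S K) =
    RtoC (d O) + v * csum (fun i => RtoC (d (S i) - d i) * v ^ i) K - RtoC (d K) * v ^ S K)%C).
  { induction K as [|K IH].
    - simpl. ring.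
    - replace ((1 - v) * csum (fun i => RtoC (d i) * v ^ i) (S (S K)))%C with
        ((1 - v) * csum (fun i => RtoC (d i) * v ^ i) (S K) +
          (1 - v) * (RtoC (d (S K)) * v ^ S K))%C by (cbn [csum]; ring).
      rewrite IH. cbn [csum]. rewrite RtoC_minus. cbn [Cpow]. ring. }
  set (V := fun K => rsum (fun i => Rabs (d (S i) - d i)) K).
  assert (HV : forall K, d O + V K <= 19 / sqrt n).
  { intros K. assert (W := slow_variation n u Hn Hu K).
    fold (d O) in *. change (rsum _ K) with (V K) in W.
    assert (D := slow_first _ _ Hu). fold (d O) in D.
    set (s := sqrt n).
    assert (Hs : 1 <= s) by (unfold s; rewrite <- sqrt_1; apply sqrt_le_1; lra).
    assert (Hss : s * s = n) by (apply sqrt_sqrt; lra).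
    unfold slow_bound in W. fold s in W.
    apply Rmult_le_reg_l with n; [lra|].
    assert (n * d O <= 1).
    { apply Rle_trans with (n * / n); [apply Rmult_le_compat_l; lra|].
      right. apply Rinv_r. lra. }
    apply Rle_trans with (19 * s); [lra|]. right. rewrite <- Hss. field. lra. }
  assert (Hd : forall K, 0 <= d K <= d O + V K).
  { intros K. split; [unfold d; assert (D := slow_decr _ _ Hu K); lra|].
    induction K as [|K IH].
    - unfold V. simpl. lra.
    - unfold V in *. cbn [rsum]. assert (T := Rle_abs (d (S K) - d K)). lra. }
  assert (B2 : forall K, Cmod (1 - v) * Cmod (csum (fun i => RtoC (d i) * v ^ i)%C K) <=
                38 / sqrt n).
  { intros K. assert (Hs0 : 0 < / sqrt n) by (apply Rinv_0_lt_compat, sqrt_lt_R0; lra).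
    destruct K as [|K]; [simpl; rewrite Cmod_0; unfold Rdiv; lra|].
    rewrite <- Cmod_mult, E2. unfold Cminus.
    eapply Rle_trans; [apply Cmod_triangle|].
    eapply Rle_trans; [apply Rplus_le_compat_r, Cmod_triangle|].
    rewrite Cmod_opp, !Cmod_mult, !Cmod_R.
    assert (Cmod (csum (fun i => RtoC (d (S i) - d i) * v ^ i)%C K) <= V K).
    { eapply Rle_trans; [apply Cmod_csum|]. apply rsum_le. intros i _.
      rewrite Cmod_mult, Cmod_R. assert (T := Hp i).
      assert (U := Rabs_pos (d (S i) - d i)). assert (P := Cmod_ge_0 (v ^ i)). nra. }
    assert (D0 := proj1 (Hd O)). assert (DK := Hd K).
    rewrite !Rabs_pos_eq by lra.
    assert (Q := Hp (S K)). assert (Q0 := Cmod_ge_0 (v ^ S K)).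
    assert (W0 := Cmod_ge_0 v). assert (HVK := HV K).
    assert (W1 := Cmod_ge_0 (csum (fun i => RtoC (d (S i) - d i) * v ^ i)%C K)).
    unfold Rdiv in *. nra. }
  assert (Key : Cmod (1 - v) * Cmod ((1 - v) * csum (fun i => RtoC (u i) * v ^ i) (S M) - 1)%C
    <= 38 / sqrt n + 2 * u M).
  { rewrite E1. unfold Cminus at 2.
    eapply Rle_trans; [apply Rmult_le_compat_l; [lra|apply Cmod_triangle]|].
    rewrite !Cmod_opp, !Cmod_mult, Cmod_R, (Rabs_pos_eq (u M)) by apply (slow_pos _ _ Hu).
    assert (B := B2 M). assert (Q := Hp (S M)). assert (Q0 := Cmod_ge_0 (v ^ S M)).
    assert (W0 := Cmod_ge_0 v). assert (U0 := slow_pos _ _ Hu M).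
    assert (C2 : Cmod (1 - v) <= 2).
    { unfold Cminus. eapply Rle_trans; [apply Cmod_triangle|].
      rewrite Cmod_1, Cmod_opp. lra. }
    rewrite Rmult_plus_distr_l. apply Rplus_le_compat.
    - set (X := Cmod (csum (fun i => RtoC (d i) * v ^ i)%C M)) in *.
      assert (X0 : 0 <= X) by apply Cmod_ge_0.
      assert (P0 : 0 <= Cmod (1 - v) * X) by (apply Rmult_le_pos; lra). nra.
    - apply Rmult_le_compat; nra. }
  replace (csum (fun i => RtoC (u i) * v ^ i)%C (S M) - / (1 - v))%C with
    (((1 - v) * csum (fun i => RtoC (u i) * v ^ i)%C (S M) - 1) / (1 - v))%C
    by (field; exact Hv2).
  rewrite Cmod_div by exact Hv2.
  apply Rmult_le_reg_r with (Cmod (1 - v) ^ 2); [apply pow_lt, Hm|].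
  assert (Hs0 : 0 < sqrt n) by (apply sqrt_lt_R0; lra).
  replace ((38 / sqrt n + 2 * u M) / Cmod (1 - v) ^ 2 * Cmod (1 - v) ^ 2)
    with (38 / sqrt n + 2 * u M) by (field; lra).
  eapply Rle_trans; [right|exact Key]. field. lra.
Qed.

(** * Sections of the exponential series *)

(** [fall n k] is n! / ((n - k)! n^k), and [rise n i] is n! n^i / (n + i)!. *)
Fixpoint fall (n k : nat) : R :=
  match k with O => 1 | S k => fall n k * (1 - INR k / INR n) end.

Fixpoint rise (n i : nat) : R :=
  match i with O => 1 | S i => rise n i * (INR n / INR (n + S i)) end.

(** The sum of the first n terms of exp (n w), in units of the term of index n. *)
Definition exp_section (n : nat) (w : C) : C :=
  csum (fun i => RtoC (fall n (S i)) * (/ w) ^ S i)%C n.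

(** exp (n w), in the same units. *)
Definition exp_ratio (n : nat) (w : C) : C :=
  (RtoC (INR (fact n)) * Cexp (RtoC (INR n) * w) / (RtoC (INR n) * w) ^ n)%C.

Lemma INR_ge_1 n : (1 <= n)%nat -> 1 <= INR n.
Proof. intros H. apply (le_INR 1), H. Qed.

Lemma fall_zero n k : (1 <= n)%nat -> (n < k)%nat -> fall n k = 0.
Proof.
  intros Hn Hk. induction k as [|k IH]; [lia|]. cbn [fall].
  assert (H := INR_ge_1 n Hn).
  destruct (Nat.eq_dec k n) as [->|E].
  - unfold Rdiv. rewrite Rinv_r by lra. ring.
  - rewrite IH by lia. ring.
Qed.

Lemma fall_pos n k : (1 <= n)%nat -> 0 <= fall n k.
Proof.
  intros Hn. assert (H := INR_ge_1 n Hn).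
  induction k as [|k IH]; cbn [fall]; [lra|].
  destruct (Nat.le_gt_cases k n) as [E|E].
  - apply Rmult_le_pos; [exact IH|]. apply le_INR in E.
    assert (INR k / INR n <= 1); [|lra].
    apply Rmult_le_reg_r with (INR n); [lra|].
    replace (INR k / INR n * INR n) with (INR k) by (field; lra). lra.
  - rewrite (fall_zero n k Hn E). lra.
Qed.

Lemma fall_fact n k : (1 <= n)%nat -> (k <= n)%nat ->
  fall n k * (INR (fact (n - k)) * INR n ^ k) = INR (fact n).
Proof.
  intros Hn. assert (H := INR_ge_1 n Hn).
  induction k as [|k IH]; intros Hk.
  - rewrite Nat.sub_0_r. simpl. ring.
  - rewrite <- IH by lia. replace (n - k)%nat with (S (n - S k)) by lia.
    rewrite fact_simpl, mult_INR. replace (S (n - S k)) with (n - k)%nat by lia.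
    rewrite minus_INR by lia. cbn [fall pow]. field. lra.
Qed.

Lemma rise_pos n i : (1 <= n)%nat -> 0 <= rise n i.
Proof.
  intros Hn. induction i as [|i IH]; cbn [rise]; [lra|].
  apply Rmult_le_pos; [exact IH|]. apply Rle_div_r; [apply lt_0_INR; lia|].
  rewrite Rmult_0_l. apply pos_INR.
Qed.

Lemma rise_fact n i : rise n i * INR (fact (n + i)) = INR (fact n) * INR n ^ i.
Proof.
  induction i as [|i IH].
  - rewrite Nat.add_0_r. simpl. ring.
  - cbn [rise pow]. rewrite (Nat.add_succ_r n i), fact_simpl, mult_INR.
    transitivity (rise n i * INR (fact (n + i)) * INR n).
    + field. apply not_0_INR. lia.
    + rewrite IH. ring.
Qed.

(** All conditions follow from n (u_i - u_(i+1)) = (i+1) u_i. *)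
Lemma slow_fall n : (1 <= n)%nat -> slow (INR n) (fun i => fall n (S i)).
Proof.
  intros Hn. assert (H := INR_ge_1 n Hn).
  assert (P : forall i, 0 <= fall n (S i)) by (intros i; apply fall_pos, Hn).
  assert (D : forall i, INR n * (fall n (S i) - fall n (S (S i))) = INR (S i) * fall n (S i)).
  { intros i. cbn [fall]. field. lra. }
  assert (D' : forall i, fall n (S (S i)) <= fall n (S i)).
  { intros i. assert (0 <= INR (S i) * fall n (S i))
      by (apply Rmult_le_pos; [apply pos_INR|apply P]).
    specialize (D i). nra. }
  constructor.
  - cbn. field. lra.
  - exact P.
  - exact D'.
  - right. cbn. field. lra.
  - intros i. rewrite D. apply Rmult_le_compat_l; [apply pos_INR|apply D'].
  - intros i. specialize (P i) as P0. specialize (P (S i)) as P1.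
    set (u0 := fall n (S i)) in *. set (u1 := fall n (S (S i))) in *.
    set (u2 := fall n (S (S (S i)))) in *.
    assert (D0 : INR n * (u0 - u1) = INR (S i) * u0) by apply D.
    assert (D1 : INR n * (u1 - u2) = INR (S (S i)) * u1) by apply D.
    assert (E0 : u1 <= u0) by apply D'. assert (E1 : u2 <= u1) by apply D'.
    assert (Q : 0 <= INR (S (S i))) by apply pos_INR.
    assert (Q0 : 0 <= INR (S (S i)) * (u0 - u1)) by (apply Rmult_le_pos; lra).
    assert (Q1 : 0 <= INR (S (S i)) * (u1 - u2)) by (apply Rmult_le_pos; lra).
    rewrite <- (Rabs_pos_eq (INR n)) at 1 by lra. rewrite <- Rabs_mult.
    replace (INR n * (u1 - u2 - (u0 - u1))) with (INR (S (S i)) * u1 - INR (S i) * u0) by lra.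
    rewrite (S_INR (S i)) in *. set (a := INR (S i)) in *.
    replace ((a + 1) * u1 - a * u0) with (u0 - (a + 1) * (u0 - u1)) by ring.
    apply Rabs_le. split; lra.
Qed.

(** All conditions follow from n (u_i - u_(i+1)) = (i+1) u_(i+1). *)
Lemma slow_rise n : (1 <= n)%nat -> slow (INR n) (rise n).
Proof.
  intros Hn. assert (H := INR_ge_1 n Hn).
  assert (P : forall i, 0 <= rise n i) by (intros i; apply rise_pos, Hn).
  assert (D : forall i, INR n * (rise n i - rise n (S i)) = INR (S i) * rise n (S i)).
  { intros i. cbn [rise]. rewrite plus_INR.
    assert (0 < INR (S i)) by (apply lt_0_INR; lia). field. lra. }
  assert (D' : forall i, rise n (S i) <= rise n i).
  { intros i. assert (0 <= INR (S i) * rise n (S i))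
      by (apply Rmult_le_pos; [apply pos_INR|apply P]).
    specialize (D i). nra. }
  constructor.
  - reflexivity.
  - exact P.
  - exact D'.
  - specialize (D O). simpl (INR 1) in D. specialize (D' O). cbn [rise] in *.
    apply Rmult_le_reg_l with (INR n); [lra|]. rewrite Rinv_r by lra. lra.
  - intros i. rewrite D. lra.
  - intros i. specialize (P (S i)) as P1. specialize (P (S (S i))) as P2.
    set (u0 := rise n i) in *. set (u1 := rise n (S i)) in *.
    set (u2 := rise n (S (S i))) in *.
    assert (D0 : INR n * (u0 - u1) = INR (S i) * u1) by apply D.
    assert (D1 : INR n * (u1 - u2) = INR (S (S i)) * u2) by apply D.
    assert (E0 : u1 <= u0) by apply D'. assert (E1 : u2 <= u1) by apply D'.
    assert (Q : 0 <= INR (S (S i))) by apply pos_INR.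
    assert (Q0 : 0 <= INR (S (S i)) * (u0 - u1)) by (apply Rmult_le_pos; lra).
    assert (Q1 : 0 <= INR (S (S i)) * (u1 - u2)) by (apply Rmult_le_pos; lra).
    rewrite <- (Rabs_pos_eq (INR n)) at 1 by lra. rewrite <- Rabs_mult.
    replace (INR n * (u1 - u2 - (u0 - u1))) with (INR (S (S i)) * u2 - INR (S i) * u1) by lra.
    rewrite (S_INR (S i)) in *. set (a := INR (S i)) in *.
    assert (0 <= u0) by lra.
    replace ((a + 1) * u2 - a * u1) with (u1 - (a + 1) * (u1 - u2)) by ring.
    apply Rabs_le. split; lra.
Qed.

Lemma exp_section_csum n w :
  exp_section n w = (/ w * csum (fun i => RtoC (fall n (S i)) * (/ w) ^ i)%C n)%C.
Proof.
  unfold exp_section. rewrite <- csum_scal. apply csum_ext. intros i _. cbn [Cpow]. ring.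
Qed.

Lemma RtoC_neq_0 x : x <> 0 -> RtoC x <> RtoC 0.
Proof. intros H E. apply H, RtoC_inj, E. Qed.

(** The terms of index n + i of exp (n w), for i >= 0, complete the section. *)
Lemma exp_section_complement n w M : (1 <= n)%nat -> w <> RtoC 0 ->
  (RtoC (INR (fact n)) / (RtoC (INR n) * w) ^ n * csum (exp_term (RtoC (INR n) * w)) (n + M) =
   exp_section n w + csum (fun i => RtoC (rise n i) * w ^ i) M)%C.
Proof.
  intros Hn Hw. assert (H := INR_ge_1 n Hn).
  set (N := RtoC (INR n)).
  assert (HN : N <> RtoC 0) by (apply RtoC_neq_0; lra).
  assert (HNp : forall k, (N ^ k <> 0)%C) by (intros k; apply Cpow_nz, HN).
  assert (Hwp : forall k, (w ^ k <> 0)%C) by (intros k; apply Cpow_nz, Hw).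
  rewrite csum_split, Cmult_plus_distr_l. f_equal.
  - unfold exp_section. rewrite <- csum_scal, <- csum_rev. apply csum_ext. intros i Hi.
    assert (F := fall_fact n (S i) Hn ltac:(lia)).
    rewrite <- F, !RtoC_mult, RtoC_pow. fold N. unfold exp_term.
    rewrite Cpow_inv by exact Hw. rewrite !Cpow_mult_l.
    replace (N ^ n)%C with (N ^ (n - S i) * N ^ S i)%C by (rewrite <- Cpow_add_r; f_equal; lia).
    replace (w ^ n)%C with (w ^ (n - S i) * w ^ S i)%C by (rewrite <- Cpow_add_r; f_equal; lia).
    field. repeat split; auto using INR_fact_C.
  - rewrite <- csum_scal. apply csum_ext. intros i _.
    assert (R : RtoC (rise n i) = (RtoC (INR (fact n)) * N ^ i / RtoC (INR (fact (n + i))))%C).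
    { unfold N. rewrite <- RtoC_pow, <- RtoC_mult, <- rise_fact, RtoC_mult.
      field. apply INR_fact_C. }
    rewrite R. unfold exp_term. rewrite !Cpow_mult_l, !Cpow_add_r.
    field. repeat split; auto using INR_fact_C.
Qed.

Lemma is_lim_exp_section n w : (1 <= n)%nat -> w <> RtoC 0 ->
  is_lim_seq (fun M => Cmod (exp_section n w + csum (fun i => RtoC (rise n i) * w ^ i)%C M
                             - exp_ratio n w)) 0.
Proof.
  intros Hn Hw.
  set (q := (RtoC (INR (fact n)) / (RtoC (INR n) * w) ^ n)%C).
  eapply is_lim_seq_ext; [|rewrite <- (Rmult_0_r (Cmod q));
    apply (is_lim_seq_scal_l (fun M => Cmod (csum (exp_term (RtoC (INR n) * w)) (M + n)
             - Cexp (RtoC (INR n) * w))) _ 0)].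
  - intros M. cbv beta. rewrite <- Cmod_mult. f_equal.
    rewrite <- (exp_section_complement n w M Hn Hw), (Nat.add_comm M n).
    unfold exp_ratio, q, Cdiv. ring.
  - apply (proj1 (is_lim_seq_incr_n (fun M => Cmod (csum (exp_term (RtoC (INR n) * w)) M
             - Cexp (RtoC (INR n) * w))) n 0)), is_lim_Cexp_partial.
Qed.

Lemma Cmod_inv_le_1 w : 1 <= Cmod w -> Cmod (/ w) <= 1.
Proof.
  intros H. rewrite Cmod_inv by (apply Cmod_gt_0; lra).
  rewrite <- Rinv_1. apply Rinv_le_contravar; lra.
Qed.

Lemma exp_section_bound_out n w : (1 <= n)%nat -> 1 <= Cmod w ->
  Cmod (exp_section n w) <= slow_bound (INR n).
Proof.
  intros Hn Hw. rewrite exp_section_csum, Cmod_mult.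
  assert (A := slow_csum_bound _ _ (INR_ge_1 n Hn) (slow_fall n Hn) (/ w) n (Cmod_inv_le_1 w Hw)).
  assert (B := Cmod_inv_le_1 w Hw). assert (B0 := Cmod_ge_0 (/ w)).
  cbv beta in A. set (X := csum _ n) in *. assert (X0 := Cmod_ge_0 X). nra.
Qed.

(** On and outside the unit circle the section is a [slow] sum in 1/w. *)
Lemma exp_section_limit_out n w : (1 <= n)%nat -> 1 <= Cmod w -> w <> RtoC 1 ->
  Cmod (exp_section n w - / (w - 1)) <= 38 / sqrt (INR n) / Cmod (1 - / w) ^ 2.
Proof.
  intros Hn Hw Hw1. assert (Hw0 : w <> RtoC 0) by (apply Cmod_gt_0; lra).
  assert (Hv1 : (/ w)%C <> RtoC 1).
  { intros E. apply Hw1. replace w with (/ / w)%C by (field; exact Hw0).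
    rewrite E. field. }
  assert (Hw2 : (w - 1 <> 0)%C).
  { intros E. apply Hw1. replace w with (w - 1 + 1)%C by ring. rewrite E. ring. }
  assert (A := slow_csum_limit _ _ (INR_ge_1 n Hn) (slow_fall n Hn) (/ w) n
                 (Cmod_inv_le_1 w Hw) Hv1).
  cbv beta in A. rewrite (fall_zero n (S n)), Rmult_0_r, Rplus_0_r in A by lia.
  eapply Rle_trans; [|exact A].
  cbn [csum]. rewrite (fall_zero n (S n)) by lia. rewrite Cmult_0_l, Cplus_0_r.
  rewrite exp_section_csum.
  replace (/ w * csum (fun i => RtoC (fall n (S i)) * (/ w) ^ i)%C n - / (w - 1))%C
    with (/ w * (csum (fun i => RtoC (fall n (S i)) * (/ w) ^ i)%C n - / (1 - / w)))%C
    by (field; auto).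
  rewrite Cmod_mult. assert (B := Cmod_inv_le_1 w Hw). assert (B0 := Cmod_ge_0 (/ w)).
  set (X := (_ - _)%C). assert (X0 := Cmod_ge_0 X). nra.
Qed.

Lemma exp_section_bound_in n w : (1 <= n)%nat -> w <> RtoC 0 -> Cmod w <= 1 ->
  Cmod (exp_section n w - exp_ratio n w) <= slow_bound (INR n).
Proof.
  intros Hn Hw0 Hw.
  assert (L : is_lim_seq (fun M => Cmod (exp_section n w +
        csum (fun i => RtoC (rise n i) * w ^ i)%C M - exp_ratio n w) + slow_bound (INR n))
      (0 + slow_bound (INR n))).
  { apply is_lim_seq_plus'; [apply is_lim_exp_section; assumption|apply is_lim_seq_const]. }
  rewrite Rplus_0_l in L.
  apply (is_lim_seq_le (fun _ => Cmod (exp_section n w - exp_ratio n w)) _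
    (Cmod (exp_section n w - exp_ratio n w)) (slow_bound (INR n))) in L;
    [exact L| |apply is_lim_seq_const].
  intros M. assert (A := slow_csum_bound _ _ (INR_ge_1 n Hn) (slow_rise n Hn) w M Hw).
  cbv beta in A. set (X := csum _ M) in *.
  replace (exp_section n w - exp_ratio n w)%C
    with ((exp_section n w + X - exp_ratio n w) + - X)%C by ring.
  eapply Rle_trans; [apply Cmod_triangle|]. rewrite Cmod_opp. lra.
Qed.

Lemma is_lim_rise n : (1 <= n)%nat -> is_lim_seq (rise n) 0.
Proof.
  intros Hn. assert (H := INR_ge_1 n Hn).
  apply ex_series_lim_0. 
  destruct (ex_finite_lim_seq_incr (rsum (rise n)) (slow_bound (INR n))) as [l Hl].
  - intros i. cbn [rsum]. assert (P := rise_pos n i Hn). lra.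
  - intros M. apply (slow_sum _ _ H (slow_rise n Hn)).
  - exists l. apply is_Rseries_rsum, Hl.
Qed.

(** On and inside the unit circle the complement of the section in exp (n w) is a
    [slow] sum in w, so the section is the full exponential minus a quantity
    converging to 1 / (1 - w).  Together with the exterior case this leaves no gap
    along the circle. *)
Lemma exp_section_limit_in n w : (1 <= n)%nat -> w <> RtoC 0 -> Cmod w <= 1 -> w <> RtoC 1 ->
  Cmod (exp_section n w - exp_ratio n w - / (w - 1)) <=
  38 / sqrt (INR n) / Cmod (1 - w) ^ 2.
Proof.
  intros Hn Hw0 Hw Hw1.
  assert (Hw2 : (w - 1 <> 0)%C).
  { intros E. apply Hw1. replace w with (w - 1 + 1)%C by ring. rewrite E. ring. }
  assert (Hw3 : (1 - w <> 0)%C).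
  { intros E. apply Hw2. replace (w - 1)%C with (- (1 - w))%C by ring. rewrite E. ring. }
  assert (L : is_lim_seq (fun M => Cmod (exp_section n w +
        csum (fun i => RtoC (rise n i) * w ^ i)%C (S M) - exp_ratio n w) +
        (38 / sqrt (INR n) + 2 * rise n M) / Cmod (1 - w) ^ 2)
      (0 + (38 / sqrt (INR n) + 2 * 0) / Cmod (1 - w) ^ 2)).
  { apply is_lim_seq_plus'.
    - apply (proj1 (is_lim_seq_incr_1 _ 0) (is_lim_exp_section n w Hn Hw0)).
    - apply is_lim_seq_mult'; [|apply is_lim_seq_const].
      apply is_lim_seq_plus'; [apply is_lim_seq_const|].
      apply (is_lim_seq_scal_l _ 2 0), is_lim_rise, Hn. }
  replace (0 + (38 / sqrt (INR n) + 2 * 0) / Cmod (1 - w) ^ 2)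
    with (38 / sqrt (INR n) / Cmod (1 - w) ^ 2) in L by (unfold Rdiv; ring).
  apply (is_lim_seq_le (fun _ => Cmod (exp_section n w - exp_ratio n w - / (w - 1))) _
    (Cmod (exp_section n w - exp_ratio n w - / (w - 1)))
    (38 / sqrt (INR n) / Cmod (1 - w) ^ 2)) in L; [exact L| |apply is_lim_seq_const].
  intros M.
  assert (A := slow_csum_limit _ _ (INR_ge_1 n Hn) (slow_rise n Hn) w M Hw Hw1).
  set (X := csum (fun i => RtoC (rise n i) * w ^ i)%C (S M)) in *.
  replace (exp_section n w - exp_ratio n w - / (w - 1))%C
    with ((exp_section n w + X - exp_ratio n w) + - (X - / (1 - w)))%C by (field; auto).
  eapply Rle_trans; [apply Cmod_triangle|]. rewrite Cmod_opp.
  apply Rplus_le_compat_l. exact A.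
Qed.

(** * Rescaled Bernoulli polynomials as sums over poles *)

(** Division by the leading term (nz)^n of B_n(nz) makes the saddle point
    contribution bounded. *)
Definition scaled_bernoulli (B : nat -> C -> C) (n : nat) (z : C) : C :=
  (B n (RtoC (INR n) * z) / (RtoC (INR n) * z) ^ n)%C.

(** The poles at 2 pi i m and -2 pi i m contribute jointly; separately their sum over
    m would not converge absolutely. *)
Definition pole_pair (n : nat) (w : C) : C := (exp_section n w + exp_section n (- w))%C.

Definition pole_pairs (n : nat) (w : C) (K : nat) : C :=
  csum (fun i => pole_pair n (RtoC (INR (S i)) * w)) K.

Lemma scaled_bernoulli_csum B n z :
  is_bernoulli_polynomials B -> (1 <= n)%nat -> z <> RtoC 0 ->
  scaled_bernoulli B n z = csum (fun k => bern_coef k * (RtoC (fall n k) * (/ z) ^ k))%C (S n).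
Proof.
  intros HB Hn Hz. assert (H := INR_ge_1 n Hn).
  set (N := RtoC (INR n)). assert (HN : N <> RtoC 0) by (apply RtoC_neq_0; lra).
  assert (HNp : forall k, (N ^ k <> 0)%C) by (intros k; apply Cpow_nz, HN).
  assert (Hzp : forall k, (z ^ k <> 0)%C) by (intros k; apply Cpow_nz, Hz).
  assert (E := bernoulli_formula B HB (N * z) n).
  unfold scaled_bernoulli. fold N.
  replace (B n (N * z))%C with
    (RtoC (INR (fact n)) * (B n (N * z) / RtoC (INR (fact n))))%C
    by (field; apply INR_fact_C).
  rewrite E. unfold Cdiv. rewrite Cmult_comm, Cmult_assoc, <- csum_scal.
  apply csum_ext. intros k Hk.
  assert (F := fall_fact n k Hn ltac:(lia)).
  rewrite <- F, !RtoC_mult, RtoC_pow. fold N. unfold exp_term.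
  rewrite Cpow_inv by exact Hz. rewrite !Cpow_mult_l.
  replace (N ^ n)%C with (N ^ (n - k) * N ^ k)%C by (rewrite <- Cpow_add_r; f_equal; lia).
  replace (z ^ n)%C with (z ^ (n - k) * z ^ k)%C by (rewrite <- Cpow_add_r; f_equal; lia).
  field. repeat split; auto using INR_fact_C.
Qed.

Lemma RtoC_sign k : ((- (1)) ^ k)%C = RtoC ((-1) ^ k).
Proof. rewrite RtoC_pow. f_equal. apply Ceq_parts; simpl; ring. Qed.

(** Substituting t by t/z moves the saddle point of e^(zt) / t to 1 and the pole
    2 pi i to this point. *)
Definition first_pole (z : C) : C := (C2i * RtoC PI * z)%C.

(** By exchanging sums, the pairs up to K contribute to the coefficient of 1/z^k the
    truncation at K of the pole sum that defines [bern_coef]. *)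
Lemma pole_pairs_csum n z K : z <> RtoC 0 ->
  pole_pairs n (first_pole z) K =
  csum (fun i => RtoC (fall n (S i)) * (/ z) ^ S i *
    ((/ C2i) ^ S i * RtoC ((1 + (-1) ^ S i) * rsum (pole_power (S i)) K)))%C n.
Proof.
  intros Hz. unfold pole_pairs, pole_pair, exp_section.
  rewrite (csum_ext _ (fun j => csum (fun i => RtoC (fall n (S i)) * (/ z) ^ S i *
    ((/ C2i) ^ S i * RtoC ((1 + (-1) ^ S i) * pole_power (S i) j)))%C n)).
  - rewrite csum_exchange. apply csum_ext. intros i _.
    rewrite csum_scal. f_equal. rewrite csum_scal. f_equal.
    rewrite csum_RtoC, rsum_scal. reflexivity.
  - intros j _. rewrite <- csum_plus. apply csum_ext. intros i _.
    assert (Hp : PI * INR (S j) <> 0).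
    { assert (T := pi_gt_3). assert (0 < INR (S j)) by (apply lt_0_INR; lia). nra. }
    assert (E : (/ (RtoC (INR (S j)) * first_pole z) =
       / z * (/ C2i * RtoC (/ (PI * INR (S j)))))%C).
    { rewrite RtoC_inv by exact Hp. unfold first_pole. rewrite RtoC_mult.
      assert (U := RtoC_neq_0 _ Hp). rewrite RtoC_mult in U.
      assert (RtoC PI <> RtoC 0) by (intros X; apply U; rewrite X; ring).
      assert (RtoC (INR (S j)) <> RtoC 0) by (intros X; apply U; rewrite X; ring).
      field. repeat split; auto using C2i_neq_0. }
    assert (E' : (/ - (RtoC (INR (S j)) * first_pole z) =
       - (1) * (/ z * (/ C2i * RtoC (/ (PI * INR (S j))))))%C).
    { rewrite <- E.
      assert (V1 : RtoC (INR (S j)) <> RtoC 0) by (apply RtoC_neq_0, not_0_INR; lia).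
      assert (V2 : first_pole z <> RtoC 0).
      { unfold first_pole. repeat apply Cmult_neq_0; auto using C2i_neq_0.
        apply RtoC_neq_0. assert (T := pi_gt_3). lra. }
      field. auto. }
    rewrite E, E', !Cpow_mult_l, RtoC_sign. unfold pole_power.
    rewrite RtoC_mult, RtoC_plus, !RtoC_pow. ring.
Qed.

(** Truncating the sum over pole pairs costs an error uniform in n: the pairs of
    index above K are geometrically dominated by the sum of the inverse squares. *)
Lemma scaled_bernoulli_pole_pairs B n z K :
  is_bernoulli_polynomials B -> (1 <= n)%nat -> z <> RtoC 0 -> (1 <= K)%nat ->
  1 <= PI * INR K * Cmod z ->
  Cmod (scaled_bernoulli B n z - (1 - / (2 * z) - pole_pairs n (first_pole z) K)) <=
  / (INR K * Cmod z ^ 2).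
Proof.
  intros HB Hn Hz HK HKz. assert (T := pi_gt_3).
  rewrite (scaled_bernoulli_csum B n z HB Hn Hz), (pole_pairs_csum n z K Hz).
  destruct n as [|m]; [lia|]. rewrite csum_head, (csum_head _ m), (csum_head _ m).
  assert (F1 : fall (S m) 1 = 1) by (apply (slow_0 _ _ (slow_fall (S m) Hn))).
  rewrite F1.
  set (r := fun i => (RtoC (fall (S m) (S (S i))) * (/ z) ^ S (S i) * ((/ C2i) ^ S (S i) *
     RtoC (- ((1 + (-1) ^ i) * (pole_sum (S (S i)) - rsum (pole_power (S (S i))) K)))))%C).
  replace (_ - _)%C with (csum r m).
  - assert (Hzp : 0 < Cmod z) by (apply Cmod_gt_0; exact Hz).
    assert (HK1 : 1 <= INR K) by (apply (le_INR 1); lia).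
    eapply Rle_trans; [apply Cmod_csum|].
    apply Rle_trans with (rsum (fun i => / (2 * INR K * Cmod z ^ 2) * (1 / 2) ^ i) m).
    + apply rsum_le. intros i _. unfold r.
      rewrite !Cmod_mult, !Cmod_R, !Cmod_pow, !Cmod_inv by auto using C2i_neq_0.
      rewrite Cmod_C2i.
      assert (A := fall_pos (S m) (S (S i)) Hn).
      assert (A1 : fall (S m) (S (S i)) <= 1)
        by (apply (slow_le_1 _ _ _ (slow_fall (S m) Hn))).
      rewrite (Rabs_pos_eq (fall _ _)) by exact A.
      assert (P := pole_sum_bounds i K HK). assert (Sg := sign_bounds i).
      set (ps := pole_sum (S (S i)) - rsum (pole_power (S (S i))) K) in *.
      rewrite Rabs_Ropp, Rabs_mult, !Rabs_pos_eq by lra.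
      apply Rle_trans with
        (1 * (/ Cmod z) ^ S (S i) * ((/ 2) ^ S (S i) * (2 * ((/ (PI * INR K)) ^ i * / INR K)))).
      * apply Rmult_le_compat.
        -- apply Rmult_le_pos; [exact A|]. apply pow_le. left. apply Rinv_0_lt_compat, Hzp.
        -- apply Rmult_le_pos; [apply pow_le; lra|apply Rmult_le_pos; lra].
        -- apply Rmult_le_compat_r; [|exact A1]. apply pow_le. left. apply Rinv_0_lt_compat, Hzp.
        -- apply Rmult_le_compat_l; [apply pow_le; lra|]. apply Rmult_le_compat; lra.
      * replace (1 * (/ Cmod z) ^ S (S i) * ((/ 2) ^ S (S i) * (2 * ((/ (PI * INR K)) ^ i * / INR K))))
          with (/ (2 * INR K * Cmod z ^ 2) *
                ((/ Cmod z) ^ i * (/ 2) ^ i * (/ (PI * INR K)) ^ i)).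
        2:{ cbn [pow]. field. lra. }
        apply Rmult_le_compat_l.
        -- left. apply Rinv_0_lt_compat. assert (0 < Cmod z ^ 2) by (apply pow_lt, Hzp). nra.
        -- rewrite <- !Rpow_mult_distr. apply pow_incr.
           rewrite <- !Rinv_mult. split.
           ++ left. apply Rinv_0_lt_compat. nra.
           ++ replace (1 / 2) with (/ 2) by field. apply Rinv_le_contravar; nra.
    + rewrite rsum_scal. assert (G := rsum_half_pow m).
      assert (0 < / (2 * INR K * Cmod z ^ 2)).
      { apply Rinv_0_lt_compat. assert (0 < Cmod z ^ 2) by (apply pow_lt, Hzp). nra. }
      apply Rle_trans with (/ (2 * INR K * Cmod z ^ 2) * 2);
        [apply Rmult_le_compat_l; [left; assumption|exact G]|].
      apply Req_le. field. repeat split; try lra.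
  - unfold r.
    rewrite (csum_ext _ (fun i =>
      bern_coef (S (S i)) * (RtoC (fall (S m) (S (S i))) * (/ z) ^ S (S i)) +
      RtoC (fall (S m) (S (S i))) * (/ z) ^ S (S i) * ((/ C2i) ^ S (S i) *
        RtoC ((1 + (-1) ^ S (S i)) * rsum (pole_power (S (S i))) K))))%C.
    + rewrite csum_plus. simpl (bern_coef 0). simpl (bern_coef 1). simpl (fall (S m) 0).
      simpl (/ z ^ 0)%C. 
      replace ((1 + (-1) ^ 1) * rsum (pole_power 1) K) with 0 by ring.
      rewrite RtoC_opp, RtoC_inv by lra. rewrite Cpow_1_r. cbn [Cpow].
      field. repeat split; auto using C2i_neq_0.
    + intros i _. unfold bern_coef. cbn [cot_coef].
      replace ((-1) ^ S (S i)) with ((-1) ^ i) by (simpl; ring).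
      rewrite !RtoC_opp, !RtoC_mult, !RtoC_minus. ring.
Qed.

Lemma scaled_bernoulli_pole_pairs_sym B n z w K :
  is_bernoulli_polynomials B -> (1 <= n)%nat -> z <> RtoC 0 -> (1 <= K)%nat ->
  1 <= PI * INR K * Cmod z -> w = first_pole z \/ w = (- first_pole z)%C ->
  Cmod (scaled_bernoulli B n z - (1 - / (2 * z) - pole_pairs n w K)) <=
  / (INR K * Cmod z ^ 2).
Proof.
  intros HB Hn Hz HK HKz Hw.
  replace (pole_pairs n w K) with (pole_pairs n (first_pole z) K).
  - apply scaled_bernoulli_pole_pairs; assumption.
  - destruct Hw as [-> | ->]; [reflexivity|]. apply csum_ext. intros i _.
    unfold pole_pair. rewrite Cplus_comm. f_equal; f_equal; ring.
Qed.

Lemma exp_pow x k : exp x ^ k = exp (INR k * x).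
Proof.
  induction k as [|k IH]; [simpl; rewrite Rmult_0_l, exp_0; reflexivity|].
  cbn [pow]. rewrite IH, <- exp_plus, S_INR. f_equal. ring.
Qed.

(** The difference equation of the Bernoulli polynomials moves a zero at n z to a
    value at n z + 1 = n (z + 1/n) which is not small. *)
Lemma scaled_bernoulli_shift B n z :
  is_bernoulli_polynomials B -> (1 <= n)%nat -> z <> RtoC 0 ->
  (z + RtoC (/ INR n) <> 0)%C -> B n (RtoC (INR n) * z)%C = RtoC 0 ->
  / Cmod z * exp (- / Cmod z) <= Cmod (scaled_bernoulli B n (z + RtoC (/ INR n))).
Proof.
  intros HB Hn Hz Hz' H0. assert (H := INR_ge_1 n Hn).
  set (N := RtoC (INR n)) in *. assert (HN : N <> RtoC 0) by (apply RtoC_neq_0; lra).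
  set (z' := (z + RtoC (/ INR n))%C) in *.
  assert (Ez : (N * z' = N * z + 1)%C).
  { unfold z'. rewrite RtoC_inv by lra. fold N. field. exact HN. }
  assert (A : 0 < Cmod z) by (apply Cmod_gt_0, Hz).
  assert (A' : 0 < Cmod z') by (apply Cmod_gt_0, Hz').
  assert (V : Cmod (scaled_bernoulli B n z') = / Cmod z * (Cmod z / Cmod z') ^ n).
  { unfold scaled_bernoulli. fold N. rewrite Ez.
    destruct n as [|m]; [lia|].
    assert (D := bernoulli_difference B HB (N * z) m). rewrite H0 in D.
    replace (B (S m) (N * z + 1))%C with (N * (N * z) ^ m)%C.
    - rewrite <- Ez. rewrite Cmod_div by (apply Cpow_nz, Cmult_neq_0; assumption).
      rewrite Cmod_mult, !Cmod_pow, !Cmod_mult. unfold N. rewrite Cmod_R, Rabs_pos_eq by lra.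
      unfold Rdiv. rewrite !Rpow_mult_distr, pow_inv. cbn [pow]. field.
      repeat split; try lra; try (apply pow_nonzero; lra).
    - fold N in D. rewrite <- D. ring. }
  rewrite V. apply Rmult_le_compat_l; [left; apply Rinv_0_lt_compat, A|].
  assert (Q : Cmod z' / Cmod z <= exp (/ Cmod z / INR n)).
  { eapply Rle_trans; [|apply exp_ineq1_le].
    apply Rmult_le_reg_r with (Cmod z); [exact A|].
    replace (Cmod z' / Cmod z * Cmod z) with (Cmod z') by (field; lra).
    replace ((1 + / Cmod z / INR n) * Cmod z) with (Cmod z + / INR n) by (field; lra).
    unfold z'. eapply Rle_trans; [apply Cmod_triangle|]. rewrite Cmod_R, Rabs_pos_eq; [lra|].
    left. apply Rinv_0_lt_compat. lra. }
  assert (Q' : exp (- (/ Cmod z / INR n)) <= Cmod z / Cmod z').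
  { rewrite exp_Ropp. replace (Cmod z / Cmod z') with (/ (Cmod z' / Cmod z)) by (field; lra).
    apply Rinv_le_contravar; [apply Rdiv_lt_0_compat; assumption|exact Q]. }
  replace (exp (- / Cmod z)) with (exp (- (/ Cmod z / INR n)) ^ n).
  - apply pow_incr. split; [left; apply exp_pos|exact Q'].
  - rewrite exp_pow. f_equal. field. lra.
Qed.

(** * Limits of complex sequences *)

Definition Clim (u : nat -> C) (l : C) : Prop := is_lim_seq (fun j => Cmod (u j - l)) 0.

Lemma Clim_squeeze (u : nat -> C) l (v : nat -> R) :
  (exists N, forall j, (N <= j)%nat -> Cmod (u j - l) <= v j) -> is_lim_seq v 0 -> Clim u l.
Proof.
  intros [N H] Hv. unfold Clim.
  apply is_lim_seq_le_le_loc with (fun _ => 0) v; [|apply is_lim_seq_const|exact Hv].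
  exists N. intros j Hj. split; [apply Cmod_ge_0|apply H, Hj].
Qed.

Lemma Clim_const c : Clim (fun _ => c) c.
Proof.
  unfold Clim. eapply is_lim_seq_ext; [|apply is_lim_seq_const].
  intros j. simpl. replace (c - c)%C with (RtoC 0) by ring. symmetry. apply Cmod_0.
Qed.

Lemma Clim_ext u v l : (forall j, u j = v j) -> Clim u l -> Clim v l.
Proof. intros H Hu. unfold Clim. eapply is_lim_seq_ext; [|exact Hu]. intros j. simpl. rewrite H. reflexivity. Qed.

Lemma Clim_plus u v l m : Clim u l -> Clim v m -> Clim (fun j => u j + v j)%C (l + m)%C.
Proof.
  intros Hu Hv. apply Clim_squeeze with (fun j => Cmod (u j - l) + Cmod (v j - m)).
  - exists O. intros j _. replace (u j + v j - (l + m))%C with ((u j - l) + (v j - m))%C by ring.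
    apply Cmod_triangle.
  - rewrite <- (Rplus_0_r 0). apply is_lim_seq_plus'; assumption.
Qed.

Lemma Cmod_diff_le x y : Rabs (Cmod x - Cmod y) <= Cmod (x - y).
Proof.
  assert (A := Cmod_triangle (x - y) y). assert (B := Cmod_triangle (y - x) x).
  replace (x - y + y)%C with x in A by ring. replace (y - x + x)%C with y in B by ring.
  replace (y - x)%C with (- (x - y))%C in B by ring. rewrite Cmod_opp in B.
  apply Rabs_le. lra.
Qed.

Lemma Clim_Cmod u l : Clim u l -> is_lim_seq (fun j => Cmod (u j)) (Cmod l).
Proof.
  intros H. apply is_lim_seq_minus_0. eapply is_lim_seq_0_abs_le; [|exact H].
  intros j. apply Cmod_diff_le.
Qed.

Lemma Clim_Re u l : Clim u l -> is_lim_seq (fun j => Re (u j)) (Re l).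
Proof.
  intros H. apply is_lim_seq_minus_0. eapply is_lim_seq_0_abs_le; [|exact H].
  intros j. apply (Rabs_Re_le (u j - l)).
Qed.

Lemma Clim_mult u v l m : Clim u l -> Clim v m -> Clim (fun j => u j * v j)%C (l * m)%C.
Proof.
  intros Hu Hv.
  apply Clim_squeeze with (fun j => Cmod (u j - l) * Cmod (v j) + Cmod l * Cmod (v j - m)).
  - exists O. intros j _.
    replace (u j * v j - l * m)%C with ((u j - l) * v j + l * (v j - m))%C by ring.
    rewrite <- !Cmod_mult. apply Cmod_triangle.
  - replace 0 with (0 * Cmod m + Cmod l * 0) by ring.
    apply is_lim_seq_plus'; apply is_lim_seq_mult'; auto using Clim_Cmod, is_lim_seq_const.
Qed.

Lemma eventually_lt (u : nat -> R) (l c : R) :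
  is_lim_seq u l -> l < c -> eventually (fun j => u j < c).
Proof.
  intros H Hc. apply is_lim_seq_spec in H.
  destruct (H (mkposreal (c - l) ltac:(lra))) as [N HN]. exists N. intros j Hj.
  specialize (HN j Hj). simpl in HN. apply Rabs_def2 in HN. lra.
Qed.

Lemma eventually_gt (u : nat -> R) (l c : R) :
  is_lim_seq u l -> c < l -> eventually (fun j => c < u j).
Proof.
  intros H Hc. apply is_lim_seq_spec in H.
  destruct (H (mkposreal (l - c) ltac:(lra))) as [N HN]. exists N. intros j Hj.
  specialize (HN j Hj). simpl in HN. apply Rabs_def2 in HN. lra.
Qed.

Lemma Clim_neq u l c : Clim u l -> l <> c -> eventually (fun j => u j <> c).
Proof.
  intros H Hc. assert (P : 0 < Cmod (l - c)).
  { apply Cmod_gt_0. intros E. apply Hc. replace l with (l - c + c)%C by ring.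
    rewrite E. ring. }
  destruct (eventually_lt _ _ _ H P) as [N HN]. exists N. intros j Hj E.
  specialize (HN j Hj). rewrite E in HN.
  replace (c - l)%C with (- (l - c))%C in HN by ring. rewrite Cmod_opp in HN. lra.
Qed.

Lemma Clim_inv u l : Clim u l -> l <> RtoC 0 -> Clim (fun j => / u j)%C (/ l)%C.
Proof.
  intros H Hl. assert (P : 0 < Cmod l) by (apply Cmod_gt_0, Hl).
  apply Clim_squeeze with (fun j => Cmod (u j - l) * (/ Cmod (u j) * / Cmod l)).
  - destruct (Clim_neq _ _ _ H Hl) as [N HN]. exists N. intros j Hj. specialize (HN j Hj).
    replace (/ u j - / l)%C with (- ((u j - l) * (/ u j * / l)))%C by (field; auto).
    rewrite Cmod_opp, !Cmod_mult, !Cmod_inv by assumption. lra.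
  - replace 0 with (0 * (/ Cmod l * / Cmod l)) by ring.
    apply is_lim_seq_mult'; [exact H|]. apply is_lim_seq_mult'; [|apply is_lim_seq_const].
    apply (is_lim_seq_inv _ (Cmod l)); [apply Clim_Cmod, H|].
    intros E. injection E. lra.
Qed.

Lemma Clim_scal c u l : Clim u l -> Clim (fun j => c * u j)%C (c * l)%C.
Proof. intros H. apply (Clim_mult (fun _ => c)); [apply Clim_const|exact H]. Qed.

Lemma Clim_opp u l : Clim u l -> Clim (fun j => - u j)%C (- l)%C.
Proof.
  intros H. replace (- l)%C with (- (1) * l)%C by ring.
  eapply Clim_ext; [|apply (Clim_scal (- (1)) _ _ H)]. intros j. simpl. ring.
Qed.

Lemma Clim_csum (u : nat -> nat -> C) (l : nat -> C) K :
  (forall i, (i < K)%nat -> Clim (fun j => u j i) (l i)) ->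
  Clim (fun j => csum (u j) K) (csum l K).
Proof.
  induction K as [|K IH]; intros H; simpl; [apply Clim_const|].
  apply Clim_plus; auto with arith.
Qed.

(** * Growth rates *)

(** The n-th root of |exp (n w) / w^n|.  The number e is its value at the saddle
    point 1. *)
Definition rate (w : C) : R := exp (Re w) / Cmod w.

Lemma rate_pos w : w <> RtoC 0 -> 0 < rate w.
Proof. intros H. apply Rdiv_lt_0_compat; [apply exp_pos|apply Cmod_gt_0, H]. Qed.

Lemma is_lim_rate u l : Clim u l -> l <> RtoC 0 -> is_lim_seq (fun j => rate (u j)) (rate l).
Proof.
  intros H Hl. apply is_lim_seq_div'.
  - apply (is_lim_seq_continuous exp); [apply derivable_continuous_pt, derivable_pt_exp|].
    apply Clim_Re, H.
  - apply Clim_Cmod, H.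
  - apply Rgt_not_eq, Cmod_gt_0, Hl.
Qed.

(** Since m Re w <= m |w| <= 1, this reduces to exp ((m - 1) / m) < m. *)
Lemma rate_multiple w m : 0 < Re w -> (2 <= m)%nat -> INR m * Cmod w <= 1 ->
  rate (RtoC (INR m) * w) < rate w.
Proof.
  intros Hw Hm Hd.
  assert (M : 2 <= INR m) by (apply (le_INR 2); exact Hm).
  assert (Hx : Re w <= Cmod w) by (eapply Rle_trans; [apply Rle_abs|apply Rabs_Re_le]).
  unfold rate. rewrite Cmod_mult, Cmod_R, Rabs_pos_eq by lra.
  replace (Re (RtoC (INR m) * w)) with (Re w + (INR m - 1) * Re w)
    by (unfold Re; simpl; ring).
  rewrite exp_plus.
  assert (E : exp ((INR m - 1) * Re w) < INR m).
  { assert (B : Re w <= / INR m).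
    { apply Rmult_le_reg_l with (INR m); [lra|]. rewrite Rinv_r by lra.
      apply Rle_trans with (INR m * Cmod w); [apply Rmult_le_compat_l; lra|exact Hd]. }
    apply Rle_lt_trans with (exp (1 - / INR m)).
    - apply exp_mono. apply Rle_trans with ((INR m - 1) * / INR m).
      + apply Rmult_le_compat_l; lra.
      + right. field. lra.
    - assert (I0 : / INR m < 1) by (rewrite <- Rinv_1; apply Rinv_lt_contravar; lra).
      assert (I1 := exp_ineq1 (/ INR m - 1) ltac:(lra)).
      replace (1 - / INR m) with (- (/ INR m - 1)) by ring. rewrite exp_Ropp.
      apply Rlt_le_trans with (/ / INR m); [|right; apply Rinv_inv].
      assert (0 < / INR m) by (apply Rinv_0_lt_compat; lra).
      apply Rinv_lt_contravar; [|lra]. apply Rmult_lt_0_compat; [lra|apply exp_pos]. }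
  assert (P := exp_pos (Re w)). assert (0 < Cmod w) by lra.
  apply Rmult_lt_reg_r with (INR m * Cmod w); [nra|].
  replace (exp (Re w) * exp ((INR m - 1) * Re w) / (INR m * Cmod w) * (INR m * Cmod w))
    with (exp (Re w) * exp ((INR m - 1) * Re w)) by (field; lra).
  replace (exp (Re w) / Cmod w * (INR m * Cmod w)) with (exp (Re w) * INR m) by (field; lra).
  apply Rmult_lt_compat_l; assumption.
Qed.

Lemma rate_opposite w m : 0 < Re w -> (1 <= m)%nat ->
  rate (- (RtoC (INR m) * w)) < rate w.
Proof.
  intros Hw Hm. assert (M : 1 <= INR m) by (apply (le_INR 1); exact Hm).
  assert (Hx : Re w <= Cmod w) by (eapply Rle_trans; [apply Rle_abs|apply Rabs_Re_le]).
  unfold rate. rewrite Cmod_opp, Cmod_mult, Cmod_R, Rabs_pos_eq by lra.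
  replace (Re (- (RtoC (INR m) * w))) with (- (INR m * Re w)) by (unfold Re; simpl; ring).
  assert (E : exp (- (INR m * Re w)) < exp (Re w)) by (apply exp_increasing; nra).
  unfold Rdiv. apply Rle_lt_trans with (exp (- (INR m * Re w)) * / Cmod w).
  - apply Rmult_le_compat_l; [left; apply exp_pos|]. apply Rinv_le_contravar; nra.
  - apply Rmult_lt_compat_r; [apply Rinv_0_lt_compat; lra|exact E].
Qed.

Lemma fact_upper n : (1 <= n)%nat ->
  INR (fact n) <= exp 1 * INR n * (INR n * exp (- 1)) ^ n.
Proof.
  intros Hn. induction n as [|n IH]; [lia|].
  destruct (Nat.eq_dec n 0) as [->|Hn0].
  - simpl. right. replace 1 with (exp 1 * exp (- 1)) at 1.
    + ring.
    + rewrite <- exp_plus. replace (1 + -1) with 0 by ring. apply exp_0.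
  - assert (Hn1 : (1 <= n)%nat) by lia. assert (H := INR_ge_1 n Hn1).
    rewrite fact_simpl, mult_INR.
    eapply Rle_trans; [apply Rmult_le_compat_l; [apply pos_INR|apply (IH Hn1)]|].
    rewrite Rmult_comm. replace (exp 1 * INR n * (INR n * exp (- 1)) ^ n * INR (S n))
      with (INR (S n) * exp 1 * (INR n * (INR n * exp (-1)) ^ n)) by ring.
    replace (exp 1 * INR (S n) * (INR (S n) * exp (- 1)) ^ S n)
      with (INR (S n) * exp 1 * (INR (S n) * exp (- 1)) ^ S n) by ring.
    apply Rmult_le_compat_l;
      [apply Rmult_le_pos; [apply pos_INR|left; apply exp_pos]|].
    rewrite !Rpow_mult_distr. cbn [pow].
    replace (INR n * (INR n ^ n * exp (- 1) ^ n)) with (INR n ^ S n * exp (- 1) ^ n)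
      by (cbn [pow]; ring).
    replace (INR (S n) * INR (S n) ^ n * (exp (- 1) * exp (- 1) ^ n))
      with (INR (S n) ^ S n * exp (- 1) * exp (- 1) ^ n) by (cbn [pow]; ring).
    apply Rmult_le_compat_r; [apply pow_le; left; apply exp_pos|].
    (* What is left is (n / (n+1))^(n+1) <= exp (-1), from 1 + x <= exp x. *)
    replace (INR n ^ S n) with (INR (S n) ^ S n * (INR n / INR (S n)) ^ S n).
    2:{ rewrite <- Rpow_mult_distr. f_equal. field. apply not_0_INR. lia. }
    apply Rmult_le_compat_l; [apply pow_le, pos_INR|].
    apply Rle_trans with (exp (- / INR (S n)) ^ S n).
    + apply pow_incr. split.
      * apply Rmult_le_pos; [apply pos_INR|]. left. apply Rinv_0_lt_compat, lt_0_INR. lia.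
      * eapply Rle_trans; [|apply exp_ineq1_le]. right. rewrite S_INR. field. lra.
    + right. rewrite exp_pow. f_equal. field. apply not_0_INR. lia.
Qed.

Lemma fact_lower n : (INR n * exp (- 1)) ^ n <= INR (fact n).
Proof.
  induction n as [|n IH]; [simpl; lra|].
  rewrite fact_simpl, mult_INR.
  apply Rle_trans with (INR (S n) * (INR n * exp (- 1)) ^ n);
    [|apply Rmult_le_compat_l; [apply pos_INR|exact IH]].
  cbn [pow]. rewrite Rmult_assoc. apply Rmult_le_compat_l; [apply pos_INR|].
  rewrite !Rpow_mult_distr.
  replace (exp (- 1) * (INR (S n) ^ n * exp (- 1) ^ n))
    with (INR (S n) ^ n * exp (- 1) * exp (- 1) ^ n) by ring.
  apply Rmult_le_compat_r; [apply pow_le; left; apply exp_pos|].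
  destruct (Nat.eq_dec n 0) as [->|Hn0].
  - simpl. rewrite Rmult_1_l, <- exp_0. apply exp_mono. lra.
  - assert (H : 1 <= INR n) by (apply (le_INR 1); lia).
    (* What is left is ((n+1) / n)^n <= exp 1, from 1 + x <= exp x. *)
    replace (INR (S n) ^ n) with (INR n ^ n * (INR (S n) / INR n) ^ n).
    2:{ rewrite <- Rpow_mult_distr. f_equal. field. lra. }
    rewrite Rmult_assoc. rewrite <- (Rmult_1_r (INR n ^ n)) at 2.
    apply Rmult_le_compat_l; [apply pow_le, pos_INR|].
    apply Rle_trans with (exp (/ INR n) ^ n * exp (- 1)).
    + apply Rmult_le_compat_r; [left; apply exp_pos|]. apply pow_incr. split.
      * apply Rmult_le_pos; [apply pos_INR|]. left. apply Rinv_0_lt_compat. lra.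
      * eapply Rle_trans; [|apply exp_ineq1_le]. right. rewrite S_INR. field. lra.
    + right. rewrite exp_pow, <- exp_plus, <- exp_0. f_equal. field. lra.
Qed.

Lemma Cmod_exp_ratio n w : (1 <= n)%nat -> w <> RtoC 0 ->
  Cmod (exp_ratio n w) = INR (fact n) * (rate w / INR n) ^ n.
Proof.
  intros Hn Hw. assert (H := INR_ge_1 n Hn).
  assert (HN : RtoC (INR n) <> RtoC 0) by (apply RtoC_neq_0; lra).
  assert (Hp : 0 < Cmod w) by (apply Cmod_gt_0, Hw).
  unfold exp_ratio, rate.
  rewrite Cmod_div by (apply Cpow_nz, Cmult_neq_0; assumption).
  rewrite Cmod_mult, Cmod_pow, Cmod_mult, Cmod_Cexp, !Cmod_R, !Rabs_pos_eq by apply pos_INR.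
  replace (Re (RtoC (INR n) * w)) with (INR n * Re w) by (unfold Re; simpl; ring).
  rewrite <- exp_pow. unfold Rdiv. rewrite !Rpow_mult_distr, !pow_inv.
  field. split; apply pow_nonzero; lra.
Qed.

Lemma exp_ratio_upper n w : (1 <= n)%nat -> w <> RtoC 0 ->
  Cmod (exp_ratio n w) <= exp 1 * (INR n * (rate w * exp (- 1)) ^ n).
Proof.
  intros Hn Hw. assert (H := INR_ge_1 n Hn). assert (P := rate_pos w Hw).
  rewrite Cmod_exp_ratio by assumption.
  apply Rle_trans with (exp 1 * INR n * (INR n * exp (- 1)) ^ n * (rate w / INR n) ^ n).
  - apply Rmult_le_compat_r; [|apply fact_upper, Hn].
    apply pow_le, Rlt_le, Rdiv_lt_0_compat; lra.
  - right. rewrite !Rmult_assoc, <- Rpow_mult_distr. do 3 f_equal. field. lra.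
Qed.

Lemma exp_ratio_lower n w : (1 <= n)%nat -> w <> RtoC 0 ->
  (rate w * exp (- 1)) ^ n <= Cmod (exp_ratio n w).
Proof.
  intros Hn Hw. assert (H := INR_ge_1 n Hn). assert (P := rate_pos w Hw).
  rewrite Cmod_exp_ratio by assumption.
  apply Rle_trans with ((INR n * exp (- 1)) ^ n * (rate w / INR n) ^ n).
  - right. rewrite <- Rpow_mult_distr. f_equal. field. lra.
  - apply Rmult_le_compat_r; [|apply fact_lower].
    apply pow_le, Rlt_le, Rdiv_lt_0_compat; lra.
Qed.

Lemma exp_ratio_quotient n v w : (1 <= n)%nat -> v <> RtoC 0 -> w <> RtoC 0 ->
  Cmod (exp_ratio n v) / Cmod (exp_ratio n w) = (rate v / rate w) ^ n.
Proof.
  intros Hn Hv Hw. assert (H := INR_ge_1 n Hn). assert (P := rate_pos w Hw).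
  rewrite !Cmod_exp_ratio by assumption.
  unfold Rdiv. rewrite !Rpow_mult_distr, !pow_inv.
  field. repeat split; try (apply pow_nonzero; lra). apply INR_fact_neq_0.
Qed.

Lemma INR_mult_pow_le s n : 0 < s < 1 -> INR n * s ^ n <= / (/ s - 1).
Proof.
  intros Hs. assert (B := poly n (/ s - 1)).
  assert (I1 : 1 < / s) by (rewrite <- Rinv_1; apply Rinv_lt_contravar; lra).
  specialize (B ltac:(lra)). replace (1 + (/ s - 1)) with (/ s) in B by ring.
  rewrite pow_inv in B. assert (P : 0 < s ^ n) by (apply pow_lt; lra).
  apply Rmult_le_reg_r with (/ s - 1); [lra|]. rewrite Rinv_l by lra.
  apply Rle_trans with (s ^ n * / s ^ n); [|right; apply Rinv_r; lra].
  replace (INR n * s ^ n * (/ s - 1)) with (s ^ n * (INR n * (/ s - 1))) by ring.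
  apply Rmult_le_compat_l; lra.
Qed.

(** With s = sqrt q, n q^n = (n s^n) s^n, and n s^n stays bounded. *)
Lemma is_lim_INR_mult_pow (n : nat -> nat) (x : nat -> R) (l : R) :
  (forall j, (j <= n j)%nat) -> (forall j, 0 <= x j) -> is_lim_seq x l -> 0 <= l < 1 ->
  is_lim_seq (fun j => INR (n j) * x j ^ n j) 0.
Proof.
  intros Hn Hx Lx Hl. set (q := (1 + l) / 2). set (s := sqrt q).
  assert (Hq : 0 < q < 1) by (unfold q; lra).
  assert (Hs0 : 0 < s) by (apply sqrt_lt_R0; lra).
  assert (Hss : s * s = q) by (apply sqrt_sqrt; lra).
  assert (Hs1 : s < 1) by (unfold s; rewrite <- sqrt_1; apply sqrt_lt_1; lra).
  destruct (eventually_lt x l q Lx ltac:(unfold q; lra)) as [N HN].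
  apply is_lim_seq_le_le_loc with (fun _ => 0) (fun j => / (/ s - 1) * s ^ j).
  - exists N. intros j Hj. split; [apply Rmult_le_pos; [apply pos_INR|apply pow_le, Hx]|].
    apply Rle_trans with (INR (n j) * s ^ n j * s ^ n j).
    + rewrite Rmult_assoc, <- Rpow_mult_distr, Hss.
      apply Rmult_le_compat_l; [apply pos_INR|]. apply pow_incr.
      specialize (HN j Hj). specialize (Hx j). lra.
    + apply Rmult_le_compat.
      * apply Rmult_le_pos; [apply pos_INR|apply pow_le; lra].
      * apply pow_le; lra.
      * apply INR_mult_pow_le; lra.
      * replace (n j) with (j + (n j - j))%nat by (specialize (Hn j); lia).
        rewrite pow_add. assert (s ^ (n j - j) <= 1).
        { rewrite <- (pow1 (n j - j)). apply pow_incr. lra. }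
        assert (0 < s ^ j) by (apply pow_lt, Hs0). nra.
  - apply is_lim_seq_const.
  - apply is_lim_pow_0. lra.
Qed.

Lemma is_lim_inv_sqrt (n : nat -> nat) (c : R) :
  (forall j, (j <= n j)%nat) -> (forall j, (1 <= n j)%nat) -> 
  is_lim_seq (fun j => c / sqrt (INR (n j))) 0.
Proof.
  intros Hn Hn1.
  replace (Finite 0) with (Finite (c * 0)) by (f_equal; ring).
  apply (is_lim_seq_scal_l (fun j => / sqrt (INR (n j))) c 0).
  apply (is_lim_seq_inv _ p_infty); [|discriminate].
  apply (filterlim_comp _ _ _ (fun j => INR (n j)) sqrt _ (Rbar_locally p_infty)).
  - apply is_lim_seq_le_p_loc with INR; [|apply is_lim_seq_INR].
    exists O. intros j _. apply le_INR, Hn.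
  - apply filterlim_sqrt_p.
Qed.

(** * The two regimes of the exponential sections *)

(** The limit is the saddle point contribution.  It is the whole limit outside the
    unit disk, where the section contains no exponential part, and inside it when the
    exponential part is of rate less than e, the growth rate of n^n / n!. *)
Lemma exp_section_converges (n : nat -> nat) (w : nat -> C) (l : C) :
  (forall j, (j <= n j)%nat) -> (forall j, (1 <= n j)%nat) ->
  Clim w l -> l <> RtoC 0 -> (1 < Cmod l \/ rate l < exp 1) ->
  Clim (fun j => exp_section (n j) (w j)) (/ (l - 1))%C.
Proof.
  intros Hn Hn1 Hw Hl Hcase.
  assert (Hl1 : l <> RtoC 1).
  { intros E. rewrite E in Hcase. unfold rate in Hcase. rewrite Cmod_1 in Hcase.
    simpl in Hcase. unfold Rdiv in Hcase. rewrite Rinv_1, Rmult_1_r in Hcase. lra. }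
  assert (Hl2 : (l - 1 <> 0)%C).
  { intros E. apply Hl1. replace l with (l - 1 + 1)%C by ring. rewrite E. ring. }
  assert (Hl3 : (1 - l <> 0)%C).
  { intros E. apply Hl2. replace (l - 1)%C with (- (1 - l))%C by ring. rewrite E. ring. }
  assert (Hl4 : (1 - / l <> 0)%C).
  { intros E. apply Hl2. replace (l - 1)%C with (l * (1 - / l))%C by (field; exact Hl).
    rewrite E. ring. }
  assert (L1 : Clim (fun j => / (w j - 1))%C (/ (l - 1))%C).
  { apply Clim_inv; [|exact Hl2]. apply (Clim_plus _ (fun _ => (- (1))%C)); [exact Hw|apply Clim_const]. }
  assert (Lout : is_lim_seq (fun j => 38 / sqrt (INR (n j)) / Cmod (1 - / w j) ^ 2) 0).
  { replace 0 with (0 * / (Cmod (1 - / l) ^ 2)) by ring.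
    apply is_lim_seq_mult'; [apply is_lim_inv_sqrt; assumption|].
    assert (Q : is_lim_seq (fun j => Cmod (1 - / w j)) (Cmod (1 - / l))).
    { apply Clim_Cmod. apply (Clim_plus (fun _ => RtoC 1)); [apply Clim_const|].
      apply Clim_opp, Clim_inv; assumption. }
    apply (is_lim_seq_inv _ (Cmod (1 - / l) ^ 2)).
    - simpl. repeat apply is_lim_seq_mult'; auto using is_lim_seq_const.
    - intros E. injection E as E. apply Cmod_gt_0 in Hl4. nra. }
  assert (Lin : is_lim_seq (fun j => 38 / sqrt (INR (n j)) / Cmod (1 - w j) ^ 2) 0).
  { replace 0 with (0 * / (Cmod (1 - l) ^ 2)) by ring.
    apply is_lim_seq_mult'; [apply is_lim_inv_sqrt; assumption|].
    assert (Q : is_lim_seq (fun j => Cmod (1 - w j)) (Cmod (1 - l))).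
    { apply Clim_Cmod. apply (Clim_plus (fun _ => RtoC 1)); [apply Clim_const|].
      apply Clim_opp; assumption. }
    apply (is_lim_seq_inv _ (Cmod (1 - l) ^ 2)).
    - simpl. repeat apply is_lim_seq_mult'; auto using is_lim_seq_const.
    - intros E. injection E as E. apply Cmod_gt_0 in Hl3. nra. }
  destruct (Clim_neq w l _ Hw Hl) as [N0 H0].
  destruct (Clim_neq w l _ Hw Hl1) as [N1 H1].
  set (extra := fun j => exp 1 * (INR (n j) * (Rabs (rate (w j)) * exp (- 1)) ^ n j)).
  assert (Hpos : forall j x, 0 <= 38 / sqrt (INR (n j)) / Cmod x ^ 2 \/ x = RtoC 0).
  { intros j x. destruct (Ceq_dec x (RtoC 0)) as [->|E]; [right; reflexivity|left].
    apply Cmod_gt_0 in E. assert (0 < sqrt (INR (n j))).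
    { apply sqrt_lt_R0. assert (T := INR_ge_1 _ (Hn1 j)). lra. }
    unfold Rdiv. repeat apply Rmult_le_pos; try lra; left; apply Rinv_0_lt_compat;
      [assumption|]. apply pow_lt, E. }
  assert (Main : exists v, is_lim_seq v 0 /\ exists N, forall j, (N <= j)%nat ->
     Cmod (exp_section (n j) (w j) - / (w j - 1)) <= v j).
  { destruct Hcase as [Hout|Hrate].
    - eexists; split; [exact Lout|].
      destruct (eventually_gt _ _ 1 (Clim_Cmod _ _ Hw) Hout) as [N2 H2].
      exists (N0 + N1 + N2)%nat. intros j Hj.
      apply exp_section_limit_out; auto; [|apply H1; lia].
      specialize (H2 j ltac:(lia)). simpl in H2. lra.
    - exists (fun j => 38 / sqrt (INR (n j)) / Cmod (1 - / w j) ^ 2 +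
                       38 / sqrt (INR (n j)) / Cmod (1 - w j) ^ 2 + extra j). split.
      + replace 0 with (0 + 0 + exp 1 * 0) by ring.
        apply is_lim_seq_plus'; [apply is_lim_seq_plus'; assumption|].
        apply (is_lim_seq_scal_l _ (exp 1) 0).
        apply is_lim_INR_mult_pow with (rate l * exp (- 1)); [exact Hn| | |].
        * intros j. apply Rmult_le_pos; [apply Rabs_pos|left; apply exp_pos].
        * apply is_lim_seq_mult'; [|apply is_lim_seq_const].
          rewrite <- (Rabs_pos_eq (rate l)) by (left; apply rate_pos, Hl).
          apply (is_lim_seq_abs _ (rate l)), is_lim_rate; assumption.
        * assert (R0 := rate_pos l Hl). assert (E1 := exp_pos (- 1)).
          split; [nra|]. apply Rlt_le_trans with (exp 1 * exp (- 1)).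
          -- apply Rmult_lt_compat_r; assumption.
          -- right. rewrite <- exp_plus. replace (1 + -1) with 0 by ring. apply exp_0.
      + exists (N0 + N1)%nat. intros j Hj.
        specialize (H0 j ltac:(lia)). specialize (H1 j ltac:(lia)).
        assert (Ex : Cmod (exp_ratio (n j) (w j)) <= extra j).
        { unfold extra. rewrite Rabs_pos_eq by (left; apply rate_pos, H0).
          apply exp_ratio_upper; auto. }
        assert (Ex0 := Cmod_ge_0 (exp_ratio (n j) (w j))).
        assert (P1 : 0 <= 38 / sqrt (INR (n j)) / Cmod (1 - / w j) ^ 2).
        { destruct (Hpos j (1 - / w j)%C) as [P|P]; [exact P|].
          exfalso. apply H1. replace (w j) with (/ (1 - (1 - / w j)))%C.
          - rewrite P. field.
          - replace (1 - (1 - / w j))%C with (/ w j)%C by ring. field. exact H0. }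
        assert (P2 : 0 <= 38 / sqrt (INR (n j)) / Cmod (1 - w j) ^ 2).
        { destruct (Hpos j (1 - w j)%C) as [P|P]; [exact P|].
          exfalso. apply H1. replace (w j) with (1 - (1 - w j))%C by ring. rewrite P. ring. }
        destruct (Rle_lt_dec 1 (Cmod (w j))) as [D|D].
        * assert (T := exp_section_limit_out (n j) (w j) (Hn1 j) D H1). lra.
        * assert (T := exp_section_limit_in (n j) (w j) (Hn1 j) H0 ltac:(lra) H1).
          replace (exp_section (n j) (w j) - / (w j - 1))%C with
            ((exp_section (n j) (w j) - exp_ratio (n j) (w j) - / (w j - 1)) +
             exp_ratio (n j) (w j))%C by ring.
          eapply Rle_trans; [apply Cmod_triangle|]. lra. }
  destruct Main as [v [Lv [N HN]]].
  apply Clim_squeeze with (fun j => v j + Cmod (/ (w j - 1) - / (l - 1))).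
  - exists N. intros j Hj. specialize (HN j Hj).
    replace (exp_section (n j) (w j) - / (l - 1))%C with
      ((exp_section (n j) (w j) - / (w j - 1)) + (/ (w j - 1) - / (l - 1)))%C by ring.
    eapply Rle_trans; [apply Cmod_triangle|]. lra.
  - rewrite <- (Rplus_0_r 0). apply is_lim_seq_plus'; assumption.
Qed.

Lemma slow_bound_over_ratio (n : nat -> nat) (w : nat -> C) (l : C) :
  (forall j, (j <= n j)%nat) -> (forall j, (1 <= n j)%nat) ->
  Clim w l -> l <> RtoC 0 -> exp 1 < rate l ->
  is_lim_seq (fun j => slow_bound (INR (n j)) / Cmod (exp_ratio (n j) (w j))) 0.
Proof.
  intros Hn Hn1 Hw Hl Hr. assert (E1 := exp_pos 1).
  destruct (Clim_neq w l _ Hw Hl) as [N HN].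
  apply is_lim_seq_le_le_loc with (fun _ => 0)
    (fun j => 4 * (INR (n j) * (exp 1 * / Rabs (rate (w j))) ^ n j)).
  - exists N. intros j Hj. specialize (HN j Hj).
    assert (P := rate_pos _ HN). assert (H := INR_ge_1 _ (Hn1 j)).
    assert (Q : 0 < rate (w j) * exp (- 1)) by (apply Rmult_lt_0_compat; [exact P|apply exp_pos]).
    assert (L := exp_ratio_lower (n j) (w j) (Hn1 j) HN).
    assert (Lp : 0 < (rate (w j) * exp (- 1)) ^ n j) by (apply pow_lt, Q).
    assert (S0 : 0 <= slow_bound (INR (n j)) <= 4 * INR (n j)).
    { unfold slow_bound. assert (sqrt (INR (n j)) <= INR (n j)).
      { rewrite <- (sqrt_square (INR (n j))) at 2 by lra. apply sqrt_le_1; nra. }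
      assert (T := sqrt_pos (INR (n j))). lra. }
    split; [apply Rmult_le_pos; [lra|left; apply Rinv_0_lt_compat; lra]|].
    rewrite Rabs_pos_eq by lra. unfold Rdiv. rewrite <- Rmult_assoc.
    replace ((exp 1 * / rate (w j)) ^ n j) with (/ (rate (w j) * exp (- 1)) ^ n j).
    + apply Rmult_le_compat; [lra|left; apply Rinv_0_lt_compat; lra|lra|].
      apply Rinv_le_contravar; lra.
    + rewrite <- pow_inv. f_equal. replace (-1) with (- (1)) by ring.
      rewrite exp_Ropp. field. lra.
  - apply is_lim_seq_const.
  - replace (Finite 0) with (Finite (4 * 0)) by (f_equal; ring).
    apply (is_lim_seq_scal_l _ 4 0).
    apply is_lim_INR_mult_pow with (exp 1 * / rate l); [exact Hn| | |].
    + intros j. apply Rmult_le_pos; [lra|].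
      destruct (Req_dec (Rabs (rate (w j))) 0) as [-> | E]; [rewrite Rinv_0; lra|].
      left. apply Rinv_0_lt_compat. assert (T := Rabs_pos (rate (w j))). lra.
    + apply is_lim_seq_mult'; [apply is_lim_seq_const|].
      apply (is_lim_seq_inv _ (rate l)); [|intros E; injection E; lra].
      rewrite <- (Rabs_pos_eq (rate l)) by lra.
      apply (is_lim_seq_abs _ (rate l)), is_lim_rate; assumption.
    + split; [apply Rmult_le_pos; [lra|left; apply Rinv_0_lt_compat; lra]|].
      apply Rmult_lt_reg_r with (rate l); [lra|]. rewrite Rmult_assoc, Rinv_l; lra.
Qed.

(** Outside the unit disk the section at v has no exponential part; inside, that part
    is of smaller rate by hypothesis.  What remains is of order sqrt n, against an
    exponentially large denominator. *)
Lemma exp_section_negligible (n : nat -> nat) (v w : nat -> C) (lv lw : C) :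
  (forall j, (j <= n j)%nat) -> (forall j, (1 <= n j)%nat) ->
  Clim v lv -> Clim w lw -> lv <> RtoC 0 -> lw <> RtoC 0 -> exp 1 < rate lw ->
  (1 < Cmod lv \/ rate lv < rate lw) ->
  is_lim_seq (fun j => Cmod (exp_section (n j) (v j)) / Cmod (exp_ratio (n j) (w j))) 0.
Proof.
  intros Hn Hn1 Hv Hw Hlv Hlw Hr Hcase.
  assert (E1 := exp_pos 1). assert (Rv := rate_pos lv Hlv).
  destruct (Clim_neq v lv _ Hv Hlv) as [N HN].
  destruct (Clim_neq w lw _ Hw Hlw) as [N' HN'].
  assert (SB := slow_bound_over_ratio n w lw Hn Hn1 Hw Hlw Hr).
  assert (Epos : forall j, (N' <= j)%nat -> 0 < Cmod (exp_ratio (n j) (w j))).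
  { intros j Hj. eapply Rlt_le_trans; [|apply exp_ratio_lower; auto].
    apply pow_lt, Rmult_lt_0_compat; [apply rate_pos; auto|apply exp_pos]. }
  destruct Hcase as [Hout|Hin].
  - destruct (eventually_gt _ _ 1 (Clim_Cmod _ _ Hv) Hout) as [N2 H2].
    apply is_lim_seq_le_le_loc with (fun _ => 0)
      (fun j => slow_bound (INR (n j)) / Cmod (exp_ratio (n j) (w j)));
      [|apply is_lim_seq_const|exact SB].
    exists (N' + N2)%nat. intros j Hj. specialize (Epos j ltac:(lia)).
    specialize (H2 j ltac:(lia)). simpl in H2.
    assert (Ei : 0 < / Cmod (exp_ratio (n j) (w j))) by (apply Rinv_0_lt_compat, Epos).
    split; [apply Rmult_le_pos; [apply Cmod_ge_0|lra]|].
    apply Rmult_le_compat_r; [lra|]. apply exp_section_bound_out; [apply Hn1|lra].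
  - apply is_lim_seq_le_le_loc with (fun _ => 0)
      (fun j => slow_bound (INR (n j)) / Cmod (exp_ratio (n j) (w j)) +
                INR (n j) * (Rabs (rate (v j)) * / Rabs (rate (w j))) ^ n j).
    + exists (N + N')%nat. intros j Hj. specialize (Epos j ltac:(lia)).
      specialize (HN j ltac:(lia)). specialize (HN' j ltac:(lia)).
      assert (Ei : 0 < / Cmod (exp_ratio (n j) (w j))) by (apply Rinv_0_lt_compat, Epos).
      split; [apply Rmult_le_pos; [apply Cmod_ge_0|lra]|].
      assert (P := rate_pos _ HN). assert (P' := rate_pos _ HN').
      rewrite !Rabs_pos_eq by lra.
      assert (Q : Cmod (exp_ratio (n j) (v j)) / Cmod (exp_ratio (n j) (w j)) <=
                  INR (n j) * (rate (v j) * / rate (w j)) ^ n j).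
      { rewrite exp_ratio_quotient by auto. unfold Rdiv.
        rewrite <- (Rmult_1_l ((rate (v j) * / rate (w j)) ^ n j)) at 1.
        apply Rmult_le_compat_r; [|apply INR_ge_1, Hn1].
        apply pow_le, Rlt_le, Rdiv_lt_0_compat; lra. }
      eapply Rle_trans; [|apply Rplus_le_compat_l, Q].
      unfold Rdiv. rewrite <- Rmult_plus_distr_r. apply Rmult_le_compat_r; [lra|].
      assert (R0 := Cmod_ge_0 (exp_ratio (n j) (v j))).
      destruct (Rle_lt_dec 1 (Cmod (v j))) as [D|D].
      * assert (T := exp_section_bound_out (n j) (v j) (Hn1 j) D). lra.
      * assert (T := exp_section_bound_in (n j) (v j) (Hn1 j) HN ltac:(lra)).
        replace (exp_section (n j) (v j)) with
          ((exp_section (n j) (v j) - exp_ratio (n j) (v j)) + exp_ratio (n j) (v j))%C by ring.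
        eapply Rle_trans; [apply Cmod_triangle|]. lra.
    + apply is_lim_seq_const.
    + rewrite <- (Rplus_0_r 0). apply is_lim_seq_plus'; [exact SB|].
      apply is_lim_INR_mult_pow with (rate lv * / rate lw); [exact Hn| | |].
      * intros j. apply Rmult_le_pos; [apply Rabs_pos|].
        destruct (Req_dec (Rabs (rate (w j))) 0) as [-> | E]; [rewrite Rinv_0; lra|].
        left. apply Rinv_0_lt_compat. assert (T := Rabs_pos (rate (w j))). lra.
      * apply is_lim_seq_mult'.
        -- rewrite <- (Rabs_pos_eq (rate lv)) by lra.
           apply (is_lim_seq_abs _ (rate lv)), is_lim_rate; assumption.
        -- apply (is_lim_seq_inv _ (rate lw)); [|intros E; injection E; lra].
           rewrite <- (Rabs_pos_eq (rate lw)) by lra.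
           apply (is_lim_seq_abs _ (rate lw)), is_lim_rate; assumption.
      * split; [apply Rmult_le_pos; [lra|left; apply Rinv_0_lt_compat; lra]|].
        apply Rmult_lt_reg_r with (rate lw); [lra|]. rewrite Rmult_assoc, Rinv_l; lra.
Qed.

(** * Zeros force the balance of saddle and pole *)

(** Either pole nearest to 0 may dominate, according to the sign of Im z; the sums
    over pole pairs do not distinguish them. *)
Definition is_first_pole (c : C) : Prop :=
  c = (C2i * RtoC PI)%C \/ c = (- (C2i * RtoC PI))%C.

Lemma is_first_pole_mult c z : is_first_pole c ->
  (c * z)%C = first_pole z \/ (c * z)%C = (- first_pole z)%C.
Proof. intros [-> | ->]; [left|right]; unfold first_pole; ring. Qed.

Lemma Cmod_first_pole c : is_first_pole c -> Cmod c = 2 * PI.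
Proof.
  assert (T := pi_gt_3).
  intros [-> | ->]; rewrite ?Cmod_opp, Cmod_mult, Cmod_C2i, Cmod_R, Rabs_pos_eq; lra.
Qed.

Lemma first_pole_neq_0 c : is_first_pole c -> c <> RtoC 0.
Proof.
  intros H. apply Cmod_gt_0. rewrite (Cmod_first_pole c H). assert (T := pi_gt_3). lra.
Qed.

Lemma is_lim_remainder (z : nat -> C) l K : Clim z l -> l <> RtoC 0 -> (1 <= K)%nat ->
  is_lim_seq (fun j => / (INR K * Cmod (z j) ^ 2)) (/ (INR K * Cmod l ^ 2)).
Proof.
  intros H Hl HK. assert (HK1 := INR_ge_1 K HK).
  assert (P : 0 < Cmod l) by (apply Cmod_gt_0, Hl).
  assert (L := Clim_Cmod _ _ H).
  apply (is_lim_seq_inv _ (INR K * Cmod l ^ 2)).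
  - simpl. repeat apply is_lim_seq_mult'; auto using is_lim_seq_const.
  - assert (0 < Cmod l ^ 2) by (apply pow_lt, P). intros E. injection E. nra.
Qed.

Lemma exists_truncation a : 0 < a -> exists K, (1 <= K)%nat /\ 1 < PI * INR K * a.
Proof.
  intros Ha. assert (T := pi_gt_3).
  destruct (INR_unbounded (Rmax 1 (/ a))) as [K HK].
  assert (H1 := Rmax_l 1 (/ a)). assert (H2 := Rmax_r 1 (/ a)).
  exists K. split; [apply INR_le; simpl; lra|].
  assert (1 < INR K * a).
  { replace 1 with (/ a * a) by (field; lra). apply Rmult_lt_compat_r; lra. }
  rewrite Rmult_assoc. nra.
Qed.

Lemma eventually_truncation (z : nat -> C) l K : Clim z l -> 1 < PI * INR K * Cmod l ->
  eventually (fun j => 1 <= PI * INR K * Cmod (z j)).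
Proof.
  intros H HK.
  destruct (eventually_gt (fun j => PI * INR K * Cmod (z j)) (PI * INR K * Cmod l) 1) as [N HN].
  - apply (is_lim_seq_scal_l _ (PI * INR K) (Cmod l)), Clim_Cmod, H.
  - exact HK.
  - exists N. intros j Hj. left. apply HN, Hj.
Qed.

Lemma Clim_pole_pairs (n : nat -> nat) (z : nat -> C) (l c : C) K :
  (forall j, (j <= n j)%nat) -> (forall j, (1 <= n j)%nat) ->
  Clim z l -> c <> RtoC 0 -> l <> RtoC 0 ->
  (forall m, (1 <= m)%nat ->
    (1 < Cmod (RtoC (INR m) * (c * l)) \/ rate (RtoC (INR m) * (c * l)) < exp 1) /\
    (1 < Cmod (- (RtoC (INR m) * (c * l))) \/ rate (- (RtoC (INR m) * (c * l))) < exp 1)) ->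
  Clim (fun j => pole_pairs (n j) (c * z j) K)
    (csum (fun i => / (RtoC (INR (S i)) * (c * l) - 1) +
                    / (- (RtoC (INR (S i)) * (c * l)) - 1)) K)%C.
Proof.
  intros Hn Hn1 Hz Hc Hl Hg. unfold pole_pairs.
  apply (Clim_csum (fun j i => pole_pair (n j) (RtoC (INR (S i)) * (c * z j)))).
  intros i _. destruct (Hg (S i) ltac:(lia)) as [G1 G2].
  assert (Hi : RtoC (INR (S i)) <> RtoC 0) by (apply RtoC_neq_0, not_0_INR; lia).
  assert (V : (RtoC (INR (S i)) * (c * l) <> 0)%C) by (repeat apply Cmult_neq_0; assumption).
  assert (Lw : Clim (fun j => RtoC (INR (S i)) * (c * z j))%C (RtoC (INR (S i)) * (c * l))%C)
    by (apply Clim_scal, Clim_scal, Hz).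
  unfold pole_pair. apply Clim_plus.
  - apply (exp_section_converges n (fun j => RtoC (INR (S i)) * (c * z j))%C); assumption.
  - apply (exp_section_converges n (fun j => - (RtoC (INR (S i)) * (c * z j)))%C); auto.
    + apply Clim_opp, Lw.
    + intros E. apply V. replace (RtoC (INR (S i)) * (c * l))%C
        with (- - (RtoC (INR (S i)) * (c * l)))%C by ring. rewrite E. ring.
Qed.

(** When the saddle dominates, the rescaled polynomials at n z and at n z + 1 have
    the same limit, whereas the difference equation keeps them apart at a zero. *)
Lemma no_zeros_when_saddle_dominates B (n : nat -> nat) (z : nat -> C) (l c : C) :
  is_bernoulli_polynomials B ->
  (forall j, (j <= n j)%nat) -> (forall j, (1 <= n j)%nat) ->
  (forall j, B (n j) (RtoC (INR (n j)) * z j)%C = RtoC 0) ->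
  Clim z l -> l <> RtoC 0 -> is_first_pole c ->
  (forall m, (1 <= m)%nat ->
    (1 < Cmod (RtoC (INR m) * (c * l)) \/ rate (RtoC (INR m) * (c * l)) < exp 1) /\
    (1 < Cmod (- (RtoC (INR m) * (c * l))) \/ rate (- (RtoC (INR m) * (c * l))) < exp 1)) ->
  False.
Proof.
  intros HB Hn Hn1 H0 Hz Hl Hc Hg.
  set (z' := fun j => (z j + RtoC (/ INR (n j)))%C).
  assert (Hz' : Clim z' l).
  { replace l with (l + 0)%C by ring. apply Clim_plus; [exact Hz|].
    apply Clim_squeeze with (fun j => / INR j).
    - exists 1%nat. intros j Hj. assert (H := INR_ge_1 _ (Hn1 j)).
      replace (RtoC (/ INR (n j)) - 0)%C with (RtoC (/ INR (n j))) by ring.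
      rewrite Cmod_R, Rabs_pos_eq by (left; apply Rinv_0_lt_compat; lra).
      apply Rinv_le_contravar; [apply lt_0_INR; lia|apply le_INR, Hn].
    - apply (is_lim_seq_inv _ p_infty); [apply is_lim_seq_INR|discriminate]. }
  assert (P : 0 < Cmod l) by (apply Cmod_gt_0, Hl).
  set (L0 := / Cmod l * exp (- / Cmod l)).
  assert (HL0 : 0 < L0).
  { apply Rmult_lt_0_compat; [apply Rinv_0_lt_compat, P|apply exp_pos]. }
  assert (LX : is_lim_seq (fun j => / Cmod (z j) * exp (- / Cmod (z j))) L0).
  { assert (LI : is_lim_seq (fun j => / Cmod (z j)) (/ Cmod l)).
    { apply (is_lim_seq_inv _ (Cmod l)); [apply Clim_Cmod, Hz|]. intros E; injection E; lra. }
    apply is_lim_seq_mult'; [exact LI|].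
    apply (is_lim_seq_continuous exp);
      [apply derivable_continuous_pt, derivable_pt_exp|].
    apply (is_lim_seq_opp _ (/ Cmod l)), LI. }
  destruct (Clim_neq _ _ _ Hz Hl) as [N1 HN1]. destruct (Clim_neq _ _ _ Hz' Hl) as [N2 HN2].
  assert (Hc0 := first_pole_neq_0 c Hc).
  destruct (exists_truncation (Cmod l) P) as [K0 [HK0 HK0']].
  (* The right-hand side tends to 0 as K grows, which contradicts HL0. *)
  assert (Bound : forall K, (1 <= K)%nat -> 1 < PI * INR K * Cmod l ->
            L0 <= 2 * / (INR K * Cmod l ^ 2)).
  { intros K HK HKl.
    destruct (eventually_truncation z l K Hz HKl) as [N3 HN3].
    destruct (eventually_truncation z' l K Hz' HKl) as [N4 HN4].
    set (A := fun y j => (1 - / (2 * y j) - pole_pairs (n j) (c * y j) K)%C).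
    set (LA := (1 - / (2 * l) - csum (fun i => / (RtoC (INR (S i)) * (c * l) - 1) +
                    / (- (RtoC (INR (S i)) * (c * l)) - 1)) K)%C).
    assert (LimA : forall y, Clim y l -> Clim (A y) LA).
    { intros y Hy. unfold A, LA, Cminus.
      apply Clim_plus; [apply Clim_plus; [apply Clim_const|]|]; apply Clim_opp.
      - apply Clim_inv; [apply Clim_scal, Hy|]. apply Cmult_neq_0; [|exact Hl].
        apply RtoC_neq_0. lra.
      - apply Clim_pole_pairs; assumption. }
    apply (is_lim_seq_le_loc (fun j => / Cmod (z j) * exp (- / Cmod (z j)))
      (fun j => / (INR K * Cmod (z' j) ^ 2) + (Cmod (A z' j - LA) + Cmod (A z j - LA)) +
                / (INR K * Cmod (z j) ^ 2)) L0 (2 * / (INR K * Cmod l ^ 2))).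
    - exists (N1 + N2 + N3 + N4)%nat. intros j Hj.
      specialize (HN1 j ltac:(lia)). specialize (HN2 j ltac:(lia)).
      specialize (HN3 j ltac:(lia)). specialize (HN4 j ltac:(lia)).
      eapply Rle_trans; [apply (scaled_bernoulli_shift B (n j) (z j)); auto|].
      fold (z' j).
      assert (T' := scaled_bernoulli_pole_pairs_sym B (n j) (z' j) (c * z' j) K HB (Hn1 j)
                     HN2 HK HN4 (is_first_pole_mult c _ Hc)).
      assert (T := scaled_bernoulli_pole_pairs_sym B (n j) (z j) (c * z j) K HB (Hn1 j)
                     HN1 HK HN3 (is_first_pole_mult c _ Hc)).
      assert (E0 : scaled_bernoulli B (n j) (z j) = RtoC 0).
      { unfold scaled_bernoulli. rewrite H0. unfold Cdiv. ring. }
      rewrite E0 in T. fold (A z' j) in T'. fold (A z j) in T.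
      replace (scaled_bernoulli B (n j) (z' j)) with
        ((scaled_bernoulli B (n j) (z' j) - A z' j) + ((A z' j - LA) + - (A z j - LA)) +
          - (0 - A z j))%C by ring.
      eapply Rle_trans; [apply Cmod_triangle|]. rewrite Cmod_opp. apply Rplus_le_compat; [|exact T].
      eapply Rle_trans; [apply Cmod_triangle|]. apply Rplus_le_compat; [exact T'|].
      eapply Rle_trans; [apply Cmod_triangle|]. rewrite Cmod_opp. lra.
    - exact LX.
    - replace (2 * / (INR K * Cmod l ^ 2)) with
        (/ (INR K * Cmod l ^ 2) + (0 + 0) + / (INR K * Cmod l ^ 2)) by ring.
      apply is_lim_seq_plus'; [apply is_lim_seq_plus'; [|apply is_lim_seq_plus']|];
        try (apply is_lim_remainder; assumption); apply LimA; assumption. }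
  apply (Rlt_not_le _ _ HL0). apply le_of_inv_INR with (2 * / Cmod l ^ 2).
  intros K HK. rewrite Rplus_0_r.
  assert (HK1 := INR_ge_1 K HK). assert (HK01 := INR_ge_1 K0 HK0).
  assert (Pl : 0 < Cmod l ^ 2) by (apply pow_lt, P).
  assert (I1 : INR K <= INR (K * K0)) by (rewrite mult_INR; nra).
  assert (I2 : INR K0 <= INR (K * K0)) by (rewrite mult_INR; nra).
  eapply Rle_trans; [apply (Bound (K * K0)%nat)|].
  - nia.
  - assert (T := pi_gt_3). assert (PI * INR K0 * Cmod l <= PI * INR (K * K0) * Cmod l).
    { apply Rmult_le_compat_r; [lra|]. apply Rmult_le_compat_l; lra. }
    lra.
  - unfold Rdiv. rewrite Rmult_assoc. apply Rmult_le_compat_l; [lra|].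
    rewrite <- Rinv_mult. apply Rinv_le_contravar; [nra|].
    rewrite (Rmult_comm (Cmod l ^ 2)). apply Rmult_le_compat_r; lra.
Qed.

Lemma is_lim_rsum_0 (f : nat -> nat -> R) K :
  (forall i, (i < K)%nat -> is_lim_seq (fun j => f j i) 0) ->
  is_lim_seq (fun j => rsum (f j) K) 0.
Proof.
  induction K as [|K IH]; intros H; simpl; [apply is_lim_seq_const|].
  rewrite <- (Rplus_0_r 0). apply is_lim_seq_plus'; auto with arith.
Qed.

(** When the first pole dominates strictly, its exponential outgrows every other
    contribution, so it cannot be cancelled. *)
Lemma no_zeros_when_pole_dominates B (n : nat -> nat) (z : nat -> C) (l c : C) :
  is_bernoulli_polynomials B ->
  (forall j, (j <= n j)%nat) -> (forall j, (1 <= n j)%nat) ->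
  (forall j, B (n j) (RtoC (INR (n j)) * z j)%C = RtoC 0) ->
  Clim z l -> l <> RtoC 0 -> is_first_pole c ->
  0 < Re (c * l) -> Cmod (c * l) <= 1 -> exp 1 < rate (c * l) ->
  False.
Proof.
  intros HB Hn Hn1 H0 Hz Hl Hc Hre Hmod Hrate.
  assert (Hc0 := first_pole_neq_0 c Hc).
  assert (P : 0 < Cmod l) by (apply Cmod_gt_0, Hl).
  assert (Hcl : (c * l <> 0)%C) by (apply Cmult_neq_0; assumption).
  assert (Hw : Clim (fun j => c * z j)%C (c * l)%C) by (apply Clim_scal, Hz).
  destruct (exists_truncation (Cmod l) P) as [K [HK HKl]].
  destruct K as [|Q]; [lia|].
  set (w := fun j => (c * z j)%C) in *.
  set (E := fun j => Cmod (exp_ratio (n j) (w j))).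
  assert (Hmod1 : Cmod (c * l) < 1).
  { destruct Hmod as [Hm|Hm]; [exact Hm|]. exfalso.
    unfold rate in Hrate. rewrite Hm in Hrate. unfold Rdiv in Hrate.
    rewrite Rinv_1, Rmult_1_r in Hrate.
    assert (Re (c * l) <= 1).
    { rewrite <- Hm. eapply Rle_trans; [apply Rle_abs|apply Rabs_Re_le]. }
    assert (T := exp_mono _ _ H). lra. }
  destruct (Clim_neq _ _ _ Hz Hl) as [N1 HN1].
  destruct (Clim_neq _ _ _ Hw Hcl) as [N2 HN2].
  destruct (eventually_truncation z l _ Hz HKl) as [N3 HN3].
  destruct (eventually_lt _ _ 1 (Clim_Cmod _ _ Hw) Hmod1) as [N4 HN4].
  set (v := fun i j => (RtoC (INR (S (S i))) * w j)%C).
  set (sec := fun u j => Cmod (exp_section (n j) (u j)) / E j).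
  set (cst := fun j => 2 + Cmod (/ (2 * z j)) + / (INR (S Q) * Cmod (z j) ^ 2)).
  assert (Lopp : forall m, (1 <= m)%nat ->
     is_lim_seq (sec (fun j => - (RtoC (INR m) * w j))%C) 0).
  { intros m Hm. assert (M : RtoC (INR m) <> RtoC 0) by (apply RtoC_neq_0, not_0_INR; lia).
    apply (exp_section_negligible n _ w (- (RtoC (INR m) * (c * l)))%C (c * l)%C); auto.
    - apply Clim_opp, Clim_scal, Hw.
    - intros X. apply (Cmult_neq_0 _ _ M Hcl).
      replace (RtoC (INR m) * (c * l))%C with (- - (RtoC (INR m) * (c * l)))%C by ring.
      rewrite X. ring.
    - right. apply rate_opposite; assumption. }
  assert (Lv : forall i, is_lim_seq (sec (v i)) 0).
  { intros i. assert (M : RtoC (INR (S (S i))) <> RtoC 0) by (apply RtoC_neq_0, not_0_INR; lia).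
    apply (exp_section_negligible n _ w (RtoC (INR (S (S i))) * (c * l))%C (c * l)%C); auto.
    - apply Clim_scal, Hw.
    - apply Cmult_neq_0; assumption.
    - rewrite Cmod_mult, Cmod_R, Rabs_pos_eq by apply pos_INR.
      destruct (Rle_lt_dec (INR (S (S i)) * Cmod (c * l)) 1) as [D|D]; [right|left; exact D].
      apply rate_multiple; [exact Hre|lia|exact D]. }
  assert (Lc : is_lim_seq cst (2 + Cmod (/ (2 * l)) + / (INR (S Q) * Cmod l ^ 2))).
  { apply is_lim_seq_plus'; [apply is_lim_seq_plus'; [apply is_lim_seq_const|]|].
    - apply Clim_Cmod, Clim_inv; [apply Clim_scal, Hz|].
      apply Cmult_neq_0; [apply RtoC_neq_0; lra|exact Hl].
    - apply is_lim_remainder; assumption. }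
  (* The hypothetical zero, divided by the exponential of the first pole. *)
  assert (Contra : 1 <= 0); [|lra].
  apply (is_lim_seq_le_loc (fun _ => 1)
    (fun j => slow_bound (INR (n j)) / E j * cst j +
       sec (fun j => - (RtoC (INR 1) * w j))%C j +
       rsum (fun i => sec (v i) j + sec (fun j => - v i j)%C j) Q) 1 0).
  - exists (N1 + N2 + N3 + N4)%nat. intros j Hj.
    specialize (HN1 j ltac:(lia)). specialize (HN2 j ltac:(lia)).
    specialize (HN3 j ltac:(lia)). specialize (HN4 j ltac:(lia)). simpl in HN4.
    assert (Ep : 0 < E j).
    { eapply Rlt_le_trans; [|apply exp_ratio_lower; auto].
      apply pow_lt, Rmult_lt_0_compat; [apply rate_pos; auto|apply exp_pos]. }
    assert (T := scaled_bernoulli_pole_pairs_sym B (n j) (z j) (w j) (S Q) HB (Hn1 j)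
                   HN1 HK HN3 (is_first_pole_mult c _ Hc)).
    replace (scaled_bernoulli B (n j) (z j)) with (RtoC 0) in T
      by (unfold scaled_bernoulli; rewrite H0; unfold Cdiv; ring).
    assert (Tin := exp_section_bound_in (n j) (w j) (Hn1 j) HN2 ltac:(lra)).
    unfold pole_pairs in T. rewrite csum_head in T.
    unfold pole_pair at 1 in T. rewrite Cmult_1_l in T.
    set (s1 := exp_section (n j) (w j)) in *. set (s2 := exp_section (n j) (- w j)) in *.
    set (rest := csum (fun i => pole_pair (n j) (RtoC (INR (S (S i))) * w j)) Q) in *.
    assert (Rest : Cmod rest <=
       rsum (fun i => Cmod (exp_section (n j) (v i j)) + Cmod (exp_section (n j) (- v i j))) Q).
    { eapply Rle_trans; [apply Cmod_csum|]. apply rsum_le. intros i _.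
      unfold pole_pair. apply Cmod_triangle. }
    assert (Main : E j <= slow_bound (INR (n j)) * cst j + Cmod s2 +
       rsum (fun i => Cmod (exp_section (n j) (v i j)) + Cmod (exp_section (n j) (- v i j))) Q).
    { unfold E. replace (exp_ratio (n j) (w j)) with
        (- (s1 - exp_ratio (n j) (w j)) + ((0 - (1 - / (2 * z j) - (s1 + s2 + rest))) +
         (1 + - / (2 * z j))) + - s2 + - rest)%C by ring.
      eapply Rle_trans; [apply Cmod_triangle|]. rewrite Cmod_opp.
      apply Rplus_le_compat; [|exact Rest].
      eapply Rle_trans; [apply Cmod_triangle|]. rewrite Cmod_opp. apply Rplus_le_compat_r.
      eapply Rle_trans; [apply Cmod_triangle|]. rewrite Cmod_opp.
      assert (G : Cmod (0 - (1 - / (2 * z j) - (s1 + s2 + rest)) + (1 + - / (2 * z j))) <=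
                  cst j - 1).
      { eapply Rle_trans; [apply Cmod_triangle|].
        assert (G1 := Cmod_triangle 1 (- / (2 * z j))).
        rewrite Cmod_1, Cmod_opp in G1. unfold cst. lra. }
      assert (S1 : 1 <= slow_bound (INR (n j))).
      { unfold slow_bound. assert (T' := sqrt_pos (INR (n j))). lra. }
      assert (C1 : 1 <= cst j).
      { unfold cst. assert (C0 := Cmod_ge_0 (/ (2 * z j))).
        assert (0 < / (INR (S Q) * Cmod (z j) ^ 2)); [|lra].
        apply Rinv_0_lt_compat, Rmult_lt_0_compat; [apply lt_0_INR; lia|].
        apply pow_lt, Cmod_gt_0, HN1. }
      nra. }
    apply Rmult_le_reg_r with (E j); [exact Ep|]. rewrite Rmult_1_l.
    eapply Rle_trans; [exact Main|]. right.
    unfold sec. rewrite !Rmult_plus_distr_r.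
    replace (- (RtoC (INR 1) * w j))%C with (- w j)%C by (simpl; ring). fold s2.
    rewrite (Rmult_comm (rsum _ _) (E j)), <- rsum_scal.
    f_equal; [f_equal; field; lra|]. apply rsum_ext. intros i _. field. lra.
  - apply is_lim_seq_const.
  - replace (Finite 0) with (Finite (0 * (2 + Cmod (/ (2 * l)) + / (INR (S Q) * Cmod l ^ 2)) + 0 + 0))
      by (f_equal; ring).
    apply is_lim_seq_plus'; [apply is_lim_seq_plus'|].
    + apply is_lim_seq_mult'; [|exact Lc].
      apply (slow_bound_over_ratio n w (c * l)%C); assumption.
    + apply (Lopp 1%nat). lia.
    + apply is_lim_rsum_0. intros i _. rewrite <- (Rplus_0_r 0).
      apply is_lim_seq_plus'; [apply Lv|]. apply (Lopp (S (S i))). lia.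
Qed.

(** The conditions on the multiples m c l and - m c l all follow from the one at
    m = 1, because among the poles in the unit disk the first is the strongest. *)
Lemma zeros_balance B (n : nat -> nat) (z : nat -> C) (l c : C) :
  is_bernoulli_polynomials B ->
  (forall j, (j <= n j)%nat) -> (forall j, (1 <= n j)%nat) ->
  (forall j, B (n j) (RtoC (INR (n j)) * z j)%C = RtoC 0) ->
  Clim z l -> l <> RtoC 0 -> is_first_pole c -> 0 < Re (c * l) ->
  rate (c * l) = exp 1.
Proof.
  intros HB Hn Hn1 H0 Hz Hl Hc Hre.
  assert (Saddle : 1 < Cmod (c * l) \/ rate (c * l) < exp 1 -> False).
  { intros Hg. apply (no_zeros_when_saddle_dominates B n z l c); auto.
    intros m Hm. assert (M := INR_ge_1 m Hm).
    rewrite Cmod_opp, Cmod_mult, Cmod_R, Rabs_pos_eq by lra.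
    destruct Hg as [Hg|Hg].
    - split; left; nra.
    - destruct (Rle_lt_dec (INR m * Cmod (c * l)) 1) as [D|D];
        [|split; left; exact D].
      split; right; (eapply Rle_lt_trans; [|exact Hg]).
      + destruct (Nat.eq_dec m 1) as [->|E1].
        * right. simpl (INR 1). rewrite Cmult_1_l. reflexivity.
        * left. apply rate_multiple; [exact Hre|lia|exact D].
      + left. apply rate_opposite; assumption. }
  destruct (Rtotal_order (rate (c * l)) (exp 1)) as [H|[H|H]]; [|exact H|]; exfalso.
  - apply Saddle. right. exact H.
  - destruct (Rle_lt_dec (Cmod (c * l)) 1) as [D|D].
    + apply (no_zeros_when_pole_dominates B n z l c); auto.
    + apply Saddle. left. exact D.
Qed.

Lemma rate_first_pole c l : is_first_pole c -> l <> RtoC 0 -> rate (c * l) = exp 1 ->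
  exp (Re (c * l)) = 2 * PI * exp 1 * Cmod l.
Proof.
  intros Hc Hl H. unfold rate in H. rewrite Cmod_mult, (Cmod_first_pole c Hc) in H.
  assert (T := pi_gt_3). assert (P : 0 < Cmod l) by (apply Cmod_gt_0, Hl).
  rewrite <- H. field. split; lra.
Qed.

Theorem theorem1p1
  (B : nat -> C -> C) (HB : is_bernoulli_polynomials B)
  (n : nat -> nat) (z : nat -> C) (zstar : C)
  (n_pos : forall j : nat, (0 < n j)%nat)
  (n_incr : forall j : nat, (n j < n (S j))%nat)
  (B_zero : forall j : nat, B (n j) (Cmult (RtoC (INR (n j))) (z j)) = RtoC 0)
  (z_lim : filterlim z eventually (locally zstar)) :
  ((0 < Im zstar)%R ->
     exp (2 * PI * Im zstar)%R = (2 * PI * exp 1 * Cmod zstar)%R) /\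
  ((Im zstar < 0)%R ->
     exp (-2 * PI * Im zstar)%R = (2 * PI * exp 1 * Cmod zstar)%R).
Proof.
  assert (Hn : forall j, (j <= n j)%nat).
  { induction j as [|j IH]; [lia|]. specialize (n_incr j). lia. }
  assert (Hz : Clim z zstar) by (apply filterlim_Cmod, z_lim).
  assert (T := pi_gt_3).
  split; intros Him.
  - assert (H0 : zstar <> RtoC 0) by (intros E; rewrite E in Him; simpl in Him; lra).
    assert (Hc : is_first_pole (- (C2i * RtoC PI))) by (right; reflexivity).
    assert (E : Re (- (C2i * RtoC PI) * zstar) = 2 * PI * Im zstar)
      by (unfold Re, Im; simpl; ring).
    rewrite <- E. apply (rate_first_pole _ _ Hc H0).
    apply (zeros_balance B n z zstar); auto. rewrite E. nra.
  - assert (H0 : zstar <> RtoC 0) by (intros E; rewrite E in Him; simpl in Him; lra).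
    assert (Hc : is_first_pole (C2i * RtoC PI)) by (left; reflexivity).
    assert (E : Re (C2i * RtoC PI * zstar) = -2 * PI * Im zstar)
      by (unfold Re, Im; simpl; ring).
    rewrite <- E. apply (rate_first_pole _ _ Hc H0).
    apply (zeros_balance B n z zstar); auto. rewrite E. nra.
Qed.
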